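(* In the setting described in the context, let $Y\subset\mathbb{R}^n\times H(f)$ be a connected compact hyperbolic invariant set and let $N=\dim M^u(y)$ ($=\dim V^u(y)$, independent of $y\in Y$). Then for every $y=(x_0,g)\in Y$: (a) for every $x^s\in M^s(y)\setminus\{x_0\}$ with $x^s-x_0\in\Lambda$, one has $\sigma(x^s-x_0)\ge N$; (b) for every $x^u\in M^u(y)\setminus\{x_0\}$ with $x^u-x_0\in\Lambda$, one has $\sigma(x^u-x_0)\le N-1$.
   Context: $\Lambda=\{x\in\mathbb{R}^n: x_1\ne0,\ x_n\ne0,\ \text{and if } x_i=0 \text{ for some } 2\le i\le n-1 \text{ then } x_{i-1}x_{i+1}<0\}$, $\sigma(x)=\#\{i:x_i=0\text{ or }x_ix_{i+1}<0\}$ for $x\in\Lambda$. Setting: the tridiagonal system $\dot x_1=f_1(t,x_1,x_2)$, $\dot x_i=f_i(t,x_{i-1},x_i,x_{i+1})$, $\dot x_n=f_n(t,x_{n-1},x_n)$, with $f$ $C^1$-admissible and $\partial f_i/\partial x_{i+1}\ge\varepsilon_0$, $\partial f_{i+1}/\partial x_i\ge\varepsilon_0>0$; hull $H(f)$ and skew-product flow $\Pi_t(x,g)=(x(t,x,g),g\cdot t)$. For $y=(x_0,g)\in Y$, linearization $\dot z=B(y\cdot t)z$ with $B(y\cdot t)=D_xg(t,x(t,x_0,g))$, fundamental matrix $\Phi(t,y)$. $Y$ hyperbolic: exponential dichotomy over $Y$ (continuous invariant projection $Q(y)$, $K,\alpha>0$, $|\Phi(t,y)(I-Q(y))|\le Ke^{-\alpha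 t}$ for $t\ge0$, $|\Phi(t,y)Q(y)|\le Ke^{\alpha t}$ for $t\le 0$) with $\mathrm{Im}\,Q(y)\ne\{0\}$; $V^u(y)=\mathrm{Im}\,Q(y)$, $V^s(y)=\ker Q(y)$. $W^s(y),W^u(y)$ are the standard local stable/unstable manifolds of $z=0$ for $\dot z=B(y\cdot t)z+G(z,y\cdot t)$ (equation of $z=x-x(t,x_0,g)$): graphs $\{v+h^{s}(v,y):v\in V^s(y),|v|<\delta_*\}$ and $\{v+h^u(v,y):v\in V^u(y),|v|<\delta_*\}$ of $C^1$ maps with $h=o(|v|)$ and derivative norm $\le C_0<1$, satisfying $|\Psi_t(x_s,y)|\le Ce^{-(\alpha/2)t}|x_s|$ ($t\ge0$, $x_s\in W^s(y)$), $|\Psi_t(x_u,y)|\le Ce^{(\alpha/2)t}|x_u|$ ($t\le 0$, $x_u\in W^u(y)$), and overflowing invariance $\Psi_t(W^s(y),y)\subset W^s(y\cdot t)$ for $t\gg1$, $\Psi_t(W^u(y),y)\subset W^u(y\cdot t)$ for $t\ll-1$. $M^{s}(y)=x_0+W^{s}(y)$, $M^u(y)=x_0+W^u(y)$. *)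

(* Defs.v *)
(* classical real numbers. Vectors of R^n are modelled as
   functions nat -> R that vanish at indices >= n (index i stands for the
   paper's coordinate i+1). *)
From Stdlib Require Import Reals.
Open Scope R_scope.

Definition vec := nat -> R.
Definition vfield := R -> vec -> vec.
Definition point := (vec * vfield)%type.

Fixpoint rsum (m : nat) (F : nat -> R) : R :=
  match m with O => 0 | S k => rsum k F + F k end.
Fixpoint nsum (m : nat) (F : nat -> nat) : nat :=
  match m with O => O | S k => (nsum k F + F k)%nat end.

Definition vzero : vec := fun _ => 0.
Definition vadd (x y : vec) : vec := fun i => x i + y i.
Definition vsub (x y : vec) : vec := fun i => x i - y i.
Definition vscal (c : R) (x : vec) : vec := fun i => c * x i.
Definition vupd (x : vec) (j : nat) (s : R) : vec :=
  fun i => if Nat.eqb i j then s else x i.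
Definition inRn (n : nat) (x : vec) : Prop := forall i, (n <= i)%nat -> x i = 0.
Definition vnorm (n : nat) (x : vec) : R := sqrt (rsum n (fun i => x i ^ 2)).

Definition is_jac (n : nat) (g : vfield) (J : R -> vec -> nat -> nat -> R) : Prop :=
  forall t x i j, (i < n)%nat -> (j < n)%nat ->
    derivable_pt_lim (fun s => g t (vupd x j s) i) (x j) (J t x i j).

(* C^1-admissible: f is C^1 in x, and f, D_x f are bounded and uniformly
   continuous on R x K for every compact K (balls suffice). *)
Definition C1_admissible (n : nat) (f : vfield) : Prop :=
  (forall t x, inRn n (f t x)) /\
  exists J, is_jac n f J /\
  forall r, 0 < r ->
    (exists M, forall t x, vnorm n x <= r ->
        vnorm n (f t x) <= M /\
        (forall i j, (i < n)%nat -> (j < n)%nat -> Rabs (J t x i j) <= M)) /\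
    (forall eps, 0 < eps -> exists d, 0 < d /\
       forall t t' x x', vnorm n x <= r -> vnorm n x' <= r ->
         Rabs (t - t') < d -> vnorm n (vsub x x') < d ->
         vnorm n (vsub (f t x) (f t' x')) < eps /\
         (forall i j, (i < n)%nat -> (j < n)%nat ->
            Rabs (J t x i j - J t' x' i j) < eps)).

Definition tridiagonal (n : nat) (f : vfield) : Prop :=
  forall t x x' i, (i < n)%nat ->
    (forall j, (j < n)%nat -> (j <= i + 1)%nat -> (i <= j + 1)%nat -> x j = x' j) ->
    f t x i = f t x' i.

Definition strongly_cooperative (n : nat) (f : vfield) (eps0 : R) : Prop :=
  0 < eps0 /\
  forall J, is_jac n f J -> forall t x i, (i + 1 < n)%nat ->
    eps0 <= J t x i (i + 1)%nat /\ eps0 <= J t x (i + 1)%nat i.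

Definition shift (g : vfield) (tau : R) : vfield := fun t x => g (t + tau) x.

Definition conv_co (n : nat) (gk : nat -> vfield) (g : vfield) : Prop :=
  forall T r eps, 0 < eps -> exists K, forall k, (K <= k)%nat ->
    forall t x, Rabs t <= T -> vnorm n x <= r ->
      vnorm n (vsub (gk k t x) (g t x)) < eps.

(* hull H(f): closure of the translates in the (metrizable) compact-open topology *)
Definition in_hull (n : nat) (f g : vfield) : Prop :=
  (forall t x, inRn n (g t x)) /\
  exists tau : nat -> R, conv_co n (fun k => shift f (tau k)) g.

Definition conv_vec (n : nat) (xk : nat -> vec) (x : vec) : Prop :=
  forall eps, 0 < eps -> exists K, forall k, (K <= k)%nat ->
    vnorm n (vsub (xk k) x) < eps.

Definition conv_pt (n : nat) (yk : nat -> point) (y : point) : Prop :=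
  conv_vec n (fun k => fst (yk k)) (fst y) /\
  conv_co n (fun k => snd (yk k)) (snd y).

Definition in_space (n : nat) (f : vfield) (Y : point -> Prop) : Prop :=
  forall y, Y y -> inRn n (fst y) /\ in_hull n f (snd y).

(* compactness (= sequential compactness, the space being metrizable) *)
Definition compact_set (n : nat) (Y : point -> Prop) : Prop :=
  forall yk : nat -> point, (forall k, Y (yk k)) ->
    exists (phi : nat -> nat) (y : point),
      (forall k, (phi k < phi (S k))%nat) /\ Y y /\ conv_pt n (fun k => yk (phi k)) y.

Definition rel_closed (n : nat) (Y A : point -> Prop) : Prop :=
  forall yk y, (forall k, Y (yk k) /\ A (yk k)) -> Y y -> conv_pt n yk y -> A y.

Definition connected_set (n : nat) (Y : point -> Prop) : Prop :=
  forall A B : point -> Prop,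
    (forall y, Y y -> A y \/ B y) -> (forall y, Y y -> A y -> B y -> False) ->
    rel_closed n Y A -> rel_closed n Y B ->
    (forall y, Y y -> A y) \/ (forall y, Y y -> B y).

Definition is_traj (g : vfield) (u : R -> vec) (P : R -> Prop) : Prop :=
  forall t, P t -> forall i, derivable_pt_lim (fun s => u s i) t (g t (u t) i).

Definition is_flow_on (Y : point -> Prop) (xf : R -> vec -> vfield -> vec) : Prop :=
  forall x0 g, Y (x0, g) -> xf 0 x0 g = x0 /\ is_traj g (fun t => xf t x0 g) (fun _ => True).

Definition Pi (xf : R -> vec -> vfield -> vec) (y : point) (t : R) : point :=
  (xf t (fst y) (snd y), shift (snd y) t).

Definition invariant (Y : point -> Prop) (xf : R -> vec -> vfield -> vec) : Prop :=
  forall y t, Y y -> Y (Pi xf y t).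

Definition is_fundamental (n : nat) (Y : point -> Prop) (xf : R -> vec -> vfield -> vec)
    (Phi : R -> point -> vec -> vec) : Prop :=
  forall x0 g, Y (x0, g) -> forall J, is_jac n g J -> forall v, inRn n v ->
    Phi 0 (x0, g) v = v /\ (forall t, inRn n (Phi t (x0, g) v)) /\
    forall t i, (i < n)%nat ->
      derivable_pt_lim (fun s => Phi s (x0, g) v i) t
        (rsum n (fun j => J t (xf t x0 g) i j * Phi t (x0, g) v j)).

Definition linear_on (n : nat) (A : vec -> vec) : Prop :=
  (forall u, inRn n u -> inRn n (A u)) /\
  forall u v c, inRn n u -> inRn n v ->
    A (vadd u v) = vadd (A u) (A v) /\ A (vscal c u) = vscal c (A u).

Definition exp_dichotomy (n : nat) (Y : point -> Prop) (xf : R -> vec -> vfield -> vec)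
    (Phi : R -> point -> vec -> vec) (Q : point -> vec -> vec) (K alpha : R) : Prop :=
  0 < K /\ 0 < alpha /\
  (forall y, Y y ->
     linear_on n (Q y) /\
     (forall v, inRn n v -> Q y (Q y v) = Q y v) /\
     (forall t v, inRn n v -> Phi t y (Q y v) = Q (Pi xf y t) (Phi t y v)) /\
     (forall t v, 0 <= t -> inRn n v ->
        vnorm n (Phi t y (vsub v (Q y v))) <= K * exp (- alpha * t) * vnorm n v) /\
     (forall t v, t <= 0 -> inRn n v ->
        vnorm n (Phi t y (Q y v)) <= K * exp (alpha * t) * vnorm n v) /\
     (exists v, inRn n v /\ Q y v <> vzero)) /\
  (forall yk y, (forall k, Y (yk k)) -> Y y -> conv_pt n yk y ->
     forall v, inRn n v -> conv_vec n (fun k => Q (yk k) v) (Q y v)).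

Definition Vu (n : nat) (Q : point -> vec -> vec) (y : point) (z : vec) : Prop :=
  exists v, inRn n v /\ z = Q y v.
Definition Vs (n : nat) (Q : point -> vec -> vec) (y : point) (z : vec) : Prop :=
  inRn n z /\ Q y z = vzero.

Definition lincomb (b : nat -> vec) (c : nat -> R) (N : nat) : vec :=
  fun i => rsum N (fun k => c k * b k i).

Definition is_dim (n : nat) (S : vec -> Prop) (N : nat) : Prop :=
  exists b : nat -> vec,
    (forall k, (k < N)%nat -> S (b k)) /\
    (forall c, (forall i, (i < n)%nat -> lincomb b c N i = 0) ->
       forall k, (k < N)%nat -> c k = 0) /\
    (forall z, S z -> exists c, z = lincomb b c N).

Definition graph_map (n : nat) (V W : vec -> Prop) (h : vec -> vec) (delta C0 : R) : Prop :=
  (forall v, V v -> vnorm n v < delta -> W (h v)) /\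
  (forall eps, 0 < eps -> exists d, 0 < d /\ forall v, V v -> vnorm n v < d ->
     vnorm n v < delta -> vnorm n (h v) <= eps * vnorm n v) /\
  exists L : vec -> vec -> vec, forall v, V v -> vnorm n v < delta ->
    (forall w, V w -> vnorm n (L v w) <= C0 * vnorm n w) /\
    (forall eps, 0 < eps -> exists d, 0 < d /\ forall w, V w -> vnorm n w < d ->
       vnorm n (vadd v w) < delta ->
       vnorm n (vsub (vsub (h (vadd v w)) (h v)) (L v w)) <= eps * vnorm n w) /\
    (forall eps, 0 < eps -> exists d, 0 < d /\ forall v', V v' -> vnorm n v' < delta ->
       vnorm n (vsub v' v) < d ->
       forall w, V w -> vnorm n (vsub (L v' w) (L v w)) <= eps * vnorm n w).

Definition Ws (n : nat) (Q : point -> vec -> vec) (hs : point -> vec -> vec) (delta : R)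
    (y : point) (z : vec) : Prop :=
  exists v, Vs n Q y v /\ vnorm n v < delta /\ z = vadd v (hs y v).
Definition Wu (n : nat) (Q : point -> vec -> vec) (hu : point -> vec -> vec) (delta : R)
    (y : point) (z : vec) : Prop :=
  exists v, Vu n Q y v /\ vnorm n v < delta /\ z = vadd v (hu y v).

Definition Ms n Q hs delta (y : point) (x : vec) : Prop :=
  exists z, Ws n Q hs delta y z /\ x = vadd (fst y) z.
Definition Mu n Q hu delta (y : point) (x : vec) : Prop :=
  exists z, Wu n Q hu delta y z /\ x = vadd (fst y) z.

(* properties of the standard local stable manifolds;
   Psi_t(x_s,y) = u(t) - x(t,x0,g) with u the solution through x0 + x_s *)
Definition stable_mfds (n : nat) (Y : point -> Prop) (xf : R -> vec -> vfield -> vec)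
    (Q : point -> vec -> vec) (hs : point -> vec -> vec) (delta C C0 alpha : R) : Prop :=
  0 < delta /\ 0 <= C0 < 1 /\
  forall y, Y y ->
    graph_map n (Vs n Q y) (Vu n Q y) (hs y) delta C0 /\
    exists T, forall xs, Ws n Q hs delta y xs ->
      exists u : R -> vec, u 0 = vadd (fst y) xs /\
        is_traj (snd y) u (fun t => 0 <= t) /\
        (forall t, 0 <= t ->
           vnorm n (vsub (u t) (xf t (fst y) (snd y))) <= C * exp (- (alpha / 2) * t) * vnorm n xs) /\
        (forall t, T <= t -> Ws n Q hs delta (Pi xf y t) (vsub (u t) (xf t (fst y) (snd y)))).

Definition unstable_mfds (n : nat) (Y : point -> Prop) (xf : R -> vec -> vfield -> vec)
    (Q : point -> vec -> vec) (hu : point -> vec -> vec) (delta C C0 alpha : R) : Prop :=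
  0 < delta /\ 0 <= C0 < 1 /\
  forall y, Y y ->
    graph_map n (Vu n Q y) (Vs n Q y) (hu y) delta C0 /\
    exists T, forall xu, Wu n Q hu delta y xu ->
      exists u : R -> vec, u 0 = vadd (fst y) xu /\
        is_traj (snd y) u (fun t => t <= 0) /\
        (forall t, t <= 0 ->
           vnorm n (vsub (u t) (xf t (fst y) (snd y))) <= C * exp ((alpha / 2) * t) * vnorm n xu) /\
        (forall t, t <= - T -> Wu n Q hu delta (Pi xf y t) (vsub (u t) (xf t (fst y) (snd y)))).

(* Lambda and the discrete Lyapunov function sigma (paper's indices shifted by 1) *)
Definition Lambda (n : nat) (x : vec) : Prop :=
  x 0%nat <> 0 /\ x (n - 1)%nat <> 0 /\
  forall i, (1 <= i)%nat -> (i + 2 <= n)%nat -> x i = 0 -> x (i - 1)%nat * x (i + 1)%nat < 0.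

Definition sigma_lap (n : nat) (x : vec) : nat :=
  nsum (n - 1) (fun i =>
    if Req_EM_T (x i) 0 then 1%nat
    else if Rlt_dec (x i * x (i + 1)%nat) 0 then 1%nat else 0%nat).

(* Main.v *)
Require Import Defs.
From Stdlib Require Import Reals Arith Lra Lia Psatz Classical ClassicalEpsilon FunctionalExtensionality.
Open Scope R_scope.

(** The number of sign changes does not increase along differences of solutions, because such a
    difference solves a linear tridiagonal system with positive off-diagonal entries, and it drops
    strictly whenever the first coordinate vanishes.  Rescaling a trajectory of [W^s] (resp. [W^u])
    along a sequence of times going to [+oo] (resp. [-oo]) yields, over a limit point [y'] of the
    orbit, an entire solution of the linearized equation lying in [V^s(y')] (resp. [V^u(y')]), with the
    sign-change bound of the original trajectory valid at all times.  On the other side, dimension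
    counting gives solutions in [V^u(y)] with [N - 1] leading zeros (resp. in [V^s(y)] supported on the
    first [N + 1] coordinates) at prescribed far times, whose rescaled limits have at least [N - 1]
    (resp. at most [N]) sign changes at all times.  If [s] is stable and [u] unstable, choose [c] such
    that [z = u + c s] has vanishing first coordinate at some time: [z] looks like [s] at [-oo], like
    [u] at [+oo], and loses a sign change in between, so [s] has strictly more sign changes than [u]. *)

(** [sigma] counts well only on [Lambda], and neither later states nor rescaled limits need lie
    there. Signs are therefore counted through patterns in which a zero coordinate may receive
    either sign; the minimum and maximum of [changes] over the compatible patterns are the classical
    numbers S^- and S^+, both equal to [sigma] on [Lambda]. The evolution satisfies S^+(later) <=
    S^-(earlier), and the strict loss comes from this form: a vanishing first coordinate makes S^+
    exceed S^- by at least one at that moment. Limits over the orbit are taken because differences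
    of nonlinear solutions cannot be superposed: each solves a linear system whose coefficients
    depend on the difference itself, while [u + c s] needs one common linear equation. The rows
    produced by the mean value theorem have no regularity in time, so the sign analysis rests on
    mean value estimates for the solution and not on integral formulas. Hull elements are only
    locally uniform limits of translates of [f]; their differentiability is recovered from a common
    modulus of continuity of the Jacobians. *)

Lemma rsum_ext (m : nat) (F G : nat -> R) :
  (forall i, (i < m)%nat -> F i = G i) -> rsum m F = rsum m G.
Proof.
  induction m as [|m IH]; intros H; simpl; [reflexivity|].
  rewrite IH by (intros; apply H; lia). rewrite H by lia. reflexivity.
Qed.

Lemma rsum_plus (m : nat) (F G : nat -> R) :
  rsum m (fun i => F i + G i) = rsum m F + rsum m G.
Proof. induction m as [|m IH]; simpl; [|rewrite IH]; ring. Qed.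

Lemma rsum_minus (m : nat) (F G : nat -> R) :
  rsum m (fun i => F i - G i) = rsum m F - rsum m G.
Proof. induction m as [|m IH]; simpl; [|rewrite IH]; ring. Qed.

Lemma rsum_scal (m : nat) (c : R) (F : nat -> R) :
  rsum m (fun i => c * F i) = c * rsum m F.
Proof. induction m as [|m IH]; simpl; [|rewrite IH]; ring. Qed.

Lemma rsum_zero (m : nat) (F : nat -> R) :
  (forall i, (i < m)%nat -> F i = 0) -> rsum m F = 0.
Proof.
  induction m as [|m IH]; intros H; simpl; [reflexivity|].
  rewrite IH by (intros; apply H; lia). rewrite H by lia. ring.
Qed.

Lemma rsum_le (m : nat) (F G : nat -> R) :
  (forall i, (i < m)%nat -> F i <= G i) -> rsum m F <= rsum m G.
Proof.
  induction m as [|m IH]; intros H; simpl; [lra|].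
  apply Rplus_le_compat; [apply IH; intros; apply H; lia | apply H; lia].
Qed.

Lemma rsum_const (m : nat) (c : R) : rsum m (fun _ => c) = INR m * c.
Proof. induction m as [|m IH]; [simpl; ring|]. rewrite S_INR; simpl; rewrite IH; ring. Qed.

Lemma rsum_nonneg (m : nat) (F : nat -> R) :
  (forall i, (i < m)%nat -> 0 <= F i) -> 0 <= rsum m F.
Proof.
  intros H. rewrite <- (rsum_zero m (fun _ => 0)) by reflexivity. apply rsum_le; exact H.
Qed.

Lemma rsum_term_le (m : nat) (F : nat -> R) (i : nat) :
  (forall i, (i < m)%nat -> 0 <= F i) -> (i < m)%nat -> F i <= rsum m F.
Proof.
  induction m as [|m IH]; intros H Hi; [lia|]; simpl.
  assert (0 <= rsum m F) by (apply rsum_nonneg; intros; apply H; lia).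
  assert (0 <= F m) by (apply H; lia).
  destruct (Nat.eq_dec i m) as [->|ne]; [lra|].
  assert (F i <= rsum m F) by (apply IH; [intros; apply H; lia|lia]). lra.
Qed.

Lemma rsum_abs (m : nat) (F : nat -> R) : Rabs (rsum m F) <= rsum m (fun i => Rabs (F i)).
Proof.
  induction m as [|m IH]; simpl; [rewrite Rabs_R0; lra|].
  eapply Rle_trans; [apply Rabs_triang|]; lra.
Qed.

Lemma rsum_abs_bound (m : nat) (F : nat -> R) (c : R) :
  (forall i, (i < m)%nat -> Rabs (F i) <= c) -> Rabs (rsum m F) <= INR m * c.
Proof.
  intros H. eapply Rle_trans; [apply rsum_abs|]. rewrite <- rsum_const. apply rsum_le; exact H.
Qed.

(** Adding [b] makes every term nonnegative, so the sum dominates the single shifted term. It serves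
    when one term is large and the others are at worst slightly negative. *)
Lemma rsum_lower_bound (m : nat) (F : nat -> R) (b c : R) (i : nat) :
  0 <= b -> (forall i, (i < m)%nat -> - b <= F i) -> (i < m)%nat -> c <= F i ->
  c - INR m * b <= rsum m F.
Proof.
  intros Hb H Hi Hc.
  assert (Hq : F i + b <= rsum m (fun i => F i + b)).
  { apply (rsum_term_le m (fun i => F i + b)); [|exact Hi].
    intros k Hk; specialize (H k Hk); lra. }
  rewrite rsum_plus, rsum_const in Hq. lra.
Qed.

Lemma rsum_swap (m p : nat) (F : nat -> nat -> R) :
  rsum m (fun i => rsum p (fun j => F i j)) = rsum p (fun j => rsum m (fun i => F i j)).
Proof.
  induction m as [|m IH]; simpl.
  - symmetry; apply rsum_zero; reflexivity.
  - rewrite IH, <- rsum_plus. reflexivity.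
Qed.

Lemma rsum_delta (m : nat) (F : nat -> R) (k : nat) :
  (k < m)%nat -> rsum m (fun j => F j * (if Nat.eqb j k then 1 else 0)) = F k.
Proof.
  induction m as [|m IH]; intros Hk; [lia|]; simpl.
  destruct (Nat.eq_dec k m) as [->|ne].
  - rewrite Nat.eqb_refl, rsum_zero; [ring|].
    intros i Hi. destruct (Nat.eqb_spec i m); [lia|ring].
  - rewrite IH by lia. destruct (Nat.eqb_spec m k); [lia|ring].
Qed.

Lemma Un_cv_rsum (m : nat) (F : nat -> nat -> R) (G : nat -> R) :
  (forall i, (i < m)%nat -> Un_cv (fun k => F k i) (G i)) ->
  Un_cv (fun k => rsum m (F k)) (rsum m G).
Proof.
  induction m as [|m IH]; intros H; simpl.
  - intros e He; exists 0%nat; intros; unfold Rdist; rewrite Rminus_diag, Rabs_R0; exact He.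
  - apply CV_plus; [apply IH; intros; apply H; lia | apply H; lia].
Qed.

Lemma derivable_pt_lim_rsum (m : nat) (F : nat -> R -> R) (G : nat -> R) (t : R) :
  (forall i, (i < m)%nat -> derivable_pt_lim (F i) t (G i)) ->
  derivable_pt_lim (fun s => rsum m (fun i => F i s)) t (rsum m G).
Proof.
  induction m as [|m IH]; intros H; simpl.
  - apply derivable_pt_lim_const.
  - apply (derivable_pt_lim_plus (fun s => rsum m (fun i => F i s)) (F m));
      [apply IH; intros; apply H; lia | apply H; lia].
Qed.

(** * The Euclidean norm and its comparison with coordinates *)

Lemma sq_sum_nonneg (n : nat) (x : vec) : 0 <= rsum n (fun i => x i ^ 2).
Proof. apply rsum_nonneg; intros; apply pow2_ge_0. Qed.

Lemma vnorm_nonneg (n : nat) (x : vec) : 0 <= vnorm n x.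
Proof. apply sqrt_pos. Qed.

Lemma coord_le_vnorm (n : nat) (x : vec) (i : nat) : (i < n)%nat -> Rabs (x i) <= vnorm n x.
Proof.
  intros Hi. rewrite <- sqrt_Rsqr_abs. apply sqrt_le_1_alt. rewrite Rsqr_pow2.
  apply (rsum_term_le n (fun i => x i ^ 2)); [intros; apply pow2_ge_0|exact Hi].
Qed.

(** The factor [INR n] is cruder than its square root, but only the equivalence with the sup norm
    matters. *)
Lemma vnorm_le_bound (n : nat) (x : vec) (c : R) :
  0 <= c -> (forall i, (i < n)%nat -> Rabs (x i) <= c) -> vnorm n x <= INR n * c.
Proof.
  intros Hc H. pose proof (pos_INR n) as Hn.
  rewrite <- (sqrt_Rsqr (INR n * c)) by nra. apply sqrt_le_1_alt.
  apply Rle_trans with (rsum n (fun _ => c ^ 2)).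
  - apply rsum_le; intros i Hi. specialize (H i Hi). rewrite <- (pow2_abs (x i)).
    pose proof (Rabs_pos (x i)). nra.
  - rewrite rsum_const. unfold Rsqr. destruct n as [|n]; [simpl; lra|].
    assert (1 <= INR (S n)) by (rewrite S_INR; pose proof (pos_INR n); lra).
    assert (0 <= c ^ 2) by nra. nra.
Qed.

Lemma vnorm_ext (n : nat) (x x' : vec) :
  (forall i, (i < n)%nat -> x i = x' i) -> vnorm n x = vnorm n x'.
Proof. intros H. unfold vnorm. f_equal. apply rsum_ext. intros; rewrite H; auto. Qed.

Lemma vnorm_scal (n : nat) (c : R) (x : vec) : vnorm n (vscal c x) = Rabs c * vnorm n x.
Proof.
  unfold vnorm, vscal. rewrite <- sqrt_Rsqr_abs, <- sqrt_mult;
    [|apply Rle_0_sqr|apply sq_sum_nonneg].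
  rewrite <- rsum_scal. f_equal. apply rsum_ext; intros; unfold Rsqr; ring.
Qed.

Lemma vnorm_sub_le (n : nat) (x y : vec) : vnorm n (vsub x y) <= INR n * (vnorm n x + vnorm n y).
Proof.
  pose proof (vnorm_nonneg n x); pose proof (vnorm_nonneg n y).
  apply vnorm_le_bound; [lra|]. intros i Hi. unfold vsub.
  pose proof (coord_le_vnorm n x i Hi); pose proof (coord_le_vnorm n y i Hi).
  eapply Rle_trans; [apply Rabs_triang|]. rewrite Rabs_Ropp. lra.
Qed.

Lemma vnorm_le0_coord (n : nat) (x : vec) :
  vnorm n x <= 0 -> forall i, (i < n)%nat -> x i = 0.
Proof.
  intros H i Hi. pose proof (coord_le_vnorm n x i Hi). pose proof (Rabs_pos (x i)).
  destruct (Req_dec (x i) 0) as [|ne]; [assumption|]. pose proof (Rabs_pos_lt _ ne). lra.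
Qed.

Lemma vnorm_le0_vzero (n : nat) (x : vec) : inRn n x -> vnorm n x <= 0 -> x = vzero.
Proof.
  intros Hx H. extensionality i. destruct (le_lt_dec n i) as [Hi|Hi].
  - rewrite (Hx i Hi); reflexivity.
  - apply (vnorm_le0_coord n x H i Hi).
Qed.

Lemma vnorm_pos (n : nat) (x : vec) (i : nat) : (i < n)%nat -> x i <> 0 -> 0 < vnorm n x.
Proof. intros Hi H. pose proof (coord_le_vnorm n x i Hi). pose proof (Rabs_pos_lt _ H). lra. Qed.

(** * Coordinatewise convergence and extraction of subsequences *)

Definition vcv (n : nat) (xk : nat -> vec) (x : vec) : Prop :=
  forall i, (i < n)%nat -> Un_cv (fun k => xk k i) (x i).

Lemma finite_threshold (n : nat) (P : nat -> nat -> Prop) :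
  (forall i, (i < n)%nat -> exists K, forall k, (K <= k)%nat -> P i k) ->
  exists K, forall k, (K <= k)%nat -> forall i, (i < n)%nat -> P i k.
Proof.
  induction n as [|n IH]; intros H; [exists 0%nat; intros; lia|].
  destruct IH as [K1 H1]; [intros; apply H; lia|].
  destruct (H n) as [K2 H2]; [lia|].
  exists (Nat.max K1 K2). intros k Hk i Hi.
  destruct (Nat.eq_dec i n) as [->|]; [apply H2; lia|apply H1; lia].
Qed.

Lemma finite_radius (n : nat) (P : nat -> R -> Prop) :
  (forall i d d', P i d -> 0 < d' <= d -> P i d') ->
  (forall i, (i < n)%nat -> exists d, 0 < d /\ P i d) ->
  exists d, 0 < d /\ forall i, (i < n)%nat -> P i d.
Proof.
  intros Hm. induction n as [|n IH]; intros H; [exists 1; split; [lra|intros; lia]|].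
  destruct IH as [d1 [p1 H1]]; [intros; apply H; lia|].
  destruct (H n) as [d2 [p2 H2]]; [lia|].
  exists (Rmin d1 d2). assert (0 < Rmin d1 d2) by (apply Rmin_pos; lra).
  split; [assumption|]. intros i Hi.
  pose proof (Rmin_l d1 d2); pose proof (Rmin_r d1 d2).
  destruct (Nat.eq_dec i n) as [->|];
    [apply (Hm n d2); [assumption|lra] | apply (Hm i d1); [apply H1; lia|lra]].
Qed.

Lemma finite_bound (n : nat) (P : nat -> R -> Prop) :
  (forall i c c', P i c -> c <= c' -> P i c') ->
  (forall i, (i < n)%nat -> exists c, P i c) ->
  exists c, 0 < c /\ forall i, (i < n)%nat -> P i c.
Proof.
  intros Hm. induction n as [|n IH]; intros H; [exists 1; split; [lra|intros; lia]|].
  destruct IH as [c1 [p1 H1]]; [intros; apply H; lia|].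
  destruct (H n) as [c2 H2]; [lia|].
  exists (Rmax c1 c2). pose proof (Rmax_l c1 c2); pose proof (Rmax_r c1 c2).
  split; [lra|]. intros i Hi.
  destruct (Nat.eq_dec i n) as [->|];
    [apply (Hm n c2); assumption | apply (Hm i c1); [apply H1; lia|assumption]].
Qed.

Lemma vcv_unif (n : nat) (xk : nat -> vec) (x : vec) :
  vcv n xk x -> forall eps, 0 < eps ->
  exists K, forall k, (K <= k)%nat -> forall i, (i < n)%nat -> Rabs (xk k i - x i) < eps.
Proof.
  intros H eps He. apply finite_threshold. intros i Hi.
  destruct (H i Hi eps He) as [K HK]. exists K. intros k Hk. apply HK; lia.
Qed.

Lemma conv_vec_vcv (n : nat) (xk : nat -> vec) (x : vec) : conv_vec n xk x -> vcv n xk x.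
Proof.
  intros H i Hi eps He. destruct (H eps He) as [K HK]. exists K. intros k Hk.
  unfold Rdist. eapply Rle_lt_trans; [|apply (HK k); lia].
  apply (coord_le_vnorm n (vsub (xk k) x) i Hi).
Qed.

Lemma small_multiple (n : nat) (eps : R) : 0 < eps -> exists d, 0 < d /\ INR n * d < eps.
Proof.
  intros He. pose proof (pos_INR n) as Hn. exists (eps / (INR n + 1)).
  assert (0 < INR n + 1) by lra.
  assert (0 < eps / (INR n + 1)) by (apply Rdiv_lt_0_compat; lra).
  split; [assumption|].
  replace eps with ((INR n + 1) * (eps / (INR n + 1))) at 2 by (field; lra). nra.
Qed.

Lemma vcv_conv_vec (n : nat) (xk : nat -> vec) (x : vec) : vcv n xk x -> conv_vec n xk x.
Proof.
  intros H eps He. destruct (small_multiple n eps He) as [d [Hd Hlt]].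
  destruct (vcv_unif n xk x H d Hd) as [K HK]. exists K. intros k Hk.
  eapply Rle_lt_trans; [|exact Hlt]. apply vnorm_le_bound; [lra|].
  intros i Hi. apply Rlt_le, (HK k Hk i Hi).
Qed.

Lemma vcv_vnorm (n : nat) (xk : nat -> vec) (x : vec) :
  vcv n xk x -> Un_cv (fun k => vnorm n (xk k)) (vnorm n x).
Proof.
  intros H. unfold vnorm.
  apply (continuity_seq sqrt (fun k => rsum n (fun i => xk k i ^ 2))).
  - apply continuity_pt_sqrt, sq_sum_nonneg.
  - apply Un_cv_rsum. intros i Hi.
    apply (continuity_seq (fun s => s ^ 2) (fun k => xk k i)); [|apply H; exact Hi].
    apply derivable_continuous_pt, derivable_pt_pow.
Qed.

Definition increasing_index (phi : nat -> nat) : Prop := forall k, (phi k < phi (S k))%nat.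

Lemma increasing_index_ge (phi : nat -> nat) (k : nat) : increasing_index phi -> (k <= phi k)%nat.
Proof. intros H. induction k as [|k IH]; [lia|]. specialize (H k). lia. Qed.

Lemma increasing_index_comp (phi psi : nat -> nat) :
  increasing_index phi -> increasing_index psi -> increasing_index (fun k => phi (psi k)).
Proof.
  intros Hp Hq k.
  assert (mono : forall a b, (a < b)%nat -> (phi a < phi b)%nat).
  { intros a b Hab. induction Hab as [|b Hab IH]; [apply Hp|]. specialize (Hp b). lia. }
  apply mono, Hq.
Qed.

Lemma Un_cv_subseq (u : nat -> R) (l : R) (phi : nat -> nat) :
  increasing_index phi -> Un_cv u l -> Un_cv (fun k => u (phi k)) l.
Proof.
  intros Hphi H eps He. destruct (H eps He) as [K HK]. exists K. intros k Hk. apply HK.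
  pose proof (increasing_index_ge phi k Hphi). lia.
Qed.

Lemma Un_cv_subsequence_of_bounded (u : nat -> R) (B : R) :
  (forall k, Rabs (u k) <= B) ->
  exists phi l, increasing_index phi /\ Un_cv (fun k => u (phi k)) l.
Proof.
  intros Hb.
  destruct (Bolzano_Weierstrass u (fun x => - B <= x <= B) (compact_P3 (- B) B)) as [l Hl].
  { intros k. specialize (Hb k). unfold Rabs in Hb; destruct Rcase_abs; lra. }
  assert (next : forall k N : nat, exists p : nat, (N < p)%nat /\ Rabs (u p - l) < / INR (S k)).
  { intros k N.
    assert (Hpos : 0 < / INR (S k)) by (apply Rinv_0_lt_compat, lt_0_INR; lia).
    destruct (Hl (disc l (mkposreal _ Hpos)) (S N)) as [p [Hp Hd]].
    - exists (mkposreal _ Hpos). intros x Hx; exact Hx.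
    - exists p. split; [lia|exact Hd]. }
  set (nx := fun k N => proj1_sig (constructive_indefinite_description _ (next k N))).
  assert (Hnx : forall k N, (N < nx k N)%nat /\ Rabs (u (nx k N) - l) < / INR (S k)).
  { intros k N. exact (proj2_sig (constructive_indefinite_description _ (next k N))). }
  (* By the choice of [nx], each index exceeds the previous one and its term lies within 1/(k+1) of
     the cluster point. *)
  set (phi := fix phi k := match k with O => nx O O | S k' => nx (S k') (phi k') end).
  assert (Hphi : forall k, Rabs (u (phi k) - l) < / INR (S k)) by (intros [|k]; apply Hnx).
  exists phi, l. split; [intros k; simpl; apply Hnx|].
  intros eps He. destruct (archimed_cor1 eps He) as [N [HN HN0]].
  exists N. intros k Hk. eapply Rlt_trans; [apply Hphi|]. eapply Rle_lt_trans; [|exact HN].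
  apply Rinv_le_contravar; [apply lt_0_INR; lia|apply le_INR; lia].
Qed.

(** Each induction step refines the subsequence found for the previous coordinates, which leaves
    their limits unchanged. *)
Lemma vcv_subsequence_of_bounded (n : nat) (xk : nat -> vec) (B : R) :
  (forall k i, (i < n)%nat -> Rabs (xk k i) <= B) ->
  exists phi x, increasing_index phi /\ inRn n x /\ vcv n (fun k => xk (phi k)) x.
Proof.
  induction n as [|n IH]; intros Hb.
  - exists (fun k => k), vzero. repeat split; [intros k; lia|intros i Hi; lia].
  - destruct IH as [phi [x [Hphi [Hx Hc]]]]; [intros; apply Hb; lia|].
    destruct (Un_cv_subsequence_of_bounded (fun k => xk (phi k) n) B) as [psi [l [Hpsi Hl]]].
    { intros k; apply Hb; lia. }
    exists (fun k => phi (psi k)), (vupd x n l). split; [|split].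
    + apply increasing_index_comp; assumption.
    + intros i Hi. unfold vupd. destruct (Nat.eqb_spec i n); [lia|apply Hx; lia].
    + intros i Hi. unfold vupd. destruct (Nat.eqb_spec i n) as [->|ne]; [exact Hl|].
      apply (Un_cv_subseq (fun k => xk (phi k) i)); [exact Hpsi|apply Hc; lia].
Qed.

(** * Sign patterns *)

(** A choice of signs, [true] for positive, that leaves zero coordinates free. Minimising or
    maximising [changes] over compatible patterns gives S^- and S^+. *)
Definition compat (n : nat) (e : nat -> bool) (x : vec) : Prop :=
  forall i, (i < n)%nat -> (0 < x i -> e i = true) /\ (x i < 0 -> e i = false).

Definition changes (m : nat) (e : nat -> bool) : nat :=
  nsum m (fun i => if Bool.eqb (e i) (e (i + 1)%nat) then 0%nat else 1%nat).

Definition sign_pattern (x : vec) : nat -> bool := fun i => if Rlt_dec 0 (x i) then true else false.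

Lemma compat_sign_pattern (n : nat) (x : vec) : compat n (sign_pattern x) x.
Proof. intros i _. unfold sign_pattern. destruct Rlt_dec; split; intros; auto; lra. Qed.

Lemma compat_scal (n : nat) (e : nat -> bool) (c : R) (x : vec) :
  0 < c -> compat n e (vscal c x) <-> compat n e x.
Proof.
  intros Hc. unfold vscal. split; intros H i Hi; destruct (H i Hi) as [H1 H2]; split; intros Hx.
  - apply H1; nra.
  - apply H2; nra.
  - apply H1; nra.
  - apply H2; nra.
Qed.

Lemma compat_ext (n : nat) (e : nat -> bool) (x x' : vec) :
  (forall i, (i < n)%nat -> x i = x' i) -> compat n e x -> compat n e x'.
Proof. intros Hx H i Hi. rewrite <- Hx by exact Hi. apply H; exact Hi. Qed.

Lemma changes_S (m : nat) (e : nat -> bool) :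
  changes (S m) e =
  (changes m e + (if Bool.eqb (e m) (e (S m)) then 0 else 1))%nat.
Proof. unfold changes; simpl. replace (m + 1)%nat with (S m) by lia. reflexivity. Qed.

Lemma changes_between (e : nat -> bool) (a b : nat) :
  (a <= b)%nat -> (changes a e + (if Bool.eqb (e a) (e b) then 0 else 1) <= changes b e)%nat.
Proof.
  induction 1 as [|b Hab IH]; [rewrite Bool.eqb_reflx; lia|].
  rewrite changes_S. destruct (e a), (e b), (e (S b)); simpl in *; lia.
Qed.

(** Reading [e'] along a monotone sequence of indices never creates a change: one seen between [j i]
    and [j (S i)] occurs somewhere in that stretch of [e'], and the stretches do not overlap. *)
Lemma changes_reindex (m m' : nat) (e e' : nat -> bool) (j : nat -> nat) :
  (forall i, (i < m)%nat -> (j i <= j (S i))%nat) ->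
  (forall i, (i <= m)%nat -> e i = e' (j i)) -> (j m <= m')%nat ->
  (changes m e <= changes m' e')%nat.
Proof.
  intros Hj He Hm.
  assert (H : forall k, (k <= m)%nat -> (changes k e <= changes (j k) e')%nat).
  { induction k as [|k IH]; intros Hk; [unfold changes; simpl; lia|].
    rewrite changes_S, (He k), (He (S k)) by lia.
    pose proof (changes_between e' (j k) (j (S k)) (Hj k ltac:(lia))). specialize (IH ltac:(lia)). lia. }
  specialize (H m (le_n m)). pose proof (changes_between e' (j m) m' Hm). lia.
Qed.

(** The pattern of the vector multiplied by alternating signs. It turns a change into a non-change
    and conversely at every adjacent pair, hence exchanges minima and maxima of [changes]. *)
Definition flip (e : nat -> bool) : nat -> bool := fun i => xorb (e i) (Nat.odd i).

Lemma changes_flip (m : nat) (e : nat -> bool) : (changes m e + changes m (flip e) = m)%nat.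
Proof.
  induction m as [|m IH]; [reflexivity|]. rewrite !changes_S. unfold flip at 2 3.
  rewrite Nat.odd_succ, <- Nat.negb_odd.
  destruct (e m), (e (S m)), (Nat.odd m); simpl in *; lia.
Qed.

Lemma changes_le (m : nat) (e : nat -> bool) : (changes m e <= m)%nat.
Proof. pose proof (changes_flip m e). lia. Qed.

(** On [Lambda] a zero sits between opposite signs, so whichever sign it receives, exactly one of
    its two adjacent pairs is a change; [sigma_lap] charges that change to the zero itself. *)
Lemma changes_Lambda (n : nat) (x : vec) (e : nat -> bool) :
  (2 <= n)%nat -> Lambda n x -> compat n e x -> changes (n - 1) e = sigma_lap n x.
Proof.
  intros Hn [H0 [Hlast Hmid]] He. unfold sigma_lap.
  set (s := fun i => if Req_EM_T (x i) 0 then 1%nat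
                     else if Rlt_dec (x i * x (i + 1)%nat) 0 then 1%nat else 0%nat).
  assert (sg : forall i, (i < n)%nat -> x i <> 0 ->
             (0 < x i /\ e i = true) \/ (x i < 0 /\ e i = false)).
  { intros i Hi Hx. destruct (He i Hi). destruct (Rtotal_order (x i) 0) as [|[|]]; auto; lra. }
  (* [nsum m s] does not yet charge a zero at [m], whereas the pattern may already change on
     entering it; the extra term is this early change. *)
  assert (H : forall m, (m < n)%nat ->
             (x m <> 0 -> changes m e = nsum m s) /\
             (x m = 0 -> changes m e =
                (nsum m s + (if Bool.eqb (e (m - 1)%nat) (e m) then 0 else 1))%nat)).
  { induction m as [|m IH]; intros Hm.
    - split; [reflexivity|intros; contradiction].
    - destruct (IH ltac:(lia)) as [IH1 IH2]. clear IH.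
      rewrite changes_S. simpl nsum. replace (S m - 1)%nat with m by lia.
      assert (Es : s m = if Req_EM_T (x m) 0 then 1%nat
                     else if Rlt_dec (x m * x (S m)) 0 then 1%nat else 0%nat).
      { unfold s. replace (m + 1)%nat with (S m) by lia. reflexivity. }
      rewrite Es. split; intros Hx.
      + destruct (Req_EM_T (x m) 0) as [Hz|Hz].
        * rewrite (IH2 Hz).
          assert (Hm1 : (1 <= m)%nat) by (destruct m; [contradiction|lia]).
          pose proof (Hmid m Hm1 ltac:(lia) Hz) as Hopp.
          replace (m + 1)%nat with (S m) in Hopp by lia.
          destruct (sg (m - 1)%nat ltac:(lia)) as [[? Ea]|[? Ea]]; [intros Hc; rewrite Hc in Hopp; lra| |];
          destruct (sg (S m) ltac:(lia) Hx) as [[? Eb]|[? Eb]]; try nra;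
          rewrite Ea, Eb; destruct (e m); simpl; lia.
        * rewrite (IH1 Hz). destruct (sg m ltac:(lia) Hz) as [[? Ea]|[? Ea]];
          destruct (sg (S m) ltac:(lia) Hx) as [[? Eb]|[? Eb]]; rewrite Ea, Eb;
          destruct Rlt_dec; simpl; try lia; exfalso; nra.
      + assert (Hz : x m <> 0).
        { intros Hz. destruct (Nat.eq_dec (S m) (n - 1)) as [E|E]; [rewrite <- E in Hlast; contradiction|].
          pose proof (Hmid (S m) ltac:(lia) ltac:(lia) Hx) as Hopp.
          replace (S m - 1)%nat with m in Hopp by lia. rewrite Hz in Hopp; lra. }
        rewrite (IH1 Hz). destruct (Req_EM_T (x m) 0); [contradiction|].
        destruct Rlt_dec as [Hlt|]; [exfalso; rewrite Hx in Hlt; lra|]. lia. }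
  destruct (H (n - 1)%nat ltac:(lia)) as [H1 _]. apply H1; exact Hlast.
Qed.

(** With the first sign free, copying the second sign avoids a change and opposing it adds exactly
    one. This is the source of the strict drop in [stable_unstable_gap]. *)
Lemma compat_flip_first (n : nat) (x : vec) :
  (2 <= n)%nat -> x 0%nat = 0 ->
  exists e e', compat n e x /\ compat n e' x /\ (changes (n - 1) e + 1 = changes (n - 1) e')%nat.
Proof.
  intros Hn H0.
  set (e0 := sign_pattern x).
  set (mk := fun b i => match i with O => b | S _ => e0 i end).
  assert (Hc : forall b, compat n (mk b) x).
  { intros b [|i] Hi; [split; intros; lra|]. apply (compat_sign_pattern n x (S i) Hi). }
  exists (mk (e0 1%nat)), (mk (negb (e0 1%nat))). do 2 (split; [apply Hc|]).
  assert (Hk : forall k, (changes (S k) (mk (e0 1%nat)) + 1 = changes (S k) (mk (negb (e0 1%nat))))%nat).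
  { induction k as [|k IH].
    - unfold changes; simpl. destruct (e0 1%nat); reflexivity.
    - rewrite (changes_S (S k)), (changes_S (S k) (mk (negb (e0 1%nat)))). simpl mk. lia. }
  destruct n as [|[|n]]; try lia. simpl. apply Hk.
Qed.

Lemma compat_leading_zeros (n q : nat) (x : vec) :
  (q < n)%nat -> (forall i, (i < q)%nat -> x i = 0) ->
  exists e, compat n e x /\ (q <= changes (n - 1) e)%nat.
Proof.
  intros Hq Hz.
  set (e0 := sign_pattern x).
  (* Signs alternate backwards from position [q], so each of the first [q] adjacent pairs is a
     change. *)
  set (e := fun i => if Nat.ltb i q then xorb (e0 q) (Nat.odd (q - i)) else e0 i).
  exists e. split.
  - intros i Hi. unfold e. destruct (Nat.ltb_spec i q) as [Hlt|Hge].
    + rewrite (Hz i Hlt). split; intros; lra.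
    + exact (compat_sign_pattern n x i Hi).
  - assert (H : forall k, (k <= q)%nat -> changes k e = k).
    { induction k as [|k IH]; intros Hk; [reflexivity|].
      rewrite changes_S, IH by lia.
      assert (E : Bool.eqb (e k) (e (S k)) = false).
      { unfold e. destruct (Nat.ltb_spec k q); [|lia].
        replace (q - k)%nat with (S (q - S k)) by lia.
        rewrite Nat.odd_succ, <- Nat.negb_odd.
        destruct (Nat.ltb_spec (S k) q).
        - destruct (e0 q), (Nat.odd (q - S k)); reflexivity.
        - replace (S k) with q by lia. rewrite Nat.sub_diag.
          destruct (e0 q); reflexivity. }
      rewrite E. lia. }
    rewrite <- (H q (le_n q)) at 1. pose proof (changes_between e q (n - 1) ltac:(lia)). lia.
Qed.

Lemma compat_trailing_zeros (n p : nat) (x : vec) :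
  (p < n)%nat -> (forall i, (p < i)%nat -> (i < n)%nat -> x i = 0) ->
  exists e, compat n e x /\ (changes (n - 1) e <= p)%nat.
Proof.
  intros Hp Hz.
  set (e0 := sign_pattern x).
  (* The zeros beyond [p] all inherit the sign at [p], so changes occur only among the first [p]
     pairs. *)
  set (e := fun i => e0 (Nat.min i p)).
  exists e. split.
  - intros i Hi. unfold e. destruct (le_lt_dec i p) as [Hle|Hgt].
    + rewrite Nat.min_l by exact Hle. exact (compat_sign_pattern n x i Hi).
    + rewrite (Hz i Hgt Hi). split; intros; lra.
  - eapply Nat.le_trans; [|apply (changes_le p e0)].
    apply (changes_reindex _ _ e e0 (fun i => Nat.min i p)); intros; [lia|reflexivity|lia].
Qed.

(** Strict signs of the limit are eventually shared by the sequence, and coordinates vanishing in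
    the limit accept any sign. The implication carries the existence of a good pattern from the
    sequence to the limit, and a bound on all patterns from the limit back to the sequence. *)
Lemma compat_limit (n : nat) (xk : nat -> vec) (x : vec) :
  vcv n xk x -> exists K, forall k, (K <= k)%nat -> forall e, compat n e (xk k) -> compat n e x.
Proof.
  intros H.
  assert (Ht : exists K, forall k, (K <= k)%nat -> forall i, (i < n)%nat ->
             (0 < x i -> 0 < xk k i) /\ (x i < 0 -> xk k i < 0)).
  { apply finite_threshold. intros i Hi. destruct (Req_dec (x i) 0) as [Hz|Hz].
    - exists 0%nat. intros; lra.
    - destruct (H i Hi (Rabs (x i)) (Rabs_pos_lt _ Hz)) as [K HK]. exists K. intros k Hk.
      specialize (HK k Hk). unfold Rdist, Rabs in HK.
      destruct (Rcase_abs (x i)), (Rcase_abs (xk k i - x i)); lra. }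
  destruct Ht as [K HK]. exists K. intros k Hk e He i Hi.
  destruct (HK k Hk i Hi), (He i Hi). auto.
Qed.

(** * Variation diminishing along tridiagonal cooperative systems *)

(** The row [A] is chosen separately for each time and index, with no continuity in [t]: this is
    what the mean value theorem delivers for a difference of nonlinear solutions. Only the bounds
    [M] and [eps] are uniform. *)
Definition tri_system (n : nat) (M eps : R) (w : R -> vec) (a b : R) : Prop :=
  forall t, a <= t <= b -> forall i, (i < n)%nat ->
    exists A : nat -> R,
      (forall j, (j < n)%nat -> Rabs (A j) <= M) /\
      (forall j, (j < n)%nat -> (j + 1 < i \/ i + 1 < j)%nat -> A j = 0) /\
      (forall j, (j < n)%nat -> (j = i + 1 \/ i = j + 1)%nat -> eps <= A j) /\
      derivable_pt_lim (fun s => w s i) t (rsum n (fun j => A j * w t j)).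

(** A [tri_system] gives derivatives pointwise, without naming a derivative function; choice
    supplies one to which the mean value theorem applies. *)
Lemma MVT_ex (f : R -> R) (a b : R) :
  a < b -> (forall c, a <= c <= b -> exists l, derivable_pt_lim f c l) ->
  exists c l, a < c < b /\ derivable_pt_lim f c l /\ f b - f a = l * (b - a).
Proof.
  intros Hab H.
  set (f' := fun c => epsilon (inhabits 0) (derivable_pt_lim f c)).
  assert (Hf' : forall c, a <= c <= b -> derivable_pt_lim f c (f' c)).
  { intros c Hc. unfold f'. apply epsilon_spec, H, Hc. }
  destruct (MVT_cor2 f f' a b Hab Hf') as [c [E Hc]].
  exists c, (f' c). split; [exact Hc|split; [apply Hf'; lra|exact E]].
Qed.

Lemma continuous_bounded_on (f : R -> R) (a b : R) :
  a <= b -> (forall c, a <= c <= b -> continuity_pt f c) ->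
  exists C, forall c, a <= c <= b -> Rabs (f c) <= C.
Proof.
  intros Hab Hf.
  destruct (continuity_ab_maj f a b Hab Hf) as [c1 [H1 _]].
  destruct (continuity_ab_min f a b Hab Hf) as [c2 [H2 _]].
  exists (Rabs (f c1) + Rabs (f c2)). intros c Hc. specialize (H1 c Hc). specialize (H2 c Hc).
  unfold Rabs. repeat destruct Rcase_abs; lra.
Qed.

Lemma derivable_pt_lim_continuity (f : R -> R) (t l : R) :
  derivable_pt_lim f t l -> continuity_pt f t.
Proof. intros H. apply derivable_continuous_pt. exists l. exact H. Qed.

(** Truncated subtraction makes one summand zero, so this is the distance |i - j|. *)
Definition ndist (i j : nat) : nat := (i - j + (j - i))%nat.

Definition dist_to_support (n : nat) (x : vec) (D : nat -> nat) : Prop :=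
  forall i, (exists j, (j < n)%nat /\ x j <> 0 /\ ndist i j = D i) /\
            (forall j, (j < n)%nat -> x j <> 0 -> (D i <= ndist i j)%nat).

Lemma dist_to_support_exists (n : nat) (x : vec) :
  (exists i, (i < n)%nat /\ x i <> 0) -> exists D, dist_to_support n x D.
Proof.
  intros [i0 [Hi0 Hx0]].
  assert (H : forall i, exists d, (exists j, (j < n)%nat /\ x j <> 0 /\ ndist i j = d) /\
            (forall j, (j < n)%nat -> x j <> 0 -> (d <= ndist i j)%nat)).
  { intros i.
    destruct (dec_inh_nat_subset_has_unique_least_element
                (fun d => exists j, (j < n)%nat /\ x j <> 0 /\ ndist i j = d))
      as [d [[H1 H2] _]].
    - intros d. apply classic.
    - exists (ndist i i0), i0. auto.
    - exists d. split; [exact H1|]. intros j Hj Hxj. apply H2. exists j. auto. }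
  exists (fun i => proj1_sig (constructive_indefinite_description _ (H i))).
  intros i. exact (proj2_sig (constructive_indefinite_description _ (H i))).
Qed.

(** * Signs just after the initial time of a tridiagonal cooperative system *)

Section LocalVariation.

Variables (n : nat) (M eps : R) (w : R -> vec) (a b : R) (D : nat -> nat).
Hypothesis Heps : 0 < eps.
Hypothesis Hab : a < b.
Hypothesis Hsys : tri_system n M eps w a b.
Hypothesis HD : dist_to_support n (w a) D.

(** Capping the elapsed time at 1 makes higher powers of it no larger than lower ones. *)
Let h := Rmin 1 (b - a).

Local Lemma h_pos : 0 < h.
Proof. apply Rmin_pos; lra. Qed.

Local Lemma h_le : h <= 1 /\ a + h <= b.
Proof. pose proof (Rmin_l 1 (b - a)); pose proof (Rmin_r 1 (b - a)). unfold h; lra. Qed.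

Local Lemma M_nonneg : forall i, (i < n)%nat -> 0 <= M.
Proof.
  intros i Hi. destruct (Hsys a ltac:(lra) i Hi) as [A [HA _]].
  eapply Rle_trans; [apply (Rabs_pos (A i))|apply HA; exact Hi].
Qed.

Local Lemma dist_neighbour (i j : nat) : (i <= j + 1)%nat -> (j <= i + 1)%nat -> (D i <= D j + 1)%nat.
Proof.
  intros Hij Hji. destruct (HD j) as [[k [Hk [Hx E]]] _]. destruct (HD i) as [_ H].
  specialize (H k Hk Hx). unfold ndist in *. lia.
Qed.

Local Lemma dist_pos_zero (i : nat) : (i < n)%nat -> (0 < D i)%nat -> w a i = 0.
Proof.
  intros Hi Hd. destruct (HD i) as [_ H]. apply NNPP; intros Hx.
  specialize (H i Hi Hx). unfold ndist in H. lia.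
Qed.

(** A coordinate at distance d from the support of [w a] is reached through d successive couplings,
    and each gains one power of [tau]. The induction raises the exponent, capped as
    [Nat.min k (D i)] so that all coordinates improve simultaneously. *)
Local Lemma order_of_vanishing_upper : exists C, 0 < C /\
  forall i, (i < n)%nat -> forall tau, 0 <= tau <= h -> Rabs (w (a + tau) i) <= C * tau ^ D i.
Proof.
  pose proof h_pos as Hh. destruct h_le as [Hh1 Hhb].
  assert (Hk : forall k, exists C, 0 < C /\ forall i, (i < n)%nat -> forall tau, 0 <= tau <= h ->
             Rabs (w (a + tau) i) <= C * tau ^ Nat.min k (D i)).
  { induction k as [|k [C [HC IH]]].
    - destruct (finite_bound n (fun i C => forall tau, 0 <= tau <= h -> Rabs (w (a + tau) i) <= C))
        as [C [HC H]].
      + intros i c c' H Hc tau Ht. eapply Rle_trans; [apply H; exact Ht|exact Hc].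
      + intros i Hi. destruct (continuous_bounded_on (fun s => w s i) a b ltac:(lra)) as [C HC].
        * intros c Hc. destruct (Hsys c Hc i Hi) as [A [_ [_ [_ HA]]]].
          eapply derivable_pt_lim_continuity; exact HA.
        * exists C. intros tau Ht. apply HC. lra.
      + exists C. split; [exact HC|]. intros i Hi tau Ht. simpl. rewrite Rmult_1_r. apply H; assumption.
    - exists (C + INR n * (M * C)).
      pose proof (pos_INR n) as Hn.
      assert (HnM : 0 <= INR n * (M * C)).
      { destruct (Nat.eq_dec n 0) as [E|E]; [rewrite E; simpl; lra|]. pose proof (M_nonneg 0%nat ltac:(lia)).
        apply Rmult_le_pos; [assumption|nra]. }
      split; [lra|]. intros i Hi tau Ht.
      pose proof (pow_le tau (Nat.min (S k) (D i)) ltac:(lra)) as Hpw.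
      destruct (le_lt_dec (D i) k) as [Hd|Hd].
      + specialize (IH i Hi tau Ht). replace (Nat.min k (D i)) with (Nat.min (S k) (D i)) in IH by lia.
        nra.
      + replace (Nat.min (S k) (D i)) with (S k) in * by lia.
        destruct (Req_dec tau 0) as [E|E].
        * rewrite E, Rplus_0_r, (dist_pos_zero i Hi) by lia. rewrite Rabs_R0. simpl. nra.
        * destruct (MVT_ex (fun s => w s i) a (a + tau) ltac:(lra)) as [c [l [Hc [Hl El]]]].
          { intros c Hc. destruct (Hsys c ltac:(lra) i Hi) as [A [_ [_ [_ HA]]]]. eexists; exact HA. }
          destruct (Hsys c ltac:(lra) i Hi) as [A [HA1 [HA2 [HA3 HA4]]]].
          pose proof (uniqueness_limite _ _ _ _ Hl HA4) as El2.
          rewrite (dist_pos_zero i Hi), Rminus_0_r in El by lia. rewrite El.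
          assert (Hlb : Rabs l <= INR n * (M * (C * tau ^ k))).
          { rewrite El2. apply rsum_abs_bound. intros j Hj. rewrite Rabs_mult.
            assert (HCk : 0 <= C * tau ^ k) by (pose proof (pow_le tau k ltac:(lra)); nra).
            pose proof (M_nonneg j Hj) as HM.
            destruct (le_lt_dec i (j + 1)) as [H1|H1]; [destruct (le_lt_dec j (i + 1)) as [H2|H2]|].
            - apply Rmult_le_compat; try apply Rabs_pos; [apply HA1; exact Hj|].
              specialize (IH j Hj (c - a) ltac:(lra)). replace (a + (c - a)) with c in IH by ring.
              pose proof (dist_neighbour i j H1 H2).
              replace (Nat.min k (D j)) with k in IH by lia.
              assert ((c - a) ^ k <= tau ^ k) by (apply pow_incr; lra).
              eapply Rle_trans; [exact IH|]. nra.
            - rewrite HA2 by (auto; lia). rewrite Rabs_R0, Rmult_0_l. apply Rmult_le_pos; assumption.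
            - rewrite HA2 by (auto; lia). rewrite Rabs_R0, Rmult_0_l. apply Rmult_le_pos; assumption. }
          rewrite Rabs_mult. replace (a + tau - a) with tau by ring.
          rewrite (Rabs_right tau) by lra. simpl.
          assert (Hpk : 0 <= tau ^ k) by (apply pow_le; lra).
          apply Rle_trans with (INR n * (M * (C * tau ^ k)) * tau); [nra|].
          assert (0 <= C * (tau * tau ^ k)) by (apply Rmult_le_pos; [lra|apply Rmult_le_pos; lra]). lra. }
  destruct (finite_threshold n (fun i k => (D i <= k)%nat)) as [k0 Hk0].
  { intros i _. exists (D i). auto. }
  destruct (Hk k0) as [C [HC H]]. exists C. split; [exact HC|].
  intros i Hi tau Ht. specialize (H i Hi tau Ht).
  rewrite Nat.min_r in H by (apply Hk0; [lia|exact Hi]). exact H.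
Qed.

(** A coordinate may have a nearest support coordinate on each side; all of them must carry the sign
    [s], so that their influences do not compete. *)
Definition nearest_sign (s : R) (i : nat) : Prop :=
  forall j, (j < n)%nat -> w a j <> 0 -> ndist i j = D i -> 0 < s * w a j.

(** Induction on the distance: a neighbour one step closer to the support inherits the sign
    condition and pushes coordinate [i] with strength at least [eps * c0 * tau ^ d], while
    coordinates at distance above d, including [i] itself, contribute O([tau ^ S d]) by the upper
    estimate. *)
Local Lemma order_of_vanishing_lower (s : R) : s = 1 \/ s = -1 ->
  forall d, exists c, 0 < c /\ forall i, (i < n)%nat ->
    D i = d -> nearest_sign s i -> forall tau, 0 < tau <= c -> c * tau ^ d <= s * w (a + tau) i.
Proof.
  intros Hs. pose proof h_pos as Hh. destruct h_le as [Hh1 Hhb].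
  destruct order_of_vanishing_upper as [C [HC HU]].
  assert (Habs : forall r, Rabs (s * r) = Rabs r).
  { intros r. destruct Hs as [-> | ->].
    - f_equal; ring.
    - replace (-1 * r) with (- r) by ring. apply Rabs_Ropp. }
  assert (mono : forall (d i : nat) (c c' : R),
     (D i = d -> nearest_sign s i -> forall tau, 0 < tau <= c -> c * tau ^ d <= s * w (a + tau) i) ->
     0 < c' <= c ->
     (D i = d -> nearest_sign s i -> forall tau, 0 < tau <= c' -> c' * tau ^ d <= s * w (a + tau) i)).
  { intros d i c c' H Hc HDi Hn tau Ht. specialize (H HDi Hn tau ltac:(lra)).
    pose proof (pow_le tau d ltac:(lra)). nra. }
  induction d as [|d [c0 [Hc0 IH]]]; apply (finite_radius n); try (intros i c c'; apply mono); intros i Hi.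
  - destruct (Nat.eq_dec (D i) 0) as [Hd|Hd]; [|exists 1; split; [lra|intros; lia]].
    destruct (classic (nearest_sign s i)) as [Hns|Hns]; [|exists 1; split; [lra|intros; contradiction]].
    assert (Hpos : 0 < s * w a i).
    { destruct (HD i) as [[j [Hj [Hx E]]] _].
      assert (j = i) by (unfold ndist in E; lia). subst j. apply Hns; auto. }
    destruct (Hsys a ltac:(lra) i Hi) as [A [_ [_ [_ HA]]]].
    pose proof (derivable_pt_lim_continuity _ _ _ HA) as Hct.
    destruct (Hct (s * w a i / 2) ltac:(lra)) as [al [Hal Hct']].
    exists (Rmin (al / 2) (s * w a i / 2)).
    pose proof (Rmin_l (al / 2) (s * w a i / 2)) as Hm1; pose proof (Rmin_r (al / 2) (s * w a i / 2)) as Hm2.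
    split; [apply Rmin_pos; lra|]. intros _ _ tau Ht. simpl. rewrite Rmult_1_r.
    assert (Hcl : Rabs (w (a + tau) i - w a i) < s * w a i / 2).
    { apply (Hct' (a + tau)). split; [split; [exact I|lra]|].
      simpl. unfold Rdist. replace (a + tau - a) with tau by ring. rewrite Rabs_right; lra. }
    rewrite <- Habs in Hcl. unfold Rabs in Hcl. destruct Rcase_abs in Hcl; lra.
  - destruct (Nat.eq_dec (D i) (S d)) as [Hd|Hd]; [|exists 1; split; [lra|intros; contradiction]].
    destruct (classic (nearest_sign s i)) as [Hns|Hns]; [|exists 1; split; [lra|intros; contradiction]].
    pose proof (pos_INR n) as Hn. pose proof (M_nonneg i Hi) as HM.
    set (B := INR n * (M * C)).
    assert (HB : 0 <= B) by (apply Rmult_le_pos; [assumption|nra]).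
    (* Half of the push is kept as growth: [kap * tau ^ S d] has derivative
       [eps * c0 / 2 * tau ^ d]. The other half absorbs the terms of order [S d], which is what [r]
       ensures; [B + 1] avoids a zero denominator. *)
    set (kap := eps * c0 / 2 / INR (S d)).
    assert (HSd : 0 < INR (S d)) by (apply lt_0_INR; lia).
    assert (Hec : 0 < eps * c0) by nra.
    assert (Hkap : 0 < kap) by (unfold kap; apply Rdiv_lt_0_compat; lra).
    set (r := eps * c0 / 2 / (B + 1)).
    assert (Hr : 0 < r) by (unfold r; apply Rdiv_lt_0_compat; lra).
    assert (HrB : r * B <= eps * c0 / 2).
    { replace (eps * c0 / 2) with (r * (B + 1)) by (unfold r; field; lra). nra. }
    set (c := Rmin (Rmin h c0) (Rmin r kap)).
    assert (Hc1 : c <= h /\ c <= c0 /\ c <= r /\ c <= kap).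
    { unfold c. pose proof (Rmin_l (Rmin h c0) (Rmin r kap)); pose proof (Rmin_r (Rmin h c0) (Rmin r kap)).
      pose proof (Rmin_l h c0); pose proof (Rmin_r h c0). pose proof (Rmin_l r kap); pose proof (Rmin_r r kap). lra. }
    exists c. split; [unfold c; repeat apply Rmin_pos; lra|]. intros _ _ tau Ht.
    assert (Hnb : exists j0, (j0 < n)%nat /\ (j0 = i + 1 \/ i = j0 + 1)%nat /\ D j0 = d).
    { destruct (HD i) as [[k [Hk [Hxk Ek]]] _]. rewrite Hd in Ek. unfold ndist in Ek.
      assert (Hj : exists j0, (j0 < n)%nat /\ (j0 = i + 1 \/ i = j0 + 1)%nat /\ ndist j0 k = d).
      { destruct (le_lt_dec k i).
        - exists (i - 1)%nat. unfold ndist. lia.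
        - exists (i + 1)%nat. unfold ndist. lia. }
      destruct Hj as [j0 [Hj0 [Hadj Ej0]]]. exists j0. repeat split; auto.
      destruct (HD j0) as [_ Hmin]. specialize (Hmin k Hk Hxk).
      pose proof (dist_neighbour i j0 ltac:(lia) ltac:(lia)). lia. }
    assert (Hins : forall j, (j < n)%nat -> (j = i + 1 \/ i = j + 1)%nat -> D j = d -> nearest_sign s j).
    { intros j Hj Hadj Edj k Hk Hxk Ek. apply Hns; auto.
      destruct (HD i) as [_ Hmin]. specialize (Hmin k Hk Hxk). unfold ndist in *. lia. }
    (* Both [w z i] and the monomial vanish at [a], so a nonnegative slope of the difference yields
       the lower bound. *)
    destruct (MVT_ex (fun z => s * w z i - kap * (z - a) ^ S d) a (a + tau) ltac:(lra)) as [z [l [Hz [Hl El]]]].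
    { intros z Hz. destruct (Hsys z ltac:(lra) i Hi) as [A [_ [_ [_ HA]]]].
      eexists. apply (derivable_pt_lim_minus (fun z => s * w z i) (fun z => kap * (z - a) ^ S d)).
      - apply (derivable_pt_lim_scal (fun z => w z i)); exact HA.
      - apply (derivable_pt_lim_scal (fun z => (z - a) ^ S d)).
        apply (derivable_pt_lim_comp (fun z => z - a) (fun z => z ^ S d)).
        + apply (derivable_pt_lim_minus (fun z => z) (fun _ => a));
            [apply derivable_pt_lim_id|apply derivable_pt_lim_const].
        + apply derivable_pt_lim_pow. }
    destruct (Hsys z ltac:(lra) i Hi) as [A [HA1 [HA2 [HA3 HA]]]].
    assert (Hl2 : derivable_pt_lim (fun z => s * w z i - kap * (z - a) ^ S d) z
                   (s * rsum n (fun j => A j * w z j) - kap * (INR (S d) * (z - a) ^ d * (1 - 0)))).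
    { apply (derivable_pt_lim_minus (fun z => s * w z i) (fun z => kap * (z - a) ^ S d)).
      - apply (derivable_pt_lim_scal (fun z => w z i)); exact HA.
      - apply (derivable_pt_lim_scal (fun z => (z - a) ^ S d)).
        apply (derivable_pt_lim_comp (fun z => z - a) (fun z => z ^ S d)).
        + apply (derivable_pt_lim_minus (fun z => z) (fun _ => a));
            [apply derivable_pt_lim_id|apply derivable_pt_lim_const].
        + apply (derivable_pt_lim_pow (z - a) (S d)). }
    pose proof (uniqueness_limite _ _ _ _ Hl Hl2) as El2. clear Hl Hl2.
    set (q := z - a) in *. assert (Hq : 0 < q < tau) by (unfold q; lra).
    assert (Hqd : 0 <= q ^ d) by (apply pow_le; lra).
    assert (Ez : z = a + q) by (unfold q; ring).
    assert (Hlow : eps * c0 * q ^ d - INR n * (M * (C * q ^ S d)) <= s * rsum n (fun j => A j * w z j)).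
    { rewrite <- rsum_scal.
      assert (HCq : 0 <= C * q ^ S d) by (pose proof (pow_le q (S d) ltac:(lra)); nra).
      assert (Hsmall : forall j, (j < n)%nat -> (S d <= D j)%nat -> - (M * (C * q ^ S d)) <= s * (A j * w z j)).
      { intros j Hj HDj.
        assert (Rabs (s * (A j * w z j)) <= M * (C * q ^ S d)).
        { rewrite Habs, Rabs_mult. apply Rmult_le_compat; try apply Rabs_pos; [apply HA1; exact Hj|].
          rewrite Ez. eapply Rle_trans; [apply HU; [exact Hj|lra]|].
          apply Rmult_le_compat_l; [lra|]. replace (D j) with (S d + (D j - S d))%nat by lia.
          rewrite pow_add. pose proof (pow_le q (S d) ltac:(lra)).
          assert (q ^ (D j - S d) <= 1) by (rewrite <- (pow1 (D j - S d)); apply pow_incr; lra). nra. }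
        unfold Rabs in H. destruct Rcase_abs in H; lra. }
      assert (Hbig : forall j, (j < n)%nat -> (j = i + 1 \/ i = j + 1)%nat -> D j = d ->
                eps * c0 * q ^ d <= s * (A j * w z j)).
      { intros j Hj Hadj Edj.
        pose proof (IH j Hj Edj (Hins j Hj Hadj Edj) q ltac:(lra)) as Hj1. rewrite <- Ez in Hj1.
        pose proof (HA3 j Hj Hadj). replace (s * (A j * w z j)) with (A j * (s * w z j)) by ring.
        assert (0 <= c0 * q ^ d) by nra.
        apply Rle_trans with (eps * (s * w z j)); [nra|]. apply Rmult_le_compat_r; lra. }
      destruct Hnb as [j0 [Hj0 [Hadj0 Ej0]]].
      apply rsum_lower_bound with j0; auto; [nra|].
      intros j Hj. destruct (le_lt_dec (S d) (D j)) as [|Hlt]; [apply Hsmall; assumption|].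
      assert (j <> i) by (intros ->; lia).
      assert (H0 : 0 <= M * (C * q ^ S d)) by nra.
      destruct (le_lt_dec i (j + 1)) as [H1|H1]; [destruct (le_lt_dec j (i + 1)) as [H2|H2]|].
      - pose proof (dist_neighbour i j H1 H2). pose proof (Hbig j Hj ltac:(lia) ltac:(lia)).
        assert (0 <= eps * c0 * q ^ d) by nra. lra.
      - rewrite HA2 by (auto; lia). rewrite Rmult_0_l, Rmult_0_r. lra.
      - rewrite HA2 by (auto; lia). rewrite Rmult_0_l, Rmult_0_r. lra. }
    assert (Hlpos : 0 <= l).
    { rewrite El2.
      replace (kap * (INR (S d) * q ^ d * (1 - 0))) with (eps * c0 / 2 * q ^ d)
        by (unfold kap; field; lra).
      replace (INR n * (M * (C * q ^ S d))) with (q * B * q ^ d) in Hlow by (unfold B; simpl; ring).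
      assert (q * B <= eps * c0 / 2) by nra. nra. }
    rewrite (dist_pos_zero i Hi) in El by lia.
    replace (a + tau - a) with tau in El by ring. replace (a - a) with 0 in El by ring.
    rewrite pow_i in El by lia.
    assert (0 <= l * tau) by nra.
    apply Rle_trans with (kap * tau ^ S d); [|lra].
    apply Rmult_le_compat_r; [apply pow_le; lra|lra].
Qed.

(** Just after [a], a coordinate whose nearest support coordinates share one sign has that sign; if
    they disagree, either sign occurs among them. So a pattern at [t] is a pattern at [a] read along
    nearest support indices, which bounds S^+ at [t] by S^- at [a]. *)
Local Lemma variation_local : exists r, 0 < r /\ forall t, a < t <= a + r ->
  forall e e', compat n e (w t) -> compat n e' (w a) -> (changes (n - 1) e <= changes (n - 1) e')%nat.
Proof.
  assert (Hsig : forall s, s = 1 \/ s = -1 -> exists r, 0 < r /\ forall i, (i < n)%nat ->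
            nearest_sign s i -> forall tau, 0 < tau <= r -> 0 < s * w (a + tau) i).
  { intros s Hs. apply (finite_radius n (fun i r => nearest_sign s i -> forall tau, 0 < tau <= r -> 0 < s * w (a + tau) i)).
    - intros i d d' H Hd Hns tau Ht. apply H; [exact Hns|lra].
    - intros i Hi. destruct (order_of_vanishing_lower s Hs (D i)) as [c [Hc H]].
      exists c. split; [exact Hc|]. intros Hns tau Ht. specialize (H i Hi eq_refl Hns tau Ht).
      pose proof (pow_lt tau (D i) ltac:(lra)). nra. }
  destruct (Hsig 1 (or_introl eq_refl)) as [r1 [Hr1 H1]].
  destruct (Hsig (-1) (or_intror eq_refl)) as [r2 [Hr2 H2]].
  exists (Rmin r1 r2). split; [apply Rmin_pos; lra|].
  pose proof (Rmin_l r1 r2); pose proof (Rmin_r r1 r2). intros t Ht e e' He He'.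
  (* [e] is [e'] read along a monotone choice of nearest support indices. *)
  assert (Hch : forall i, exists j, (i < n)%nat ->
     ((j < n)%nat /\ w a j <> 0 /\ ndist i j = D i /\ e i = e' j)).
  { intros i. destruct (le_lt_dec n i) as [Hi|Hi]; [exists 0%nat; intros; lia|].
    apply NNPP; intros Hno.
    assert (Hne : forall j, (j < n)%nat -> w a j <> 0 -> ndist i j = D i -> e i <> e' j).
    { intros j Hj Hx E Hee. apply Hno. exists j. auto. }
    destruct (He i Hi) as [Hp Hm]. destruct (e i) eqn:Ei.
    - assert (Hns : nearest_sign (-1) i).
      { intros j Hj Hx E. specialize (Hne j Hj Hx E). destruct (He' j Hj) as [Hp' _].
        destruct (Rtotal_order (w a j) 0) as [|[|]]; [lra|contradiction|].
        rewrite Hp' in Hne by assumption. contradiction. }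
      specialize (H2 i Hi Hns (t - a) ltac:(lra)). replace (a + (t - a)) with t in H2 by ring.
      specialize (Hm ltac:(lra)). discriminate.
    - assert (Hns : nearest_sign 1 i).
      { intros j Hj Hx E. specialize (Hne j Hj Hx E). destruct (He' j Hj) as [_ Hm'].
        destruct (Rtotal_order (w a j) 0) as [|[|]]; [|contradiction|lra].
        rewrite Hm' in Hne by assumption. contradiction. }
      specialize (H1 i Hi Hns (t - a) ltac:(lra)). replace (a + (t - a)) with t in H1 by ring.
      specialize (Hp ltac:(lra)). discriminate. }
  set (j := fun i => proj1_sig (constructive_indefinite_description _ (Hch i))).
  assert (Hj : forall i, (i < n)%nat ->
     ((j i < n)%nat /\ w a (j i) <> 0 /\ ndist i (j i) = D i /\ e i = e' (j i))).
  { intros i. exact (proj2_sig (constructive_indefinite_description _ (Hch i))). }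
  destruct (Nat.eq_dec n 0) as [En|En]; [rewrite En; unfold changes; simpl; lia|].
  apply changes_reindex with j.
  (* Nearest choices cannot cross: if [j (S i) < j i], one of the two indices would be strictly
     closer to the choice of the other. *)
  - intros i Hi. destruct (Hj i ltac:(lia)) as [A1 [A2 [A3 _]]]. destruct (Hj (S i) ltac:(lia)) as [B1 [B2 [B3 _]]].
    destruct (HD i) as [_ Ha]. specialize (Ha _ B1 B2). destruct (HD (S i)) as [_ Hb]. specialize (Hb _ A1 A2).
    unfold ndist in *. lia.
  - intros i Hi. apply Hj. lia.
  - destruct (Hj (n - 1)%nat ltac:(lia)) as [A1 _]. lia.
Qed.

End LocalVariation.

Definition nonzero_on (n : nat) (w : R -> vec) (a b : R) : Prop :=
  forall t, a <= t <= b -> exists i, (i < n)%nat /\ w t i <> 0.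

Lemma variation_right (n : nat) (M eps : R) (w : R -> vec) (a b : R) :
  0 < eps -> a < b -> tri_system n M eps w a b -> nonzero_on n w a b ->
  exists r, 0 < r /\ forall t, a < t <= a + r ->
  forall e e', compat n e (w t) -> compat n e' (w a) -> (changes (n - 1) e <= changes (n - 1) e')%nat.
Proof.
  intros Heps Hab Hs Hnz.
  destruct (dist_to_support_exists n (w a) (Hnz a ltac:(lra))) as [D HD].
  exact (variation_local n M eps w a b D Heps Hab Hs HD).
Qed.

Definition parity (i : nat) : R := if Nat.odd i then -1 else 1.

(* Time reversal combined with alternating signs preserves the class of tridiagonal cooperative
   systems and exchanges minimal and maximal numbers of sign changes. *)
Definition reversed (w : R -> vec) : R -> vec := fun t i => parity i * w (- t) i.

Lemma parity_sq (i : nat) : parity i * parity i = 1.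
Proof. unfold parity; destruct Nat.odd; ring. Qed.

Lemma parity_S (i : nat) : parity (S i) = - parity i.
Proof. unfold parity. rewrite Nat.odd_succ, <- Nat.negb_odd. destruct Nat.odd; simpl; ring. Qed.

Lemma tri_system_reversed (n : nat) (M eps : R) (w : R -> vec) (a b : R) :
  tri_system n M eps w a b -> tri_system n M eps (reversed w) (- b) (- a).
Proof.
  intros H t Ht i Hi. destruct (H (- t) ltac:(lra) i Hi) as [A [HA1 [HA2 [HA3 HA4]]]].
  exists (fun j => - (parity i * parity j) * A j). repeat split.
  - intros j Hj. rewrite Rabs_mult.
    replace (Rabs (- (parity i * parity j))) with 1; [rewrite Rmult_1_l; auto|].
    rewrite Rabs_Ropp. unfold parity. destruct (Nat.odd i), (Nat.odd j);
      unfold Rabs; destruct Rcase_abs; lra.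
  - intros j Hj Hij. rewrite HA2 by auto. ring.
  - intros j Hj Hij. specialize (HA3 j Hj Hij).
    replace (- (parity i * parity j)) with 1; [lra|].
    destruct Hij as [E|E]; rewrite E, Nat.add_1_r, parity_S;
      [pose proof (parity_sq i)|pose proof (parity_sq j)]; lra.
  - replace (rsum n (fun j => - (parity i * parity j) * A j * reversed w t j))
      with (parity i * (rsum n (fun j => A j * w (- t) j) * - 1)).
    + apply (derivable_pt_lim_scal (fun s => w (- s) i)).
      apply (derivable_pt_lim_comp (fun s => - s) (fun s => w s i)); [|exact HA4].
      apply (derivable_pt_lim_opp (fun s => s)), derivable_pt_lim_id.
    + rewrite <- Rmult_assoc, (Rmult_comm _ (-1)), <- Rmult_assoc, <- rsum_scal. apply rsum_ext.
      intros j _. unfold reversed. pose proof (parity_sq j).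
      replace (- (parity i * parity j) * A j * (parity j * w (- t) j))
        with (- parity i * A j * w (- t) j * (parity j * parity j)) by ring. rewrite H0. ring.
Qed.

Lemma compat_reversed (n : nat) (w : R -> vec) (t : R) (e : nat -> bool) :
  compat n e (w t) -> compat n (flip e) (reversed w (- t)).
Proof.
  intros H i Hi. unfold reversed, flip, parity. rewrite Ropp_involutive.
  destruct (H i Hi) as [H1 H2]. destruct (Nat.odd i); split; intros Hx.
  - rewrite H2 by lra; reflexivity.
  - rewrite H1 by lra; reflexivity.
  - rewrite H1 by lra; reflexivity.
  - rewrite H2 by lra; reflexivity.
Qed.

(** The forward statement is applied to the time-reversed, sign-alternated solution: [flip] replaces
    [changes] by [n - 1] minus it, so the reversal of time and the reversal of the inequality
    cancel. *)
Lemma variation_left (n : nat) (M eps : R) (w : R -> vec) (a b : R) :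
  0 < eps -> a < b -> tri_system n M eps w a b -> nonzero_on n w a b ->
  exists r, 0 < r /\ forall t, b - r <= t < b ->
  forall e e', compat n e (w b) -> compat n e' (w t) -> (changes (n - 1) e <= changes (n - 1) e')%nat.
Proof.
  intros Heps Hab Hs Hnz.
  destruct (variation_right n M eps (reversed w) (- b) (- a) Heps ltac:(lra)) as [r [Hr H]].
  - apply tri_system_reversed; exact Hs.
  - intros t Ht. destruct (Hnz (- t) ltac:(lra)) as [i [Hi Hx]]. exists i. split; [exact Hi|].
    unfold reversed, parity. destruct Nat.odd; lra.
  - exists r. split; [exact Hr|]. intros t Ht e e' He He'.
    specialize (H (- t) ltac:(lra) (flip e') (flip e) (compat_reversed n w t e' He') (compat_reversed n w b e He)).
    pose proof (changes_flip (n - 1) e); pose proof (changes_flip (n - 1) e'). lia.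
Qed.

Lemma tri_system_sub (n : nat) (M eps : R) (w : R -> vec) (a b a' b' : R) :
  a <= a' -> b' <= b -> tri_system n M eps w a b -> tri_system n M eps w a' b'.
Proof. intros Ha Hb H t Ht. apply H; lra. Qed.

Lemma nonzero_on_sub (n : nat) (w : R -> vec) (a b a' b' : R) :
  a <= a' -> b' <= b -> nonzero_on n w a b -> nonzero_on n w a' b'.
Proof. intros Ha Hb H t Ht. apply H; lra. Qed.

(** Let [m] be the supremum of the times up to which the claim holds: [variation_left] includes [m]
    itself, and [variation_right] would pass beyond it if [m < b]. Links are chained through any
    pattern of an intermediate state, since the local statements compare all patterns. *)
Lemma variation_diminishing (n : nat) (M eps : R) (w : R -> vec) (a b : R) :
  0 < eps -> a < b -> tri_system n M eps w a b -> nonzero_on n w a b ->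
  forall e e', compat n e (w b) -> compat n e' (w a) -> (changes (n - 1) e <= changes (n - 1) e')%nat.
Proof.
  intros Heps Hab Hs Hnz.
  set (P := fun t => forall e e', compat n e (w t) -> compat n e' (w a) ->
              (changes (n - 1) e <= changes (n - 1) e')%nat).
  set (E := fun t => a < t <= b /\ forall t', a < t' <= t -> P t').
  destruct (variation_right n M eps w a b Heps Hab Hs Hnz) as [r [Hr HR]].
  assert (HE0 : E (Rmin b (a + r))).
  { pose proof (Rmin_l b (a + r)); pose proof (Rmin_r b (a + r)).
    split; [split; [apply Rmin_glb_lt; lra|lra]|]. intros t' Ht'. intros e e'. apply HR. lra. }
  destruct (completeness E) as [m [Hm1 Hm2]].
  { exists b. intros t [Ht _]. lra. }
  { eexists; exact HE0. }
  assert (Ham : a < m).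
  { specialize (Hm1 _ HE0). destruct HE0 as [? _]. lra. }
  assert (Hmb : m <= b) by (apply Hm2; intros t [Ht _]; lra).
  assert (Hbelow : forall t, a < t < m -> P t).
  { intros t Ht. apply NNPP; intros Hn.
    assert (m <= t); [|lra]. apply Hm2. intros t1 [Ht1 HP].
    destruct (Rle_lt_dec t1 t); [assumption|]. exfalso. apply Hn, HP. lra. }
  assert (HPm : P m).
  { destruct (variation_left n M eps w a m Heps Ham) as [r' [Hr' HL]].
    - eapply tri_system_sub; [| |exact Hs]; lra.
    - eapply nonzero_on_sub; [| |exact Hnz]; lra.
    - intros e e' He He'. set (t := Rmax ((a + m) / 2) (m - r')).
      assert (Ht : (a + m) / 2 <= t /\ m - r' <= t /\ t < m).
      { unfold t. pose proof (Rmax_l ((a + m) / 2) (m - r')); pose proof (Rmax_r ((a + m) / 2) (m - r')).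
        repeat split; auto. apply Rmax_lub_lt; lra. }
      pose proof (compat_sign_pattern n (w t)) as Hp.
      pose proof (HL t ltac:(lra) e _ He Hp). pose proof (Hbelow t ltac:(lra) _ e' Hp He'). lia. }
  destruct (Rle_lt_or_eq_dec m b Hmb) as [Hlt|Heq].
  - exfalso. destruct (variation_right n M eps w m b Heps Hlt) as [r' [Hr' HR']].
    + eapply tri_system_sub; [| |exact Hs]; lra.
    + eapply nonzero_on_sub; [| |exact Hnz]; lra.
    + set (t1 := Rmin b (m + r')).
      assert (Ht1 : t1 <= b /\ t1 <= m + r' /\ m < t1).
      { unfold t1. pose proof (Rmin_l b (m + r')); pose proof (Rmin_r b (m + r')).
        repeat split; auto. apply Rmin_glb_lt; lra. }
      assert (t1 <= m); [|lra]. apply Hm1. split; [lra|]. intros t' Ht'.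
      destruct (Rtotal_order t' m) as [Hl|[->|Hg]]; [apply Hbelow; lra|exact HPm|].
      intros e e' He He'. pose proof (compat_sign_pattern n (w m)) as Hp.
      pose proof (HR' t' ltac:(lra) e _ He Hp). pose proof (HPm _ e' Hp He'). lia.
  - rewrite <- Heq. exact HPm.
Qed.

(** * Gronwall estimates *)

(** A bound on the absolute value of the derivative works in both time directions: [F] times a
    decaying exponential is nonincreasing, [F] times a growing one is nondecreasing. *)
Lemma gronwall_scalar (F : R -> R) (L a b : R) :
  a <= b -> (forall t, a <= t <= b -> exists l, derivable_pt_lim F t l /\ Rabs l <= L * F t) ->
  F b <= F a * exp (L * (b - a)) /\ F a <= F b * exp (L * (b - a)).
Proof.
  intros Hab H. destruct (Rle_lt_or_eq_dec a b Hab) as [Hlt| ->];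
    [|rewrite Rminus_diag, Rmult_0_r, exp_0; lra].
  assert (Hd : forall c t l, derivable_pt_lim F t l ->
     derivable_pt_lim (fun s => F s * exp (c * (s - a))) t ((l + c * F t) * exp (c * (t - a)))).
  { intros c t l Hl.
    replace ((l + c * F t) * exp (c * (t - a)))
      with (l * exp (c * (t - a)) + F t * (exp (c * (t - a)) * (c * (1 - 0)))) by ring.
    apply (derivable_pt_lim_mult F (fun s => exp (c * (s - a)))); [exact Hl|].
    apply (derivable_pt_lim_comp (fun s => c * (s - a)) exp); [|apply derivable_pt_lim_exp].
    apply (derivable_pt_lim_scal (fun s => s - a)).
    apply (derivable_pt_lim_minus (fun s => s) (fun _ => a));
      [apply derivable_pt_lim_id|apply derivable_pt_lim_const]. }
  assert (Hm : forall c, exists t l m, a < t < b /\ derivable_pt_lim F t l /\ Rabs l <= L * F t /\ 0 < m /\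
     F b * exp (c * (b - a)) - F a = (l + c * F t) * m).
  { intros c. destruct (MVT_ex (fun s => F s * exp (c * (s - a))) a b Hlt) as [t [l [Ht [Hl E]]]].
    - intros t Ht. destruct (H t Ht) as [l [Hl _]]. eexists; apply Hd; exact Hl.
    - destruct (H t ltac:(lra)) as [l' [Hl' Hb]].
      pose proof (uniqueness_limite _ _ _ _ Hl (Hd c t l' Hl')) as El.
      exists t, l', (exp (c * (t - a)) * (b - a)). repeat split; try lra; auto.
      + apply Rmult_lt_0_compat; [apply exp_pos|lra].
      + replace (a - a) with 0 in E by ring. rewrite Rmult_0_r, exp_0 in E.
        rewrite El in E. lra. }
  split.
  - destruct (Hm (- L)) as [t [l [m [Ht [Hl [Hb [Hpm E]]]]]]].
    assert (Hle : F b * exp (- L * (b - a)) <= F a).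
    { assert (l + - L * F t <= 0) by (unfold Rabs in Hb; destruct Rcase_abs in Hb; lra). nra. }
    apply Rle_trans with (F b * exp (- L * (b - a)) * exp (L * (b - a))).
    + rewrite Rmult_assoc, <- exp_plus. replace (- L * (b - a) + L * (b - a)) with 0 by ring.
      rewrite exp_0; lra.
    + apply Rmult_le_compat_r; [apply Rlt_le, exp_pos|exact Hle].
  - destruct (Hm L) as [t [l [m [Ht [Hl [Hb [Hpm E]]]]]]].
    assert (0 <= l + L * F t) by (unfold Rabs in Hb; destruct Rcase_abs in Hb; lra). nra.
Qed.

Definition diff_ineq (n : nat) (M eta : R) (D : R -> vec) (a b : R) : Prop :=
  forall t, a <= t <= b -> forall i, (i < n)%nat -> exists l,
    derivable_pt_lim (fun s => D s i) t l /\ Rabs l <= M * rsum n (fun j => Rabs (D t j)) + eta.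

(** Adding [eta ^ 2] to the squared norm makes the inequality homogeneous. In the rate,
    [2 * M * INR n * INR n] comes from the coupling and [1 + INR n] from splitting each product of
    [2 * eta] with a coordinate into squares. *)
Lemma gronwall (n : nat) (M eta : R) (D : R -> vec) (a b s t : R) :
  0 <= M -> 0 <= eta -> diff_ineq n M eta D a b -> a <= s <= b -> a <= t <= b ->
  rsum n (fun i => D t i ^ 2) + eta ^ 2 <=
  (rsum n (fun i => D s i ^ 2) + eta ^ 2) * exp ((2 * M * INR n * INR n + 1 + INR n) * (b - a)).
Proof.
  intros HM Heta H Hs Ht. pose proof (pos_INR n) as Hn.
  set (L := 2 * M * INR n * INR n + 1 + INR n).
  assert (HL0 : 0 <= 2 * M * INR n * INR n) by (repeat apply Rmult_le_pos; lra).
  assert (HL : 0 <= L) by (unfold L; lra).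
  set (F := fun t => rsum n (fun i => D t i ^ 2) + eta ^ 2).
  assert (HF : forall t, 0 <= F t).
  { intros u. unfold F. pose proof (sq_sum_nonneg n (D u)). pose proof (pow2_ge_0 eta). lra. }
  assert (Hder : forall u, a <= u <= b -> exists l, derivable_pt_lim F u l /\ Rabs l <= L * F u).
  { intros u Hu.
    set (l := fun i => epsilon (inhabits 0) (fun l => derivable_pt_lim (fun s => D s i) u l /\
               Rabs l <= M * rsum n (fun j => Rabs (D u j)) + eta)).
    assert (Hl : forall i, (i < n)%nat -> derivable_pt_lim (fun s => D s i) u (l i) /\
               Rabs (l i) <= M * rsum n (fun j => Rabs (D u j)) + eta).
    { intros i Hi. unfold l. apply epsilon_spec, (H u Hu i Hi). }
    set (E := rsum n (fun i => D u i ^ 2)).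
    exists (rsum n (fun i => INR 2 * D u i ^ 1 * l i) + 0). split.
    - apply (derivable_pt_lim_plus (fun t => rsum n (fun i => D t i ^ 2)) (fun _ => eta ^ 2));
        [|apply derivable_pt_lim_const].
      apply (derivable_pt_lim_rsum n (fun i t => D t i ^ 2)). intros i Hi.
      apply (derivable_pt_lim_comp (fun s => D s i) (fun y => y ^ 2)); [apply Hl; exact Hi|].
      apply (derivable_pt_lim_pow (D u i) 2).
    - rewrite Rplus_0_r. eapply Rle_trans; [apply rsum_abs|].
      apply Rle_trans with (rsum n (fun i => (2 * M * INR n * E + eta ^ 2) + D u i ^ 2)).
      + apply rsum_le. intros i Hi. destruct (Hl i Hi) as [_ Hb].
        assert (Hprod : Rabs (D u i) * rsum n (fun j => Rabs (D u j)) <= INR n * E).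
        { rewrite <- rsum_scal, <- rsum_const. apply rsum_le. intros j Hj.
          assert (D u i ^ 2 <= E)
            by (apply (rsum_term_le n (fun i => D u i ^ 2)); [intros; apply pow2_ge_0|exact Hi]).
          assert (D u j ^ 2 <= E)
            by (apply (rsum_term_le n (fun i => D u i ^ 2)); [intros; apply pow2_ge_0|exact Hj]).
          rewrite <- (pow2_abs (D u i)) in *. rewrite <- (pow2_abs (D u j)) in *.
          pose proof (pow2_ge_0 (Rabs (D u i) - Rabs (D u j))). nra. }
        rewrite !Rabs_mult. simpl INR. rewrite (Rabs_right (1 + 1)) by lra. rewrite pow_1.
        pose proof (Rabs_pos (D u i)) as Hp.
        apply Rle_trans with (2 * Rabs (D u i) * (M * rsum n (fun j => Rabs (D u j)) + eta)).
        { replace (1 + 1) with 2 by ring. apply Rmult_le_compat_l; [lra|exact Hb]. }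
        rewrite <- (pow2_abs (D u i)).
        pose proof (pow2_ge_0 (Rabs (D u i) - eta)). nra.
      + rewrite rsum_plus, rsum_const. fold E. unfold F. fold E.
        assert (0 <= E) by apply sq_sum_nonneg. pose proof (pow2_ge_0 eta).
        unfold L. assert (0 <= INR n * E) by nra. assert (0 <= 2 * M * INR n * INR n * eta ^ 2) by nra. nra. }
  assert (Hcase : forall u v, a <= u -> u <= v -> v <= b ->
     F v <= F u * exp (L * (b - a)) /\ F u <= F v * exp (L * (b - a))).
  { intros u v Hau Huv Hvb. destruct (gronwall_scalar F L u v Huv) as [H1 H2].
    - intros z Hz. apply Hder. lra.
    - assert (Hexp : exp (L * (v - u)) <= exp (L * (b - a))).
      { destruct (Req_dec (L * (v - u)) (L * (b - a))) as [-> |ne]; [lra|].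
        apply Rlt_le, exp_increasing. nra. }
      pose proof (HF u); pose proof (HF v). split; eapply Rle_trans; eauto; apply Rmult_le_compat_l; auto. }
  destruct (Rle_lt_dec s t) as [Hst|Hst].
  - apply (Hcase s t); lra.
  - apply (Hcase t s); lra.
Qed.

(** One number [d] limits both the initial error and the forcing. It does not depend on [D] or on
    the position of the interval, so it serves a whole sequence at once. *)
Lemma gronwall_small (n : nat) (M T eps : R) :
  0 <= M -> 0 < eps -> exists d, 0 < d /\
  forall D a b s, b - a <= T -> diff_ineq n M d D a b -> a <= s <= b ->
    (forall j, (j < n)%nat -> Rabs (D s j) <= d) ->
    forall t, a <= t <= b -> forall i, (i < n)%nat -> Rabs (D t i) < eps.
Proof.
  intros HM He. pose proof (pos_INR n) as Hn.
  set (L := 2 * M * INR n * INR n + 1 + INR n).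
  assert (HL0 : 0 <= 2 * M * INR n * INR n) by (repeat apply Rmult_le_pos; lra).
  set (X := exp (L * Rabs T)).
  assert (HX : 1 <= X).
  { unfold X. rewrite <- exp_0. pose proof (Rabs_pos T).
    destruct (Req_dec (L * Rabs T) 0) as [-> |ne]; [lra|]. apply Rlt_le, exp_increasing.
    assert (0 <= L) by (unfold L; lra). assert (0 <= L * Rabs T) by nra. lra. }
  set (Cc := (INR n + 1) * X). assert (HCc : 1 <= Cc) by (unfold Cc; nra).
  exists (eps / (2 * Cc)). set (d := eps / (2 * Cc)).
  assert (Hd : 0 < d) by (apply Rdiv_lt_0_compat; lra). split; [exact Hd|].
  intros D a b s HT Hdi Hs HDs t Ht i Hi.
  pose proof (gronwall n M d D a b s t HM ltac:(lra) Hdi Hs Ht) as G. fold L in G.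
  assert (Hexp : exp (L * (b - a)) <= X).
  { unfold X. destruct (Req_dec (L * (b - a)) (L * Rabs T)) as [-> |ne]; [lra|].
    apply Rlt_le, exp_increasing. pose proof (Rle_abs T). assert (0 <= L) by (unfold L; lra). nra. }
  assert (HE : rsum n (fun i => D s i ^ 2) <= INR n * d ^ 2).
  { rewrite <- rsum_const. apply rsum_le. intros j Hj. specialize (HDs j Hj).
    rewrite <- (pow2_abs (D s j)). pose proof (Rabs_pos (D s j)). nra. }
  pose proof (sq_sum_nonneg n (D s)) as HE0. pose proof (exp_pos (L * (b - a))).
  assert (Hti : D t i ^ 2 <= rsum n (fun i => D t i ^ 2))
    by (apply (rsum_term_le n (fun i => D t i ^ 2)); [intros; apply pow2_ge_0|exact Hi]).
  assert (Hd2 : 0 < d ^ 2) by nra.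
  assert (HG : D t i ^ 2 < Cc * d ^ 2).
  { unfold Cc. apply Rlt_le_trans with (D t i ^ 2 + d ^ 2); [lra|].
    apply Rle_trans with ((INR n * d ^ 2 + d ^ 2) * X); [|lra].
    apply Rle_trans with ((rsum n (fun i => D s i ^ 2) + d ^ 2) * exp (L * (b - a))); [lra|].
    apply Rmult_le_compat; lra. }
  assert (Hfin : Cc * d ^ 2 <= eps ^ 2).
  { assert (E : Cc * d = eps / 2) by (unfold d; field; lra).
    replace (Cc * d ^ 2) with (Cc * d * d) by ring. rewrite E.
    assert (d <= eps) by nra. nra. }
  rewrite <- (pow2_abs (D t i)) in HG. pose proof (Rabs_pos (D t i)). nra.
Qed.

Lemma gronwall_zero (n : nat) (M : R) (D : R -> vec) (a b s : R) :
  0 <= M -> diff_ineq n M 0 D a b -> a <= s <= b -> (forall j, (j < n)%nat -> D s j = 0) ->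
  forall t, a <= t <= b -> forall i, (i < n)%nat -> D t i = 0.
Proof.
  intros HM H Hs HDs t Ht i Hi.
  pose proof (gronwall n M 0 D a b s t HM ltac:(lra) H Hs Ht) as G.
  rewrite (rsum_zero n (fun i => D s i ^ 2)) in G by (intros j Hj; rewrite HDs by exact Hj; ring).
  replace (0 ^ 2) with 0 in G by ring. rewrite Rplus_0_r, Rplus_0_r, Rmult_0_l in G.
  assert (D t i ^ 2 <= rsum n (fun i => D t i ^ 2))
    by (apply (rsum_term_le n (fun i => D t i ^ 2)); [intros; apply pow2_ge_0|exact Hi]).
  nra.
Qed.

(** * Jacobians over the hull *)

Definition cb (n : nat) (r : R) (x : vec) : Prop := forall i, (i < n)%nat -> Rabs (x i) <= r.

Lemma cb_vnorm (n : nat) (r : R) (x : vec) : 0 <= r -> cb n r x -> vnorm n x <= INR n * r.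
Proof. intros Hr H. apply vnorm_le_bound; assumption. Qed.

Lemma Un_cv_le (u : nat -> R) (l c : R) : Un_cv u l -> (forall k, u k <= c) -> l <= c.
Proof.
  intros H Hu. apply Rle_cv_lim with u (fun _ => c); auto.
  intros e He. exists 0%nat. intros. unfold Rdist. rewrite Rminus_diag, Rabs_R0. exact He.
Qed.

Lemma Un_cv_ge (u : nat -> R) (l c : R) : Un_cv u l -> (forall k, c <= u k) -> c <= l.
Proof.
  intros H Hu. apply Rle_cv_lim with (fun _ => c) u; auto.
  intros e He. exists 0%nat. intros. unfold Rdist. rewrite Rminus_diag, Rabs_R0. exact He.
Qed.

Lemma Un_cv_const (c : R) : Un_cv (fun _ => c) c.
Proof. intros e He. exists 0%nat. intros. unfold Rdist. rewrite Rminus_diag, Rabs_R0. exact He. Qed.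

Lemma Un_cv_abs (u : nat -> R) (l : R) : Un_cv u l -> Un_cv (fun k => Rabs (u k)) (Rabs l).
Proof. intros H. apply (continuity_seq Rabs u); [apply Rcontinuity_abs|exact H]. Qed.

Lemma MVT_between (f f' : R -> R) (a b : R) :
  (forall c, derivable_pt_lim f c (f' c)) ->
  exists c, Rabs (c - a) <= Rabs (b - a) /\ f b - f a = f' c * (b - a).
Proof.
  intros H. destruct (Rtotal_order a b) as [Hlt|[-> |Hgt]].
  - destruct (MVT_cor2 f f' a b Hlt (fun c _ => H c)) as [c [E Hc]]. exists c. split; [|exact E].
    rewrite !Rabs_right; lra.
  - exists b. split; [lra|ring].
  - destruct (MVT_cor2 f f' b a Hgt (fun c _ => H c)) as [c [E Hc]]. exists c. split; [|lra].
    rewrite !Rabs_left1; lra.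
Qed.

Lemma vupd_self (x : vec) (j : nat) : vupd x j (x j) = x.
Proof. extensionality l. unfold vupd. destruct (Nat.eqb_spec l j); subst; reflexivity. Qed.

Lemma vupd_eq (x : vec) (j : nat) (s : R) : vupd x j s j = s.
Proof. unfold vupd. rewrite Nat.eqb_refl. reflexivity. Qed.

Lemma vupd_vupd (x : vec) (j : nat) (s s' : R) : vupd (vupd x j s) j s' = vupd x j s'.
Proof. extensionality l. unfold vupd. destruct (Nat.eqb_spec l j); reflexivity. Qed.

Lemma vupd_dist (x : vec) (j : nat) (s : R) (l : nat) :
  Rabs (vupd x j s l - x l) <= Rabs (s - x j).
Proof.
  unfold vupd. destruct (Nat.eqb_spec l j) as [-> |]; [lra|].
  rewrite Rminus_diag, Rabs_R0. apply Rabs_pos.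
Qed.

Lemma is_jac_line (n : nat) (g : vfield) (J : R -> vec -> nat -> nat -> R) (t : R) (x : vec) (i j : nat) (s : R) :
  is_jac n g J -> (i < n)%nat -> (j < n)%nat ->
  derivable_pt_lim (fun s => g t (vupd x j s) i) s (J t (vupd x j s) i j).
Proof.
  intros H Hi Hj. pose proof (H t (vupd x j s) i j Hi Hj) as H0. rewrite vupd_eq in H0.
  replace (fun s0 => g t (vupd (vupd x j s) j s0) i) with (fun s => g t (vupd x j s) i) in H0; [exact H0|].
  extensionality s0. rewrite vupd_vupd. reflexivity.
Qed.

Lemma is_jac_unique (n : nat) (g : vfield) (J J' : R -> vec -> nat -> nat -> R) (t : R) (x : vec) (i j : nat) :
  is_jac n g J -> is_jac n g J' -> (i < n)%nat -> (j < n)%nat -> J t x i j = J' t x i j.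
Proof. intros H H' Hi Hj. eapply uniqueness_limite; [apply H|apply H']; assumption. Qed.

(** Coordinates are changed from [x'] to [x] one at a time, with the one-variable mean value theorem
    at each step. This needs only partial derivatives, at the cost of a different intermediate point
    for each column. *)
Lemma mean_value_rows (n : nat) (g : vfield) (J : R -> vec -> nat -> nat -> R) (t : R) (x x' : vec) (i : nat) :
  is_jac n g J -> tridiagonal n g -> (i < n)%nat ->
  exists xi : nat -> vec, (forall j l, Rabs (xi j l - x' l) <= Rabs (x l - x' l)) /\
    g t x i - g t x' i = rsum n (fun j => J t (xi j) i j * (x j - x' j)).
Proof.
  intros HJ Htri Hi.
  set (hyb := fun m l => if Nat.ltb l m then x l else x' l : R).
  assert (Hstep : forall m, exists v : vec, (m < n)%nat ->
     (forall l, Rabs (v l - x' l) <= Rabs (x l - x' l)) /\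
     g t (hyb (S m)) i - g t (hyb m) i = J t v i m * (x m - x' m)).
  { intros m. destruct (le_lt_dec n m) as [Hm|Hm]; [exists x; intros; lia|].
    destruct (MVT_between (fun s => g t (vupd (hyb m) m s) i) (fun s => J t (vupd (hyb m) m s) i m) (x' m) (x m))
      as [c [Hc E]].
    { intros c. apply (is_jac_line n); assumption. }
    exists (vupd (hyb m) m c). intros _. split.
    - intros l. unfold vupd. destruct (Nat.eqb_spec l m) as [-> |]; [exact Hc|].
      unfold hyb. destruct (Nat.ltb_spec l m); [lra|]. rewrite Rminus_diag, Rabs_R0. apply Rabs_pos.
    - rewrite <- E. replace (hyb (S m)) with (vupd (hyb m) m (x m)).
      + replace (vupd (hyb m) m (x' m)) with (hyb m); [reflexivity|].
        extensionality l. unfold vupd, hyb. destruct (Nat.eqb_spec l m) as [El|]; [|reflexivity].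
        destruct (Nat.ltb_spec l m); [lia|rewrite El; reflexivity].
      + extensionality l. unfold vupd, hyb. destruct (Nat.eqb_spec l m) as [El|].
        * destruct (Nat.ltb_spec l (S m)); [rewrite El; reflexivity|lia].
        * destruct (Nat.ltb_spec l m), (Nat.ltb_spec l (S m)); reflexivity || lia. }
  set (xi := fun m => proj1_sig (constructive_indefinite_description _ (Hstep m))).
  assert (Hxi : forall m, (m < n)%nat -> (forall l, Rabs (xi m l - x' l) <= Rabs (x l - x' l)) /\
     g t (hyb (S m)) i - g t (hyb m) i = J t (xi m) i m * (x m - x' m)).
  { intros m. exact (proj2_sig (constructive_indefinite_description _ (Hstep m))). }
  exists (fun m => if Nat.ltb m n then xi m else x'). split.
  { intros j l. destruct (Nat.ltb_spec j n); [apply Hxi; assumption|].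
    rewrite Rminus_diag, Rabs_R0; apply Rabs_pos. }
  assert (Htel : forall m, (m <= n)%nat ->
     g t (hyb m) i - g t (hyb 0%nat) i = rsum m (fun j => J t (xi j) i j * (x j - x' j))).
  { induction m as [|m IH]; intros Hm; simpl; [ring|].
    rewrite <- IH by lia. destruct (Hxi m ltac:(lia)) as [_ <-]. ring. }
  specialize (Htel n (le_n n)).
  replace (g t (hyb n) i) with (g t x i) in Htel.
  - replace (hyb 0%nat) with x' in Htel by (extensionality l; reflexivity).
    rewrite Htel. apply rsum_ext. intros j Hj. destruct (Nat.ltb_spec j n); [reflexivity|lia].
  (* The last hybrid agrees with [x] only on the first [n] indices; tridiagonality also says that
     the field ignores the others. *)
  - apply Htri; [exact Hi|]. intros j Hj _ _. unfold hyb. destruct (Nat.ltb_spec j n); [reflexivity|lia].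
Qed.

Definition jac (n : nat) (g : vfield) : R -> vec -> nat -> nat -> R :=
  epsilon (inhabits (fun _ _ _ _ => 0)) (is_jac n g).

(** Uniformity in [t] makes the modulus pass to translates and to their limits, hence to the whole
    hull. *)
Definition in_modulus (n : nat) (J : R -> vec -> nat -> nat -> R) (r eps d : R) : Prop :=
  forall t x x' i j, (i < n)%nat -> (j < n)%nat -> cb n r x -> cb n r x' ->
    (forall l, (l < n)%nat -> Rabs (x l - x' l) <= d) -> Rabs (J t x i j - J t x' i j) <= eps.

Lemma difference_quotient (n : nat) (g : vfield) (J : R -> vec -> nat -> nat -> R) (r eps d t s : R) (x : vec) (i j : nat) :
  is_jac n g J -> in_modulus n J (r + d) eps d -> (i < n)%nat -> (j < n)%nat -> cb n r x ->
  Rabs (s - x j) <= d ->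
  Rabs (g t (vupd x j s) i - g t x i - J t x i j * (s - x j)) <= eps * Rabs (s - x j).
Proof.
  intros HJ Hmod Hi Hj Hx Hs.
  destruct (MVT_between (fun s => g t (vupd x j s) i) (fun s => J t (vupd x j s) i j) (x j) s)
    as [c [Hc E]].
  { intros c. apply (is_jac_line n); assumption. }
  rewrite vupd_self in E. rewrite E, <- Rmult_minus_distr_r, Rabs_mult.
  apply Rmult_le_compat_r; [apply Rabs_pos|].
  pose proof (vupd_dist x j c) as Hv.
  assert (0 <= d) by (pose proof (Rabs_pos (s - x j)); lra).
  apply Hmod; auto.
  - intros l Hl. specialize (Hv l). specialize (Hx l Hl).
    replace (vupd x j c l) with ((vupd x j c l - x l) + x l) by ring.
    eapply Rle_trans; [apply Rabs_triang|]. lra.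
  - intros l Hl. specialize (Hx l Hl). lra.
  - intros l Hl. specialize (Hv l). lra.
Qed.

Lemma conv_co_coord (n : nat) (gk : nat -> vfield) (g : vfield) (T r eps : R) :
  conv_co n gk g -> 0 <= r -> 0 < eps -> exists K, forall k, (K <= k)%nat ->
    forall t x i, Rabs t <= T -> cb n r x -> (i < n)%nat -> Rabs (gk k t x i - g t x i) < eps.
Proof.
  intros H Hr He. destruct (H T (INR n * r) eps He) as [K HK]. exists K. intros k Hk t x i Ht Hx Hi.
  eapply Rle_lt_trans; [|apply (HK k Hk t x Ht (cb_vnorm n r x Hr Hx))].
  apply (coord_le_vnorm n (vsub (gk k t x) (g t x)) i Hi).
Qed.

Lemma cb_self (n : nat) (x : vec) : cb n (vnorm n x) x.
Proof. intros i Hi. apply coord_le_vnorm; exact Hi. Qed.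

Lemma cb_vupd (n : nat) (r d s : R) (x : vec) (j : nat) :
  cb n r x -> Rabs (s - x j) <= d -> cb n (r + d) (vupd x j s).
Proof.
  intros Hx Hs l Hl. pose proof (vupd_dist x j s l). specialize (Hx l Hl).
  replace (vupd x j s l) with ((vupd x j s l - x l) + x l) by ring.
  eapply Rle_trans; [apply Rabs_triang|]. lra.
Qed.

(* Uniformly close vector fields with a common modulus of continuity of the Jacobian have close
   Jacobians: compare both with one difference quotient of step [d]. *)
Lemma jac_close (n : nat) (g g' : vfield) (J J' : R -> vec -> nat -> nat -> R) (r eps d t t' : R)
    (x : vec) (i j : nat) :
  is_jac n g J -> is_jac n g' J' -> in_modulus n J (r + d) eps d -> in_modulus n J' (r + d) eps d ->
  0 < d -> (i < n)%nat -> (j < n)%nat -> cb n r x ->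
  (forall z, cb n (r + d) z -> Rabs (g t z i - g' t' z i) <= eps * d) ->
  Rabs (J t x i j - J' t' x i j) <= 4 * eps.
Proof.
  intros HJ HJ' Hm Hm' Hd Hi Hj Hx Hz.
  set (s := x j + d). assert (Es : s - x j = d) by (unfold s; ring).
  assert (Hsd : Rabs (s - x j) <= d) by (rewrite Es, Rabs_right; lra).
  pose proof (difference_quotient n g J r eps d t s x i j HJ Hm Hi Hj Hx Hsd) as Q1.
  pose proof (difference_quotient n g' J' r eps d t' s x i j HJ' Hm' Hi Hj Hx Hsd) as Q2.
  pose proof (Hz _ (cb_vupd n r d s x j Hx Hsd)) as Z1.
  assert (Z2 : Rabs (g t x i - g' t' x i) <= eps * d).
  { apply Hz. intros l Hl. specialize (Hx l Hl). lra. }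
  rewrite Es in *. rewrite (Rabs_right d) in Q1, Q2 by lra.
  assert (Hfin : Rabs (J t x i j - J' t' x i j) * d <= 4 * eps * d).
  { rewrite <- (Rabs_right d) at 1 by lra. rewrite <- Rabs_mult, Rmult_minus_distr_r.
    unfold Rabs in *. repeat destruct Rcase_abs; lra. }
  apply Rmult_le_reg_r with d; assumption.
Qed.

Section Hull.

Variables (n : nat) (f : vfield) (eps0 : R).
Hypothesis Hadm : C1_admissible n f.
Hypothesis Htri : tridiagonal n f.
Hypothesis Hcoop : strongly_cooperative n f eps0.

(** Admissibility restated on the boxes [cb]. Requiring [d <= 1] lets a box of radius [r + d] be
    enlarged to the fixed radius [r + 1]. *)
Local Lemma base_jac : exists J0, is_jac n f J0 /\
  (forall r, exists M, 0 <= M /\ forall t x i j, (i < n)%nat -> (j < n)%nat -> cb n r x -> Rabs (J0 t x i j) <= M) /\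
  (forall r eps, 0 < eps -> exists d, 0 < d <= 1 /\ in_modulus n J0 r eps d).
Proof.
  destruct Hadm as [_ [J0 [HJ0 Hu]]]. exists J0. split; [exact HJ0|].
  pose proof (pos_INR n) as Hn.
  assert (Hnr : forall r x, cb n r x -> vnorm n x <= INR n * Rabs r + 1).
  { intros r x Hx. pose proof (Rabs_pos r).
    assert (vnorm n x <= INR n * Rabs r); [|lra]. apply cb_vnorm; [assumption|].
    intros i Hi. eapply Rle_trans; [apply Hx; exact Hi|apply Rle_abs]. }
  assert (Hpos : forall r, 0 < INR n * Rabs r + 1).
  { intros r. pose proof (Rabs_pos r). assert (0 <= INR n * Rabs r) by (apply Rmult_le_pos; assumption). lra. }
  split.
  - intros r. destruct (Hu _ (Hpos r)) as [[M HM] _]. exists (Rabs M). split; [apply Rabs_pos|].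
    intros t x i j Hi Hj Hx. destruct (HM t x (Hnr r x Hx)) as [_ Hb].
    eapply Rle_trans; [apply Hb; assumption|apply Rle_abs].
  - intros r eps He. destruct (Hu _ (Hpos r)) as [_ Hc]. destruct (Hc eps He) as [d [Hd Hmod]].
    destruct (small_multiple n d Hd) as [d' [Hd' Hlt]].
    exists (Rmin d' 1). split; [split; [apply Rmin_pos; lra|apply Rmin_r]|].
    intros t x x' i j Hi Hj Hx Hx' Hxx. apply Rlt_le.
    apply (Hmod t t x x'); auto.
    + rewrite Rminus_diag, Rabs_R0; exact Hd.
    + eapply Rle_lt_trans; [|exact Hlt]. apply vnorm_le_bound; [lra|].
      intros l Hl. eapply Rle_trans; [apply (Hxx l Hl)|apply Rmin_l].
Qed.

Lemma is_jac_shift (g : vfield) (J : R -> vec -> nat -> nat -> R) (tau : R) :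
  is_jac n g J -> is_jac n (shift g tau) (fun t x i j => J (t + tau) x i j).
Proof. intros H t x i j Hi Hj. apply (H (t + tau)); assumption. Qed.

(** Convergence in the hull concerns values only. The common modulus makes the translated Jacobians
    Cauchy, by [jac_close], and the difference-quotient estimate survives the limit, which
    identifies it as the Jacobian of [g]. *)
Local Lemma hull_jac_limit (J0 : R -> vec -> nat -> nat -> R) (g : vfield) :
  is_jac n f J0 -> (forall r eps, 0 < eps -> exists d, 0 < d <= 1 /\ in_modulus n J0 r eps d) ->
  in_hull n f g ->
  is_jac n g (jac n g) /\ exists tau : nat -> R, forall t x i j, (i < n)%nat -> (j < n)%nat ->
    Un_cv (fun k => J0 (t + tau k) x i j) (jac n g t x i j).
Proof.
  intros HJ0 Hmod [_ [tau Htau]].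
  assert (Hg : forall t x i, (i < n)%nat -> Un_cv (fun k => f (t + tau k) x i) (g t x i)).
  { intros t x i Hi eps He.
    destruct (conv_co_coord n _ _ (Rabs t) (vnorm n x) eps Htau (vnorm_nonneg n x) He) as [K HK].
    exists K. intros k Hk. apply (HK k Hk t x i); [lra|apply cb_self|exact Hi]. }
  assert (Hm1 : forall r eps d, in_modulus n J0 (r + 1) eps d -> d <= 1 -> in_modulus n J0 (r + d) eps d).
  { intros r eps d H Hd t x x' i j Hi Hj Hx Hx'. apply H; auto; intros l Hl; [specialize (Hx l Hl)|specialize (Hx' l Hl)]; lra. }
  assert (Hcauchy : forall t x i j, (i < n)%nat -> (j < n)%nat ->
             exists l, Un_cv (fun k => J0 (t + tau k) x i j) l).
  { intros t x i j Hi Hj.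
    assert (Hcc : Cauchy_crit (fun k => J0 (t + tau k) x i j)).
    (* [jac_close] loses a factor 4, so [eps / 8] leaves a strict inequality. Two translates are
       each compared with [g], hence the tolerance [e1 * d / 2]. *)
    { intros eps He. set (e1 := eps / 8). assert (He1 : 0 < e1) by (unfold e1; lra).
      set (r := vnorm n x). pose proof (vnorm_nonneg n x) as Hr. fold r in Hr.
      destruct (Hmod (r + 1) e1 He1) as [d [Hd Hmd]].
      assert (He2 : 0 < e1 * d / 2) by nra.
      destruct (conv_co_coord n _ _ (Rabs t) (r + d) (e1 * d / 2) Htau ltac:(lra) He2) as [K HK].
      exists K. intros k l Hk Hl. unfold Rdist. apply Rle_lt_trans with (4 * e1); [|unfold e1; lra].
      apply (jac_close n f f J0 J0 r e1 d); auto; [apply Hm1; tauto|apply Hm1; tauto|tauto|apply cb_self|].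
      intros z Hz. pose proof (HK k Hk t z i ltac:(lra) Hz Hi) as A1.
      pose proof (HK l Hl t z i ltac:(lra) Hz Hi) as A2. unfold shift in A1, A2.
      unfold Rabs in *. repeat destruct Rcase_abs; lra. }
    destruct (R_complete _ Hcc) as [l Hl]. exists l. exact Hl. }
  set (J := fun t x i j => epsilon (inhabits 0) (Un_cv (fun k => J0 (t + tau k) x i j))).
  assert (HJ : forall t x i j, (i < n)%nat -> (j < n)%nat ->
             Un_cv (fun k => J0 (t + tau k) x i j) (J t x i j)).
  { intros t x i j Hi Hj. unfold J. apply epsilon_spec, Hcauchy; assumption. }
  assert (HisJ : is_jac n g J).
  { intros t x i j Hi Hj eps He.
    set (r := vnorm n x). destruct (Hmod (r + 1) (eps / 2) ltac:(lra)) as [d [Hd Hmd]].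
    assert (Hdp : 0 < d) by tauto. exists (mkposreal d Hdp). intros h Hh Hhd. simpl in Hhd.
    assert (Hq : Rabs (g t (vupd x j (x j + h)) i - g t x i - J t x i j * h) <= eps / 2 * Rabs h).
    { apply Un_cv_le with (fun k => Rabs (f (t + tau k) (vupd x j (x j + h)) i - f (t + tau k) x i - J0 (t + tau k) x i j * h)).
      - apply Un_cv_abs. apply CV_minus; [apply CV_minus; apply Hg; exact Hi|].
        apply CV_mult; [apply HJ; assumption|apply Un_cv_const].
      - intros k.
        pose proof (difference_quotient n f J0 r (eps / 2) d (t + tau k) (x j + h) x i j HJ0
                      (Hm1 r (eps / 2) d Hmd ltac:(lra)) Hi Hj (cb_self n x)) as Hdq.
        replace (x j + h - x j) with h in Hdq by ring. apply Hdq. lra. }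
    rewrite vupd_self.
    assert (Hah : 0 < Rabs h) by (apply Rabs_pos_lt; exact Hh).
    replace ((g t (vupd x j (x j + h)) i - g t x i) / h - J t x i j)
      with ((g t (vupd x j (x j + h)) i - g t x i - J t x i j * h) * / h) by (field; exact Hh).
    rewrite Rabs_mult, Rabs_inv.
    apply Rle_lt_trans with (eps / 2 * Rabs h * / Rabs h).
    - apply Rmult_le_compat_r; [apply Rlt_le, Rinv_0_lt_compat; exact Hah|exact Hq].
    - replace (eps / 2 * Rabs h * / Rabs h) with (eps / 2) by (field; lra). lra. }
  assert (Hjac : is_jac n g (jac n g)) by (unfold jac; apply epsilon_spec; exists J; exact HisJ).
  split; [exact Hjac|]. exists tau. intros t x i j Hi Hj.
  rewrite (is_jac_unique n g (jac n g) J) by assumption. apply HJ; assumption.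
Qed.

Lemma hull_is_jac (g : vfield) : in_hull n f g -> is_jac n g (jac n g).
Proof.
  intros Hg. destruct base_jac as [J0 [HJ0 [_ Hmod]]]. apply (hull_jac_limit J0 g HJ0 Hmod Hg).
Qed.

Lemma hull_jac_bound (r : R) : exists M, 0 <= M /\ forall g t x i j, in_hull n f g ->
  (i < n)%nat -> (j < n)%nat -> cb n r x -> Rabs (jac n g t x i j) <= M.
Proof.
  destruct base_jac as [J0 [HJ0 [Hb Hmod]]]. destruct (Hb r) as [M [HM H]]. exists M. split; [exact HM|].
  intros g t x i j Hg Hi Hj Hx. destruct (hull_jac_limit J0 g HJ0 Hmod Hg) as [_ [tau Htau]].
  eapply Un_cv_le; [apply Un_cv_abs, (Htau t x i j Hi Hj)|]. intros k. apply H; assumption.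
Qed.

Lemma hull_jac_modulus (r eps : R) : 0 < eps -> exists d, 0 < d <= 1 /\
  forall g, in_hull n f g -> in_modulus n (jac n g) r eps d.
Proof.
  intros He. destruct base_jac as [J0 [HJ0 [Hb Hmod]]]. destruct (Hmod r eps He) as [d [Hd H]].
  exists d. split; [exact Hd|]. intros g Hg t x x' i j Hi Hj Hx Hx' Hxx.
  destruct (hull_jac_limit J0 g HJ0 Hmod Hg) as [_ [tau Htau]].
  eapply Un_cv_le.
  - apply Un_cv_abs, CV_minus; [apply (Htau t x i j Hi Hj)|apply (Htau t x' i j Hi Hj)].
  - intros k. apply H; assumption.
Qed.

Lemma hull_jac_offdiag (g : vfield) (t : R) (x : vec) (i j : nat) : in_hull n f g ->
  (i < n)%nat -> (j < n)%nat -> (j = i + 1 \/ i = j + 1)%nat -> eps0 <= jac n g t x i j.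
Proof.
  intros Hg Hi Hj Hij. destruct base_jac as [J0 [HJ0 [Hb Hmod]]].
  destruct (hull_jac_limit J0 g HJ0 Hmod Hg) as [_ [tau Htau]].
  eapply Un_cv_ge; [apply (Htau t x i j Hi Hj)|]. intros k.
  destruct Hcoop as [_ Hc]. destruct Hij as [-> | ->]; apply (Hc J0 HJ0); assumption.
Qed.

Lemma hull_tridiagonal (g : vfield) : in_hull n f g -> tridiagonal n g.
Proof.
  intros [_ [tau Htau]] t x x' i Hi Hxx.
  assert (Hg : forall x, Un_cv (fun k => f (t + tau k) x i) (g t x i)).
  { intros z eps He.
    destruct (conv_co_coord n _ _ (Rabs t) (vnorm n z) eps Htau (vnorm_nonneg n z) He) as [K HK].
    exists K. intros k Hk. apply (HK k Hk t z i); [lra|apply cb_self|exact Hi]. }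
  apply UL_sequence with (fun k => f (t + tau k) x i); [apply Hg|].
  replace (fun k => f (t + tau k) x i) with (fun k => f (t + tau k) x' i); [apply Hg|].
  extensionality k. symmetry. apply Htri; assumption.
Qed.

Lemma hull_jac_tridiagonal (g : vfield) (t : R) (x : vec) (i j : nat) : in_hull n f g ->
  (i < n)%nat -> (j < n)%nat -> (j + 1 < i \/ i + 1 < j)%nat -> jac n g t x i j = 0.
Proof.
  intros Hg Hi Hj Hij. pose proof (hull_is_jac g Hg t x i j Hi Hj) as Hd.
  apply (uniqueness_limite _ _ _ _ Hd).
  replace (fun s => g t (vupd x j s) i) with (fun _ : R => g t x i); [apply derivable_pt_lim_const|].
  extensionality s. apply (hull_tridiagonal g Hg); [exact Hi|].
  intros l Hl H1 H2. unfold vupd. destruct (Nat.eqb_spec l j); [lia|reflexivity].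
Qed.

Lemma hull_jac_cv (gk : nat -> vfield) (g : vfield) (T r eps : R) :
  (forall k, in_hull n f (gk k)) -> in_hull n f g -> conv_co n gk g -> 0 <= r -> 0 < eps ->
  exists K, forall k, (K <= k)%nat -> forall t x i j, Rabs t <= T -> cb n r x ->
    (i < n)%nat -> (j < n)%nat -> Rabs (jac n (gk k) t x i j - jac n g t x i j) <= eps.
Proof.
  intros Hgk Hg Hcv Hr He. set (e1 := eps / 4). assert (He1 : 0 < e1) by (unfold e1; lra).
  destruct (hull_jac_modulus (r + 1) e1 He1) as [d [Hd Hmd]].
  assert (Hm1 : forall g, in_hull n f g -> in_modulus n (jac n g) (r + d) e1 d).
  { intros g' Hg' t x x' i j Hi Hj Hx Hx'.
    apply (Hmd g' Hg'); auto; intros l Hl; [specialize (Hx l Hl)|specialize (Hx' l Hl)]; lra. }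
  destruct (conv_co_coord n gk g T (r + d) (e1 * d) Hcv ltac:(lra) ltac:(nra)) as [K HK].
  exists K. intros k Hk t x i j Ht Hx Hi Hj. replace eps with (4 * e1) by (unfold e1; lra).
  apply (jac_close n (gk k) g _ _ r e1 d); auto; try (apply hull_is_jac; auto); [tauto|].
  intros z Hz. apply Rlt_le, HK; auto.
Qed.

Lemma jac_shift (g : vfield) (tau t : R) (x : vec) (i j : nat) :
  in_hull n f g -> (i < n)%nat -> (j < n)%nat ->
  jac n (shift g tau) t x i j = jac n g (t + tau) x i j.
Proof.
  intros Hg Hi Hj. pose proof (is_jac_shift g _ tau (hull_is_jac g Hg)) as Hs.
  assert (H : is_jac n (shift g tau) (jac n (shift g tau))).
  { unfold jac. apply epsilon_spec. eexists; exact Hs. }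
  apply (is_jac_unique n _ _ _ t x i j H Hs Hi Hj).
Qed.

End Hull.

(** * Homogeneous linear systems *)

(** The increasing enumeration of the indices other than [j0], used to drop a pivot column. *)
Definition skip (j0 j : nat) : nat := if Nat.ltb j j0 then j else S j.

Lemma rsum_skip (p : nat) (F : nat -> R) (j0 : nat) : (j0 < S p)%nat ->
  rsum (S p) F = F j0 + rsum p (fun j => F (skip j0 j)).
Proof.
  induction p as [|p IH]; intros Hj.
  - replace j0 with 0%nat by lia. simpl. ring.
  - destruct (Nat.eq_dec j0 (S p)) as [-> |ne].
    + rewrite (rsum_ext (S p) (fun j => F (skip (S p) j)) F).
      * simpl. ring.
      * intros i Hi. unfold skip. destruct (Nat.ltb_spec i (S p)); [reflexivity|lia].
    + change (rsum (S (S p)) F) with (rsum (S p) F + F (S p)). rewrite IH by lia.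
      change (rsum (S p) (fun j => F (skip j0 j))) with (rsum p (fun j => F (skip j0 j)) + F (skip j0 p)).
      replace (skip j0 p) with (S p); [ring|].
      unfold skip. destruct (Nat.ltb_spec p j0); [lia|reflexivity].
Qed.

(** Gaussian elimination on the last equation: a nonzero pivot removes one equation and one unknown,
    and a zero row imposes nothing. *)
Lemma homogeneous_solution (m : nat) : forall (p : nat) (A : nat -> nat -> R), (m < p)%nat ->
  exists c : nat -> R, (exists j, (j < p)%nat /\ c j <> 0) /\
    forall i, (i < m)%nat -> rsum p (fun j => A i j * c j) = 0.
Proof.
  induction m as [|m IH]; intros p A Hp.
  - exists (fun _ => 1). split; [exists 0%nat; split; [lia|lra]|intros; lia].
  - destruct (classic (exists j, (j < p)%nat /\ A m j <> 0)) as [[j0 [Hj0 Hpiv]]|Hno].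
    + destruct p as [|p]; [lia|].
      destruct (IH p (fun i j => A i (skip j0 j) - A i j0 * (A m (skip j0 j) / A m j0)) ltac:(lia))
        as [c' [[j1 [Hj1 Hc1]] Hsol]].
      set (X := - rsum p (fun j => A m (skip j0 j) * c' j) / A m j0).
      set (c := fun j => if Nat.ltb j j0 then c' j else if Nat.eqb j j0 then X else c' (j - 1)%nat).
      assert (Hc : forall j, c (skip j0 j) = c' j).
      { intros j. unfold c, skip. destruct (Nat.ltb_spec j j0) as [H|H].
        - destruct (Nat.ltb_spec j j0); [reflexivity|lia].
        - destruct (Nat.ltb_spec (S j) j0); [lia|]. destruct (Nat.eqb_spec (S j) j0); [lia|].
          f_equal. lia. }
      assert (HcX : c j0 = X).
      { unfold c. destruct (Nat.ltb_spec j0 j0); [lia|]. rewrite Nat.eqb_refl. reflexivity. }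
      exists c. split.
      * exists (skip j0 j1). split; [unfold skip; destruct (Nat.ltb_spec j1 j0); lia|].
        rewrite Hc. exact Hc1.
      * intros i Hi. rewrite (rsum_skip p _ j0 Hj0), HcX.
        rewrite (rsum_ext p _ (fun j => A i (skip j0 j) * c' j)) by (intros; rewrite Hc; reflexivity).
        destruct (Nat.eq_dec i m) as [-> |ne].
        -- unfold X. field. exact Hpiv.
        -- specialize (Hsol i ltac:(lia)).
           rewrite (rsum_ext p _ (fun j => A i (skip j0 j) * c' j - A i j0 / A m j0 * (A m (skip j0 j) * c' j))) in Hsol
             by (intros; field; exact Hpiv).
           rewrite rsum_minus, rsum_scal in Hsol. unfold X.
           replace (A i j0 * (- rsum p (fun j => A m (skip j0 j) * c' j) / A m j0))
             with (- (A i j0 / A m j0 * rsum p (fun j => A m (skip j0 j) * c' j))) by (field; exact Hpiv).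
           lra.
    + destruct (IH p A ltac:(lia)) as [c [Hc Hsol]]. exists c. split; [exact Hc|].
      intros i Hi. destruct (Nat.eq_dec i m) as [-> |ne]; [|apply Hsol; lia].
      apply rsum_zero. intros j Hj.
      assert (A m j = 0) by (apply NNPP; intros H; apply Hno; exists j; auto). rewrite H. ring.
Qed.

Lemma is_dim_le (n : nat) (V : vec -> Prop) (N : nat) : is_dim n V N -> (N <= n)%nat.
Proof.
  intros [b [_ [Hind _]]]. apply Nat.nlt_ge. intros Hlt.
  destruct (homogeneous_solution n N (fun i k => b k i) Hlt) as [c [[j [Hj Hc]] Hsol]].
  apply Hc, (Hind c); [|exact Hj]. intros i Hi. unfold lincomb. rewrite <- (Hsol i Hi).
  apply rsum_ext. intros; ring.
Qed.

(** * Linearized flow over the invariant set *)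

Lemma derivable_pt_lim_shift (F : R -> R) (t tau l : R) :
  derivable_pt_lim F (t + tau) l -> derivable_pt_lim (fun s => F (s + tau)) t l.
Proof.
  intros H. replace l with (l * (1 + 0)) by ring.
  apply (derivable_pt_lim_comp (fun s => s + tau) F); [|exact H].
  apply (derivable_pt_lim_plus (fun s => s) (fun _ => tau));
    [apply derivable_pt_lim_id|apply derivable_pt_lim_const].
Qed.

Lemma rsum_row_bound (n : nat) (A x : nat -> R) (M : R) :
  (forall j, (j < n)%nat -> Rabs (A j) <= M) ->
  Rabs (rsum n (fun j => A j * x j)) <= M * rsum n (fun j => Rabs (x j)).
Proof.
  intros H. eapply Rle_trans; [apply rsum_abs|]. rewrite <- rsum_scal. apply rsum_le.
  intros j Hj. rewrite Rabs_mult. apply Rmult_le_compat_r; [apply Rabs_pos|auto].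
Qed.

Lemma inRn_ext (n : nat) (x x' : vec) :
  inRn n x -> inRn n x' -> (forall i, (i < n)%nat -> x i = x' i) -> x = x'.
Proof.
  intros Hx Hx' H. extensionality i. destruct (le_lt_dec n i) as [Hi|Hi]; [|auto].
  rewrite Hx, Hx' by exact Hi. reflexivity.
Qed.

Lemma shift_shift (g : vfield) (s t : R) : shift (shift g s) t = shift g (t + s).
Proof. unfold shift. extensionality u. extensionality x. f_equal. ring. Qed.

Section Setting.

Variables (n : nat) (f : vfield) (eps0 : R).
Hypothesis Hn : (2 <= n)%nat.
Hypothesis Hadm : C1_admissible n f.
Hypothesis Htri : tridiagonal n f.
Hypothesis Hcoop : strongly_cooperative n f eps0.
Variables (Y : point -> Prop) (xf : R -> vec -> vfield -> vec).
Hypothesis HYsp : in_space n f Y.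
Hypothesis HYcpt : compact_set n Y.
Hypothesis Hflow : is_flow_on Y xf.
Hypothesis HYinv : invariant Y xf.

Definition orbit (y : point) (t : R) : vec := xf t (fst y) (snd y).
Definition coef (y : point) (t : R) (i j : nat) : R := jac n (snd y) t (orbit y t) i j.

Lemma eps0_pos : 0 < eps0.
Proof. apply Hcoop. Qed.

(** Points of [Y] escaping every box would contradict the convergent subsequence given by
    compactness. By invariance the same radius then bounds all orbits. *)
Lemma base_bounded : exists r, 0 <= r /\ forall y, Y y -> cb n r (fst y).
Proof.
  apply NNPP; intros Hno.
  assert (H : forall k : nat, exists y, Y y /\ ~ cb n (INR k) (fst y)).
  { intros k. apply NNPP; intros Hk. apply Hno. exists (INR k). split; [apply pos_INR|].
    intros y Hy. apply NNPP; intros Hc. apply Hk. exists y; auto. }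
  set (yk := fun k => proj1_sig (constructive_indefinite_description _ (H k))).
  assert (Hyk : forall k, Y (yk k) /\ ~ cb n (INR k) (fst (yk k))).
  { intros k. exact (proj2_sig (constructive_indefinite_description _ (H k))). }
  destruct (HYcpt yk (fun k => proj1 (Hyk k))) as [phi [y [Hphi [Hy [Hc _]]]]].
  destruct (vcv_unif n _ _ (conv_vec_vcv n _ _ Hc) 1 Rlt_0_1) as [K HK].
  destruct (INR_unbounded (vnorm n (fst y) + 1)) as [m Hm].
  set (k := Nat.max K m). destruct (Hyk (phi k)) as [_ Hbad]. apply Hbad. intros i Hi.
  specialize (HK k ltac:(lia) i Hi). pose proof (coord_le_vnorm n (fst y) i Hi) as Hb.
  assert (INR m <= INR (phi k)).
  { apply le_INR. pose proof (increasing_index_ge phi k Hphi). lia. }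
  replace (fst (yk (phi k)) i) with ((fst (yk (phi k)) i - fst y i) + fst y i) by ring.
  eapply Rle_trans; [apply Rabs_triang|]. lra.
Qed.

Lemma base_hull (y : point) : Y y -> in_hull n f (snd y).
Proof. intros Hy. apply (HYsp y Hy). Qed.

Lemma orbit_0 (y : point) : Y y -> orbit y 0 = fst y.
Proof. destruct y as [x0 g]. intros Hy. apply (Hflow x0 g Hy). Qed.

Lemma orbit_inRn (y : point) (t : R) : Y y -> inRn n (orbit y t).
Proof. intros Hy. apply (HYsp (Pi xf y t)), HYinv, Hy. Qed.

Lemma orbit_traj (y : point) : Y y -> is_traj (snd y) (orbit y) (fun _ => True).
Proof. destruct y as [x0 g]. intros Hy. apply (Hflow x0 g Hy). Qed.

Lemma orbit_cb (r : R) (y : point) (t : R) :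
  (forall y, Y y -> cb n r (fst y)) -> Y y -> cb n r (orbit y t).
Proof. intros Hr Hy. apply (Hr (Pi xf y t)), HYinv, Hy. Qed.

Lemma segment_cb (r : R) (x x' z : vec) : cb n r x -> cb n r x' ->
  (forall l, Rabs (z l - x' l) <= Rabs (x l - x' l)) -> cb n (3 * r) z.
Proof.
  intros Hx Hx' Hz l Hl. specialize (Hx l Hl); specialize (Hx' l Hl); specialize (Hz l).
  unfold Rabs in *. repeat destruct Rcase_abs; lra.
Qed.

(** The sign structure of the row feeds the variation argument; its closeness to the Jacobian feeds
    the linearization limit. The radius [3 * r] covers the intermediate points, which lie within
    [2 * r] of [x'] in each coordinate. *)
Lemma difference_rows (g : vfield) (t r M : R) (x x' : vec) (i : nat) :
  in_hull n f g -> (i < n)%nat -> cb n r x -> cb n r x' ->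
  (forall g t x i j, in_hull n f g -> (i < n)%nat -> (j < n)%nat -> cb n (3 * r) x -> Rabs (jac n g t x i j) <= M) ->
  exists A : nat -> R,
    (forall j, (j < n)%nat -> Rabs (A j) <= M) /\
    (forall j, (j < n)%nat -> (j + 1 < i \/ i + 1 < j)%nat -> A j = 0) /\
    (forall j, (j < n)%nat -> (j = i + 1 \/ i = j + 1)%nat -> eps0 <= A j) /\
    (forall eps d, in_modulus n (jac n g) (3 * r) eps d ->
       (forall l, (l < n)%nat -> Rabs (x l - x' l) <= d) ->
       forall j, (j < n)%nat -> Rabs (A j - jac n g t x' i j) <= eps) /\
    g t x i - g t x' i = rsum n (fun j => A j * (x j - x' j)).
Proof.
  intros Hg Hi Hx Hx' HM.
  destruct (mean_value_rows n g (jac n g) t x x' i (hull_is_jac n f Hadm g Hg)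
              (hull_tridiagonal n f Htri g Hg) Hi) as [xi [Hxi E]].
  assert (Hcb : forall j, cb n (3 * r) (xi j)) by (intros j; eapply segment_cb; [exact Hx|exact Hx'|apply Hxi]).
  exists (fun j => jac n g t (xi j) i j). repeat split; auto.
  - intros j Hj Hij. apply (hull_jac_tridiagonal n f Hadm Htri); auto.
  - intros j Hj Hij. apply (hull_jac_offdiag n f eps0 Hadm Hcoop); auto.
  - intros eps d Hmod Hd j Hj. apply Hmod; auto.
    + intros l Hl. specialize (Hx' l Hl). pose proof (Rabs_pos (x' l)). lra.
    + intros l Hl. eapply Rle_trans; [apply Hxi|apply Hd; exact Hl].
Qed.

Lemma traj_unique (g : vfield) (u1 u2 : R -> vec) (a b s r : R) :
  in_hull n f g -> is_traj g u1 (fun t => a <= t <= b) -> is_traj g u2 (fun t => a <= t <= b) ->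
  (forall t, a <= t <= b -> cb n r (u1 t)) -> (forall t, a <= t <= b -> cb n r (u2 t)) ->
  a <= s <= b -> (forall i, (i < n)%nat -> u1 s i = u2 s i) ->
  forall t, a <= t <= b -> forall i, (i < n)%nat -> u1 t i = u2 t i.
Proof.
  intros Hg H1 H2 Hr1 Hr2 Hs Es t Ht i Hi.
  destruct (hull_jac_bound n f Hadm (3 * r)) as [M [HM HMb]].
  assert (H0 : vsub (u1 t) (u2 t) i = 0).
  { apply (gronwall_zero n M (fun t => vsub (u1 t) (u2 t)) a b s HM); auto.
    - intros z Hz j Hj. exists (g z (u1 z) j - g z (u2 z) j). split.
      + apply (derivable_pt_lim_minus (fun s => u1 s j) (fun s => u2 s j)); [apply H1|apply H2]; exact Hz.
      + destruct (difference_rows g z r M (u1 z) (u2 z) j Hg Hj (Hr1 z Hz) (Hr2 z Hz) HMb)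
          as [A [HA [_ [_ [_ E]]]]].
        rewrite E, Rplus_0_r. apply (rsum_row_bound n A (vsub (u1 z) (u2 z))); exact HA.
    - intros j Hj. unfold vsub. rewrite Es by exact Hj. ring. }
  unfold vsub in H0. lra.
Qed.

(** [xf] is only known to give trajectories staying in [Y], so the cocycle property is derived from
    uniqueness of bounded trajectories. *)
Lemma orbit_Pi (y : point) (s t : R) : Y y -> orbit (Pi xf y s) t = orbit y (t + s).
Proof.
  intros Hy. destruct base_bounded as [r [Hr Hb]].
  apply (inRn_ext n); try apply orbit_inRn; auto.
  assert (Hab : - Rabs t <= 0 <= Rabs t /\ - Rabs t <= t <= Rabs t).
  { unfold Rabs; destruct Rcase_abs; lra. }
  apply (traj_unique (shift (snd y) s) (orbit (Pi xf y s)) (fun t => orbit y (t + s)) (- Rabs t) (Rabs t) 0 r).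
  - apply (base_hull (Pi xf y s)). auto.
  - intros u _ i. apply (orbit_traj (Pi xf y s)); auto.
  - intros u _ i. apply (derivable_pt_lim_shift (fun s => orbit y s i)).
    apply (orbit_traj y Hy (u + s) I i).
  - intros u _. apply orbit_cb; auto.
  - intros u _. apply orbit_cb; auto.
  - apply Hab.
  - intros i Hi. rewrite orbit_0 by auto. rewrite Rplus_0_l. reflexivity.
  - apply Hab.
Qed.

Lemma Pi_Pi (y : point) (s t : R) : Y y -> Pi xf (Pi xf y s) t = Pi xf y (t + s).
Proof.
  intros Hy. transitivity (orbit (Pi xf y s) t, shift (shift (snd y) s) t); [reflexivity|].
  rewrite orbit_Pi, shift_shift by exact Hy. reflexivity.
Qed.

Lemma Pi_0 (y : point) : Y y -> Pi xf y 0 = y.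
Proof.
  intros Hy. unfold Pi. pose proof (orbit_0 y Hy) as E. unfold orbit in E. rewrite E.
  destruct y as [x0 g]; simpl. f_equal. unfold shift. extensionality t. extensionality x.
  f_equal. ring.
Qed.

Lemma coef_Pi (y : point) (s t : R) (i j : nat) : Y y -> (i < n)%nat -> (j < n)%nat ->
  coef (Pi xf y s) t i j = coef y (t + s) i j.
Proof.
  intros Hy Hi Hj. unfold coef. rewrite orbit_Pi by exact Hy. simpl.
  apply (jac_shift n f Hadm); auto. apply base_hull; exact Hy.
Qed.

Lemma coef_bound : exists M, 0 <= M /\ forall y t i j, Y y -> (i < n)%nat -> (j < n)%nat ->
  Rabs (coef y t i j) <= M.
Proof.
  destruct base_bounded as [r [Hr Hb]]. destruct (hull_jac_bound n f Hadm r) as [M [HM H]].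
  exists M. split; [exact HM|]. intros y t i j Hy Hi Hj. apply H; auto; [apply base_hull; exact Hy|].
  apply orbit_cb; auto.
Qed.

Definition lsol (y : point) (z : R -> vec) : Prop :=
  (forall t, inRn n (z t)) /\
  forall t i, (i < n)%nat ->
    derivable_pt_lim (fun s => z s i) t (rsum n (fun j => coef y t i j * z t j)).

Lemma lsol_comb (y : point) (z z' : R -> vec) (c c' : R) : lsol y z -> lsol y z' ->
  lsol y (fun t => vadd (vscal c (z t)) (vscal c' (z' t))).
Proof.
  intros [H1 H2] [H1' H2']. split.
  - intros t i Hi. unfold vadd, vscal. rewrite H1, H1' by exact Hi. ring.
  - intros t i Hi. unfold vadd, vscal.
    replace (rsum n (fun j => coef y t i j * (c * z t j + c' * z' t j)))
      with (c * rsum n (fun j => coef y t i j * z t j) + c' * rsum n (fun j => coef y t i j * z' t j)).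
    + apply (derivable_pt_lim_plus (fun s => c * z s i) (fun s => c' * z' s i)).
      * apply (derivable_pt_lim_scal (fun s => z s i)); auto.
      * apply (derivable_pt_lim_scal (fun s => z' s i)); auto.
    + rewrite <- !rsum_scal, <- rsum_plus. apply rsum_ext. intros; ring.
Qed.

Lemma lsol_scal (y : point) (z : R -> vec) (c : R) : lsol y z -> lsol y (fun t => vscal c (z t)).
Proof.
  intros H. pose proof (lsol_comb y z z c 0 H H) as Hc.
  replace (fun t => vscal c (z t)) with (fun t => vadd (vscal c (z t)) (vscal 0 (z t))); [exact Hc|].
  extensionality t. extensionality i. unfold vadd, vscal. ring.
Qed.

Lemma lsol_diff_ineq (M : R) (y : point) (z : R -> vec) (a b : R) :
  (forall y t i j, Y y -> (i < n)%nat -> (j < n)%nat -> Rabs (coef y t i j) <= M) ->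
  Y y -> lsol y z -> diff_ineq n M 0 z a b.
Proof.
  intros HM Hy [_ Hz] t _ i Hi. eexists. split; [apply Hz; exact Hi|].
  rewrite Rplus_0_r. apply (rsum_row_bound n (coef y t i) (z t)). intros; apply HM; auto.
Qed.

Lemma lsol_zero (y : point) (z : R -> vec) (s t : R) : Y y -> lsol y z -> z s = vzero -> z t = vzero.
Proof.
  intros Hy Hz Hs. destruct coef_bound as [M [HM HMb]].
  assert (Hab : Rmin s t <= s <= Rmax s t /\ Rmin s t <= t <= Rmax s t).
  { pose proof (Rmin_l s t); pose proof (Rmin_r s t); pose proof (Rmax_l s t); pose proof (Rmax_r s t). lra. }
  apply (inRn_ext n); [apply Hz|intros i _; reflexivity|].
  apply (gronwall_zero n M z (Rmin s t) (Rmax s t) s HM); try apply Hab.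
  - eapply lsol_diff_ineq; eauto.
  - intros j Hj. rewrite Hs. reflexivity.
Qed.

Lemma lsol_unique (y : point) (z z' : R -> vec) (s t : R) :
  Y y -> lsol y z -> lsol y z' -> z s = z' s -> z t = z' t.
Proof.
  intros Hy Hz Hz' Hs.
  pose proof (lsol_zero y _ s t Hy (lsol_comb y z z' 1 (-1) Hz Hz')) as H.
  assert (H0 : vadd (vscal 1 (z s)) (vscal (-1) (z' s)) = vzero).
  { rewrite Hs. extensionality i. unfold vadd, vscal, vzero. ring. }
  specialize (H H0). extensionality i. apply (f_equal (fun v => v i)) in H.
  unfold vadd, vscal, vzero in H. lra.
Qed.

Lemma lsol_Pi (y : point) (z : R -> vec) (s : R) :
  Y y -> lsol y z -> lsol (Pi xf y s) (fun t => z (t + s)).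
Proof.
  intros Hy [H1 H2]. split; [intros t; apply H1|]. intros t i Hi.
  replace (rsum n (fun j => coef (Pi xf y s) t i j * z (t + s) j))
    with (rsum n (fun j => coef y (t + s) i j * z (t + s) j)).
  - apply (derivable_pt_lim_shift (fun u => z u i)). apply H2; exact Hi.
  - apply rsum_ext. intros j Hj. rewrite coef_Pi; auto.
Qed.

Lemma lsol_Pi_inv (y : point) (z : R -> vec) (s : R) :
  Y y -> lsol (Pi xf y s) z -> lsol y (fun t => z (t - s)).
Proof.
  intros Hy Hz. pose proof (lsol_Pi (Pi xf y s) z (- s) (HYinv y s Hy) Hz) as H.
  rewrite Pi_Pi in H by exact Hy. replace (- s + s) with 0 in H by ring.
  rewrite Pi_0 in H by exact Hy. exact H.
Qed.

Lemma lsol_tri_system (M : R) (y : point) (z : R -> vec) (a b : R) :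
  (forall y t i j, Y y -> (i < n)%nat -> (j < n)%nat -> Rabs (coef y t i j) <= M) ->
  Y y -> lsol y z -> tri_system n M eps0 z a b.
Proof.
  intros HM Hy [_ Hz] t _ i Hi. exists (coef y t i). repeat split; auto.
  - intros j Hj Hij. apply (hull_jac_tridiagonal n f Hadm Htri); auto. apply base_hull; exact Hy.
  - intros j Hj Hij. apply (hull_jac_offdiag n f eps0 Hadm Hcoop); auto. apply base_hull; exact Hy.
Qed.

Lemma nonzero_ex (x : vec) : inRn n x -> x <> vzero -> exists i, (i < n)%nat /\ x i <> 0.
Proof.
  intros Hx Hne. apply NNPP; intros Hno. apply Hne, (inRn_ext n); auto; [intros i _; reflexivity|].
  intros i Hi. apply NNPP; intros Hc. apply Hno. exists i; auto.
Qed.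

Lemma lsol_nonzero (y : point) (z : R -> vec) (s : R) : Y y -> lsol y z -> z s <> vzero ->
  forall t, z t <> vzero.
Proof. intros Hy Hz Hs t Ht. apply Hs, (lsol_zero y z t s); auto. Qed.

Lemma lsol_variation (y : point) (z : R -> vec) (a b : R) : Y y -> lsol y z -> z a <> vzero -> a < b ->
  forall e e', compat n e (z b) -> compat n e' (z a) -> (changes (n - 1) e <= changes (n - 1) e')%nat.
Proof.
  intros Hy Hz Ha Hab. destruct coef_bound as [M [HM HMb]].
  apply (variation_diminishing n M eps0 z a b eps0_pos Hab).
  - eapply lsol_tri_system; eauto.
  - intros t _. apply nonzero_ex; [apply Hz|]. eapply lsol_nonzero; eauto.
Qed.

(** The difference of the two orbits satisfies a linear differential inequality whose forcing is the
    distance of the two fields along the limit orbit, so Gronwall applies on the fixed window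
    [[-T, T]]. *)
Lemma orbit_cv (yk : nat -> point) (y : point) (T eps : R) :
  (forall k, Y (yk k)) -> Y y -> conv_pt n yk y -> 0 <= T -> 0 < eps ->
  exists K, forall k, (K <= k)%nat -> forall t l, Rabs t <= T -> (l < n)%nat ->
    Rabs (orbit (yk k) t l - orbit y t l) < eps.
Proof.
  intros Hyk Hy [Hc1 Hc2] HT He. destruct base_bounded as [r [Hr Hb]].
  destruct (hull_jac_bound n f Hadm (3 * r)) as [M [HM HMb]].
  destruct (gronwall_small n M (2 * T) eps HM He) as [d [Hd G]].
  destruct (conv_co_coord n _ _ T r d Hc2 Hr Hd) as [K1 HK1].
  destruct (vcv_unif n _ _ (conv_vec_vcv n _ _ Hc1) d Hd) as [K2 HK2].
  exists (Nat.max K1 K2). intros k Hk t l Ht Hl.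
  assert (Ht' : - T <= t <= T) by (unfold Rabs in Ht; destruct Rcase_abs in Ht; lra).
  apply (G (fun t => vsub (orbit (yk k) t) (orbit y t)) (- T) T 0); auto; try lra.
  - intros u Hu i Hi. exists (snd (yk k) u (orbit (yk k) u) i - snd y u (orbit y u) i). split.
    + apply (derivable_pt_lim_minus (fun s => orbit (yk k) s i) (fun s => orbit y s i));
        [apply (orbit_traj (yk k) (Hyk k) u I i)|apply (orbit_traj y Hy u I i)].
    + assert (Hu' : Rabs u <= T) by (unfold Rabs; destruct Rcase_abs; lra).
      pose proof (HK1 k ltac:(lia) u (orbit y u) i Hu' (orbit_cb r y u Hb Hy) Hi) as Hclose.
      destruct (difference_rows (snd (yk k)) u r M (orbit (yk k) u) (orbit y u) i (base_hull _ (Hyk k)) Hi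
        (orbit_cb r _ u Hb (Hyk k)) (orbit_cb r _ u Hb Hy) HMb) as [A [HA [_ [_ [_ E]]]]].
      pose proof (rsum_row_bound n A (vsub (orbit (yk k) u) (orbit y u)) M HA) as Hrow.
      unfold vsub at 1 in Hrow. rewrite <- E in Hrow.
      unfold Rabs in Hrow at 1. unfold Rabs in Hclose. unfold Rabs at 1.
      repeat destruct Rcase_abs in Hrow; repeat destruct Rcase_abs in Hclose; destruct Rcase_abs; lra.
  - intros j Hj. unfold vsub. rewrite !orbit_0 by auto. apply Rlt_le, (HK2 k ltac:(lia) j Hj).
Qed.

Lemma coef_cv (yk : nat -> point) (y : point) (T eps : R) :
  (forall k, Y (yk k)) -> Y y -> conv_pt n yk y -> 0 <= T -> 0 < eps ->
  exists K, forall k, (K <= k)%nat -> forall t i j, Rabs t <= T -> (i < n)%nat -> (j < n)%nat ->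
    Rabs (coef (yk k) t i j - coef y t i j) <= eps.
Proof.
  intros Hyk Hy Hc HT He. destruct base_bounded as [r [Hr Hb]].
  destruct (hull_jac_modulus n f Hadm r (eps / 2) ltac:(lra)) as [d [Hd Hmod]].
  destruct (orbit_cv yk y T d Hyk Hy Hc HT ltac:(tauto)) as [K1 HK1].
  destruct (hull_jac_cv n f Hadm (fun k => snd (yk k)) (snd y) T r (eps / 2)) as [K2 HK2]; auto;
    [intros k; apply base_hull; auto|apply base_hull; auto|apply Hc|lra|].
  exists (Nat.max K1 K2). intros k Hk t i j Ht Hi Hj. unfold coef.
  pose proof (HK2 k ltac:(lia) t (orbit y t) i j Ht (orbit_cb r y t Hb Hy) Hi Hj) as H2.
  assert (H1 : Rabs (jac n (snd (yk k)) t (orbit (yk k) t) i j - jac n (snd (yk k)) t (orbit y t) i j) <= eps / 2).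
  { apply Hmod; auto; try (apply orbit_cb; auto); [apply base_hull; auto|].
    intros l Hl. apply Rlt_le, HK1; auto. lia. }
  unfold Rabs in *. repeat destruct Rcase_abs; lra.
Qed.

(** Normalized differences of nonlinear solutions solve exactly a linear system whose rows are
    merely close to the linearization; this notion covers them together with true linear
    solutions. *)
Definition almost_lsol (y : point) (eta T : R) (W : R -> vec) : Prop :=
  forall t, Rabs t <= T -> forall i, (i < n)%nat -> exists A : nat -> R,
    (forall j, (j < n)%nat -> Rabs (A j - coef y t i j) <= eta) /\
    derivable_pt_lim (fun s => W s i) t (rsum n (fun j => A j * W t j)).

Lemma lsol_almost (y : point) (eta T : R) (W : R -> vec) :
  0 <= eta -> lsol y W -> almost_lsol y eta T W.
Proof.
  intros He [_ H] t _ i Hi. exists (coef y t i). split; [|auto].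
  intros j _. rewrite Rminus_diag, Rabs_R0. exact He.
Qed.

Lemma almost_lsol_cv (yk : nat -> point) (y : point) (Wk : nat -> R -> vec) (z : R -> vec) :
  (forall k, Y (yk k)) -> Y y -> conv_pt n yk y ->
  (forall T eta, 0 < eta -> exists K, forall k, (K <= k)%nat -> almost_lsol (yk k) eta T (Wk k)) ->
  lsol y z -> vcv n (fun k => Wk k 0) (z 0) -> forall t, vcv n (fun k => Wk k t) (z t).
Proof.
  intros Hyk Hy Hc HW Hz H0 t i Hi eps He.
  set (T := Rabs t). assert (HT : 0 <= T) by apply Rabs_pos.
  destruct coef_bound as [M [HM HMb]].
  (* The rate [M + 2] bounds the perturbed rows: they differ from the limiting coefficients by at
     most [2 * eta], one [eta] from the perturbation and one from [coef_cv], with [eta <= 1]. The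
     second bound on [eta] keeps the forcing, that error applied to [z], below [d]. *)
  destruct (gronwall_small n (M + 2) (2 * T) eps ltac:(lra) He) as [d [Hd G]].
  destruct (finite_bound n (fun j C => forall s, - T <= s <= T -> Rabs (z s j) <= C)) as [B [HB Hzb]].
  { intros j c c' Hj Hcc s Hs. eapply Rle_trans; [apply Hj; exact Hs|exact Hcc]. }
  { intros j Hj. apply (continuous_bounded_on (fun s => z s j)); [lra|].
    intros c _. eapply derivable_pt_lim_continuity. apply Hz; exact Hj. }
  pose proof (pos_INR n) as HnR.
  set (eta := Rmin 1 (d / (2 * (INR n * B + 1)))).
  assert (HnB : 0 <= INR n * B) by (apply Rmult_le_pos; lra).
  assert (Heta : 0 < eta) by (apply Rmin_pos; [lra|apply Rdiv_lt_0_compat; lra]).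
  assert (Heta1 : eta <= 1) by apply Rmin_l.
  assert (Heta2 : INR n * (2 * eta * B) <= d).
  { assert (H : eta <= d / (2 * (INR n * B + 1))) by apply Rmin_r.
    apply (Rmult_le_compat_r (2 * (INR n * B + 1))) in H; [|lra].
    replace (d / (2 * (INR n * B + 1)) * (2 * (INR n * B + 1))) with d in H by (field; lra). nra. }
  destruct (HW T eta Heta) as [K1 HK1].
  destruct (coef_cv yk y T eta Hyk Hy Hc HT Heta) as [K2 HK2].
  destruct (vcv_unif n _ _ H0 d Hd) as [K3 HK3].
  exists (Nat.max K1 (Nat.max K2 K3)). intros k Hk. unfold Rdist.
  apply (G (fun t => vsub (Wk k t) (z t)) (- T) T 0); try lra; auto.
  - intros s Hs j Hj.
    assert (Hs' : Rabs s <= T) by (unfold Rabs; destruct Rcase_abs; lra).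
    destruct (HK1 k ltac:(lia) s Hs' j Hj) as [A [HA Hder]].
    exists (rsum n (fun l => A l * Wk k s l) - rsum n (fun l => coef y s j l * z s l)). split.
    + apply (derivable_pt_lim_minus (fun s => Wk k s j) (fun s => z s j)); [exact Hder|apply Hz; exact Hj].
    + assert (Hdiff : forall l, (l < n)%nat -> Rabs (A l - coef y s j l) <= 2 * eta).
      { intros l Hl. specialize (HA l Hl). pose proof (HK2 k ltac:(lia) s j l Hs' Hj Hl) as H2.
        unfold Rabs in *. repeat destruct Rcase_abs; lra. }
      replace (rsum n (fun l => A l * Wk k s l) - rsum n (fun l => coef y s j l * z s l))
        with (rsum n (fun l => A l * vsub (Wk k s) (z s) l) + rsum n (fun l => (A l - coef y s j l) * z s l)).
      * eapply Rle_trans; [apply Rabs_triang|]. apply Rplus_le_compat.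
        -- apply rsum_row_bound. intros l Hl. specialize (Hdiff l Hl). pose proof (HMb y s j l Hy Hj Hl) as H3.
           unfold Rabs in *. repeat destruct Rcase_abs; lra.
        -- eapply Rle_trans; [|exact Heta2]. apply rsum_abs_bound. intros l Hl. rewrite Rabs_mult.
           apply Rmult_le_compat; try apply Rabs_pos; auto.
      * rewrite <- rsum_plus, <- rsum_minus. apply rsum_ext. intros l _. unfold vsub. ring.
  - intros j Hj. unfold vsub. apply Rlt_le, (HK3 k ltac:(lia) j Hj).
  - unfold T, Rabs. destruct Rcase_abs; lra.
Qed.

(** * Exponential dichotomy *)

Variables (Phi : R -> point -> vec -> vec) (Q : point -> vec -> vec) (K alpha : R).
Hypothesis HPhi : is_fundamental n Y xf Phi.
Hypothesis Hhyp : exp_dichotomy n Y xf Phi Q K alpha.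

Lemma K_pos : 0 < K.
Proof. apply Hhyp. Qed.

Lemma alpha_pos : 0 < alpha.
Proof. apply Hhyp. Qed.

Lemma Phi_lsol (y : point) (v : vec) : Y y -> inRn n v ->
  lsol y (fun t => Phi t y v) /\ Phi 0 y v = v.
Proof.
  destruct y as [x0 g]. intros Hy Hv.
  destruct (HPhi x0 g Hy (jac n g) (hull_is_jac n f Hadm g (base_hull (x0, g) Hy)) v Hv) as [H0 [H1 H2]].
  split; [split; [exact H1|exact H2]|exact H0].
Qed.

Lemma lsol_eq_Phi (y : point) (z : R -> vec) (t : R) : Y y -> lsol y z -> z t = Phi t y (z 0).
Proof.
  intros Hy Hz. destruct (Phi_lsol y (z 0) Hy (proj1 Hz 0)) as [H1 H2].
  apply (lsol_unique y z _ 0 t Hy Hz H1). symmetry; exact H2.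
Qed.

Lemma Q_inRn (y : point) (v : vec) : Y y -> inRn n v -> inRn n (Q y v).
Proof. intros Hy Hv. destruct Hhyp as [_ [_ [H _]]]. apply (H y Hy). exact Hv. Qed.

Lemma Q_comb (y : point) (u v : vec) (c d : R) : Y y -> inRn n u -> inRn n v ->
  Q y (vadd (vscal c u) (vscal d v)) = vadd (vscal c (Q y u)) (vscal d (Q y v)).
Proof.
  intros Hy Hu Hv. destruct Hhyp as [_ [_ [H _]]]. destruct (H y Hy) as [[_ Hl] _].
  assert (Hs : forall c u, inRn n u -> inRn n (vscal c u)).
  { intros c' u' Hu' i Hi. unfold vscal. rewrite Hu' by exact Hi. ring. }
  destruct (Hl (vscal c u) (vscal d v) 1 (Hs c u Hu) (Hs d v Hv)) as [-> _].
  destruct (Hl u v c Hu Hv) as [_ ->]. destruct (Hl v u d Hv Hu) as [_ ->]. reflexivity.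
Qed.

Lemma Q_vzero (y : point) : Y y -> Q y vzero = vzero.
Proof.
  intros Hy. assert (H0 : inRn n vzero) by (intros i _; reflexivity).
  pose proof (Q_comb y vzero vzero 0 0 Hy H0 H0) as H.
  replace (vadd (vscal 0 vzero) (vscal 0 vzero)) with vzero in H
    by (extensionality i; unfold vadd, vscal, vzero; ring).
  rewrite H. extensionality i. unfold vadd, vscal, vzero. ring.
Qed.

Lemma Q_idem (y : point) (v : vec) : Y y -> inRn n v -> Q y (Q y v) = Q y v.
Proof. intros Hy Hv. destruct Hhyp as [_ [_ [H _]]]. apply (H y Hy). exact Hv. Qed.

(** This is the backward dichotomy estimate at time 0. *)
Lemma Q_bound (y : point) (v : vec) : Y y -> inRn n v -> vnorm n (Q y v) <= K * vnorm n v.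
Proof.
  intros Hy Hv. destruct Hhyp as [_ [_ [H _]]]. destruct (H y Hy) as [_ [_ [_ [_ [H2 _]]]]].
  specialize (H2 0 v (Rle_refl 0) Hv).
  destruct (Phi_lsol y (Q y v) Hy (Q_inRn y v Hy Hv)) as [_ E]. rewrite E in H2.
  rewrite Rmult_0_r, exp_0, Rmult_1_r in H2. exact H2.
Qed.

Lemma Q_lincomb (y : point) (b : nat -> vec) (c : nat -> R) (N : nat) : Y y ->
  (forall k, (k < N)%nat -> inRn n (b k)) ->
  inRn n (lincomb b c N) /\ Q y (lincomb b c N) = lincomb (fun k => Q y (b k)) c N.
Proof.
  intros Hy. induction N as [|N IH]; intros Hb.
  - split; [intros i _; reflexivity|]. apply (Q_vzero y Hy).
  - destruct IH as [IH1 IH2]; [intros; apply Hb; lia|].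
    assert (E : lincomb b c (S N) = vadd (vscal 1 (lincomb b c N)) (vscal (c N) (b N))).
    { extensionality i. unfold lincomb, vadd, vscal. simpl. ring. }
    split.
    + intros i Hi. unfold lincomb. apply rsum_zero. intros k Hk. rewrite Hb by (auto; lia). ring.
    + rewrite E, Q_comb, IH2 by (auto; apply Hb; lia).
      extensionality i. unfold lincomb, vadd, vscal. simpl. ring.
Qed.

Lemma lsol_lincomb (y : point) (z : nat -> R -> vec) (c : nat -> R) (N : nat) :
  (forall k, (k < N)%nat -> lsol y (z k)) -> lsol y (fun t => lincomb (fun k => z k t) c N).
Proof.
  induction N as [|N IH]; intros Hz.
  - split; [intros t i _; reflexivity|]. intros t i Hi. simpl.
    rewrite rsum_zero by (intros; unfold lincomb; simpl; ring). apply derivable_pt_lim_const.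
  - pose proof (lsol_comb y _ (z N) 1 (c N) (IH ltac:(intros; apply Hz; lia)) (Hz N ltac:(lia))) as H.
    match type of H with lsol _ ?F => replace (fun t => lincomb (fun k => z k t) c (S N)) with F end;
      [exact H|].
    extensionality t. extensionality i. unfold lincomb, vadd, vscal. simpl. ring.
Qed.

Lemma lsol_Q (y : point) (z : R -> vec) (t : R) : Y y -> lsol y z ->
  Q (Pi xf y t) (z t) = Phi t y (Q y (z 0)).
Proof.
  intros Hy Hz. rewrite (lsol_eq_Phi y z t Hy Hz).
  destruct Hhyp as [_ [_ [H _]]]. destruct (H y Hy) as [_ [_ [H1 _]]].
  symmetry. apply H1. apply Hz.
Qed.

Definition stable (y : point) (z : R -> vec) : Prop := lsol y z /\ Q y (z 0) = vzero.
Definition unstable (y : point) (z : R -> vec) : Prop := lsol y z /\ Q y (z 0) = z 0.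

Lemma stable_Pi (y : point) (z : R -> vec) (s : R) :
  Y y -> stable y z -> stable (Pi xf y s) (fun t => z (t + s)).
Proof.
  intros Hy [Hz H0]. split; [apply lsol_Pi; assumption|]. rewrite Rplus_0_l, lsol_Q, H0 by assumption.
  destruct (Phi_lsol y vzero Hy (fun i _ => eq_refl)) as [H1 H2].
  apply (lsol_zero y _ 0 s Hy H1 H2).
Qed.

Lemma unstable_Pi (y : point) (z : R -> vec) (s : R) :
  Y y -> unstable y z -> unstable (Pi xf y s) (fun t => z (t + s)).
Proof.
  intros Hy [Hz H0]. split; [apply lsol_Pi; assumption|]. rewrite Rplus_0_l, lsol_Q, H0 by assumption.
  symmetry. apply lsol_eq_Phi; assumption.
Qed.

Lemma stable_decay (y : point) (z : R -> vec) (a b : R) : Y y -> stable y z -> a <= b ->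
  vnorm n (z b) <= K * exp (- alpha * (b - a)) * vnorm n (z a).
Proof.
  intros Hy Hz Hab. pose proof (HYinv y a Hy) as Hya. destruct (stable_Pi y z a Hy Hz) as [H1 H2].
  destruct Hhyp as [_ [_ [H _]]]. destruct (H _ Hya) as [_ [_ [_ [H3 _]]]].
  specialize (H3 (b - a) (z a) ltac:(lra) (proj1 (proj1 Hz) a)).
  rewrite Rplus_0_l in H2. rewrite H2 in H3.
  replace (vsub (z a) vzero) with (z a) in H3 by (extensionality i; unfold vsub, vzero; ring).
  pose proof (lsol_eq_Phi _ _ (b - a) Hya H1) as E. simpl in E. rewrite Rplus_0_l in E. rewrite <- E in H3.
  replace (b - a + a) with b in H3 by ring. exact H3.
Qed.

Lemma unstable_decay (y : point) (z : R -> vec) (a b : R) : Y y -> unstable y z -> a <= b ->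
  vnorm n (z a) <= K * exp (- alpha * (b - a)) * vnorm n (z b).
Proof.
  intros Hy Hz Hab. pose proof (HYinv y b Hy) as Hyb. destruct (unstable_Pi y z b Hy Hz) as [H1 H2].
  destruct Hhyp as [_ [_ [H _]]]. destruct (H _ Hyb) as [_ [_ [_ [_ [H3 _]]]]].
  specialize (H3 (a - b) (z b) ltac:(lra) (proj1 (proj1 Hz) b)).
  rewrite Rplus_0_l in H2. rewrite H2 in H3.
  pose proof (lsol_eq_Phi _ _ (a - b) Hyb H1) as E. simpl in E. rewrite Rplus_0_l in E. rewrite <- E in H3.
  replace (a - b + b) with a in H3 by ring.
  replace (- alpha * (b - a)) with (alpha * (a - b)) by ring. exact H3.
Qed.

Lemma exp_decay_nonpos (c A : R) :
  0 <= A -> (forall t, 0 <= t -> c <= A * exp (- alpha * t)) -> c <= 0.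
Proof.
  intros HA H. pose proof alpha_pos as Hal. apply Rnot_lt_le; intros Hc.
  (* At this time [1 + x <= exp x] gives [c * exp (alpha * t) >= c + A], more than the hypothesis
     allows. *)
  assert (Ht : 0 <= A / (c * alpha)).
  { apply Rmult_le_pos; [exact HA|]. apply Rlt_le, Rinv_0_lt_compat. nra. }
  specialize (H _ Ht). set (t := A / (c * alpha)) in *.
  assert (E : c * (alpha * t) = A) by (unfold t; field; split; lra).
  pose proof (exp_ineq1_le (alpha * t)) as He.
  assert (Hm : exp (- alpha * t) * exp (alpha * t) = 1).
  { rewrite <- exp_plus. replace (- alpha * t + alpha * t) with 0 by ring. apply exp_0. }
  assert (c * exp (alpha * t) <= A).
  { apply Rle_trans with (A * exp (- alpha * t) * exp (alpha * t)).
    - apply Rmult_le_compat_r; [apply Rlt_le, exp_pos|exact H].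
    - rewrite Rmult_assoc, Hm. lra. }
  nra.
Qed.

(** The [Q]-component is an unstable solution, bounded in forward time because [Q] is bounded by
    [K]; the backward contraction from time [t] to 0 then forces its initial value to vanish. *)
Lemma bounded_forward_stable (y : point) (z : R -> vec) (B : R) : Y y -> lsol y z ->
  (forall t, 0 <= t -> vnorm n (z t) <= B) -> stable y z.
Proof.
  intros Hy Hz HB. split; [exact Hz|]. pose proof K_pos as HK.
  destruct (Phi_lsol y (Q y (z 0)) Hy (Q_inRn y _ Hy (proj1 Hz 0))) as [Hq Hq0].
  assert (Hu : unstable y (fun t => Phi t y (Q y (z 0)))).
  { split; [exact Hq|]. rewrite Hq0. apply Q_idem; [exact Hy|apply Hz]. }
  assert (HB0 : 0 <= B) by (eapply Rle_trans; [apply (vnorm_nonneg n (z 0))|apply HB; lra]).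
  apply (vnorm_le0_vzero n); [apply Q_inRn; [exact Hy|apply Hz]|].
  apply (exp_decay_nonpos _ (K * (K * B))); [repeat apply Rmult_le_pos; lra|].
  intros t Ht. pose proof (unstable_decay y _ 0 t Hy Hu Ht) as H. simpl in H. rewrite Hq0 in H.
  rewrite Rminus_0_r in H. eapply Rle_trans; [exact H|].
  rewrite <- (lsol_Q y z t Hy Hz).
  pose proof (Q_bound (Pi xf y t) (z t) (HYinv y t Hy) (proj1 Hz t)) as Hb. specialize (HB t Ht).
  replace (K * (K * B) * exp (- alpha * t)) with (K * exp (- alpha * t) * (K * B)) by ring.
  pose proof (exp_pos (- alpha * t)). apply Rmult_le_compat_l; [nra|]. nra.
Qed.

(** Subtracting the [Q]-component leaves a stable solution bounded in backward time, and the forward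
    contraction from [- t] to 0 makes it vanish. *)
Lemma bounded_backward_unstable (y : point) (z : R -> vec) (B : R) : Y y -> lsol y z ->
  (forall t, t <= 0 -> vnorm n (z t) <= B) -> unstable y z.
Proof.
  intros Hy Hz HB. split; [exact Hz|]. pose proof K_pos as HK. pose proof (pos_INR n) as HnR.
  destruct (Phi_lsol y (Q y (z 0)) Hy (Q_inRn y _ Hy (proj1 Hz 0))) as [Hq Hq0].
  set (r := fun t => vadd (vscal 1 (z t)) (vscal (-1) (Phi t y (Q y (z 0))))).
  assert (Hr : stable y r).
  { split; [apply lsol_comb; assumption|]. unfold r. rewrite Hq0, Q_comb, Q_idem;
      auto; try apply Hz; [|apply Q_inRn; [exact Hy|apply Hz]].
    extensionality i. unfold vadd, vscal, vzero. ring. }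
  assert (HB0 : 0 <= B) by (eapply Rle_trans; [apply (vnorm_nonneg n (z 0))|apply HB; lra]).
  assert (E : r 0 = vzero).
  { apply (vnorm_le0_vzero n); [apply Hr|].
    apply (exp_decay_nonpos _ (K * (INR n * (B + K * B)))).
    { apply Rmult_le_pos; [lra|]. apply Rmult_le_pos; [lra|]. nra. }
    intros t Ht. pose proof (stable_decay y r (- t) 0 Hy Hr ltac:(lra)) as H.
    replace (0 - - t) with t in H by ring. eapply Rle_trans; [exact H|].
    replace (K * (INR n * (B + K * B)) * exp (- alpha * t))
      with (K * exp (- alpha * t) * (INR n * (B + K * B))) by ring.
    pose proof (exp_pos (- alpha * t)). apply Rmult_le_compat_l; [nra|].
    rewrite (vnorm_ext n (r (- t)) (vsub (z (- t)) (Phi (- t) y (Q y (z 0)))))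
      by (intros i _; unfold r, vadd, vscal, vsub; ring).
    eapply Rle_trans; [apply vnorm_sub_le|]. apply Rmult_le_compat_l; [lra|].
    specialize (HB (- t) ltac:(lra)). rewrite <- (lsol_Q y z (- t) Hy Hz).
    pose proof (Q_bound (Pi xf y (- t)) (z (- t)) (HYinv y (- t) Hy) (proj1 Hz (- t))) as Hb. nra. }
  unfold r in E. rewrite Hq0 in E. extensionality i. apply (f_equal (fun v => v i)) in E.
  unfold vadd, vscal, vzero in E. lra.
Qed.

(** The dichotomy provides continuity of [Q] at a fixed vector; the uniform bound [K] upgrades it to
    joint continuity. *)
Lemma Q_cv (yk : nat -> point) (y : point) (vk : nat -> vec) (v : vec) :
  (forall k, Y (yk k)) -> Y y -> conv_pt n yk y -> (forall k, inRn n (vk k)) -> inRn n v ->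
  vcv n vk v -> vcv n (fun k => Q (yk k) (vk k)) (Q y v).
Proof.
  intros Hyk Hy Hc Hvk Hv Hcv i Hi eps He. pose proof K_pos as HK.
  destruct Hhyp as [_ [_ [_ Hcont]]].
  destruct (Hcont yk y Hyk Hy Hc v Hv (eps / 2) ltac:(lra)) as [K1 HK1].
  destruct (vcv_conv_vec n vk v Hcv (eps / (2 * K))) as [K2 HK2]; [apply Rdiv_lt_0_compat; lra|].
  exists (Nat.max K1 K2). intros k Hk. unfold Rdist.
  specialize (HK1 k ltac:(lia)). specialize (HK2 k ltac:(lia)).
  pose proof (coord_le_vnorm n (vsub (Q (yk k) v) (Q y v)) i Hi) as A1. unfold vsub in A1 at 1.
  set (dv := vsub (vk k) v) in *.
  assert (Hdv : inRn n dv) by (intros j Hj; unfold dv, vsub; rewrite Hvk, Hv by exact Hj; ring).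
  assert (E : Q (yk k) (vk k) = vadd (vscal 1 (Q (yk k) v)) (vscal 1 (Q (yk k) dv))).
  { rewrite <- Q_comb by auto. f_equal. extensionality j. unfold vadd, vscal, dv, vsub. ring. }
  rewrite E. unfold vadd, vscal.
  pose proof (coord_le_vnorm n (Q (yk k) dv) i Hi) as A2.
  pose proof (Q_bound (yk k) dv (Hyk k) Hdv) as A3.
  assert (A4 : K * vnorm n dv < eps / 2).
  { replace (eps / 2) with (K * (eps / (2 * K))) by (field; lra). nra. }
  replace (1 * Q (yk k) v i + 1 * Q (yk k) dv i - Q y v i)
    with ((Q (yk k) v i - Q y v i) + Q (yk k) dv i) by ring.
  eapply Rle_lt_trans; [apply Rabs_triang|]. lra.
Qed.

Lemma conv_pt_subseq (yk : nat -> point) (y : point) (phi : nat -> nat) :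
  increasing_index phi -> conv_pt n yk y -> conv_pt n (fun k => yk (phi k)) y.
Proof.
  intros Hphi [H1 H2]. split.
  - intros eps He. destruct (H1 eps He) as [K1 HK1]. exists K1. intros k Hk. apply HK1.
    pose proof (increasing_index_ge phi k Hphi). lia.
  - intros T r eps He. destruct (H2 T r eps He) as [K1 HK1]. exists K1. intros k Hk. apply HK1.
    pose proof (increasing_index_ge phi k Hphi). lia.
Qed.

Definition asymptotic_lsol (yk : nat -> point) (Xk : nat -> R -> vec) : Prop :=
  forall T eta, 0 < eta -> exists k0, forall k, (k0 <= k)%nat -> almost_lsol (yk k) eta T (Xk k).

(** Both families use the same subsequence because their limits must live over one point [y] to be
    superposed. Unit norm at time 0 keeps the limits from vanishing. *)
Lemma limit_lsol_pair (yk : nat -> point) (Xk Zk : nat -> R -> vec) :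
  (forall k, Y (yk k)) ->
  (forall k, vnorm n (Xk k 0) = 1) -> (forall k, vnorm n (Zk k 0) = 1) ->
  asymptotic_lsol yk Xk -> asymptotic_lsol yk Zk ->
  exists phi y X Z, increasing_index phi /\ Y y /\ conv_pt n (fun k => yk (phi k)) y /\
    lsol y X /\ lsol y Z /\ X 0 <> vzero /\ Z 0 <> vzero /\
    (forall t, vcv n (fun k => Xk (phi k) t) (X t)) /\ (forall t, vcv n (fun k => Zk (phi k) t) (Z t)).
Proof.
  intros Hyk HX HZ HaX HaZ.
  destruct (HYcpt yk Hyk) as [p1 [y [Hp1 [Hy Hc]]]].
  destruct (vcv_subsequence_of_bounded n (fun k => Xk (p1 k) 0) 1) as [p2 [X0 [Hp2 [HX0 HcX]]]].
  { intros k i Hi. rewrite <- (HX (p1 k)). apply coord_le_vnorm; exact Hi. }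
  destruct (vcv_subsequence_of_bounded n (fun k => Zk (p1 (p2 k)) 0) 1) as [p3 [Z0 [Hp3 [HZ0 HcZ]]]].
  { intros k i Hi. rewrite <- (HZ (p1 (p2 k))). apply coord_le_vnorm; exact Hi. }
  set (phi := fun k => p1 (p2 (p3 k))).
  assert (Hphi : increasing_index phi).
  { unfold phi. apply (increasing_index_comp p1); [exact Hp1|].
    apply (increasing_index_comp p2); assumption. }
  assert (HcX' : vcv n (fun k => Xk (phi k) 0) X0).
  { intros i Hi. apply (Un_cv_subseq (fun k => Xk (p1 (p2 k)) 0 i)); [exact Hp3|apply HcX; exact Hi]. }
  assert (Hc' : conv_pt n (fun k => yk (phi k)) y).
  { apply (conv_pt_subseq (fun k => yk (p1 k)) y (fun k => p2 (p3 k))); [|exact Hc].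
    apply increasing_index_comp; assumption. }
  assert (Has : forall Wk, asymptotic_lsol yk Wk -> asymptotic_lsol (fun k => yk (phi k)) (fun k => Wk (phi k))).
  { intros Wk H T eta He. destruct (H T eta He) as [k0 Hk0]. exists k0. intros k Hk. apply Hk0.
    pose proof (increasing_index_ge phi k Hphi). lia. }
  destruct (Phi_lsol y X0 Hy HX0) as [HlX EX]. destruct (Phi_lsol y Z0 Hy HZ0) as [HlZ EZ].
  assert (Hne : forall (Wk : nat -> R -> vec) W0, vcv n (fun k => Wk k 0) W0 ->
             (forall k, vnorm n (Wk k 0) = 1) -> W0 <> vzero).
  { intros Wk W0 Hcv H1 E. pose proof (vcv_vnorm n _ _ Hcv) as Hn1.
    assert (H : vnorm n W0 = 1).
    { apply (UL_sequence _ _ _ Hn1). intros eps He. exists 0%nat. intros k _. rewrite H1.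
      unfold Rdist. rewrite Rminus_diag, Rabs_R0. exact He. }
    assert (vnorm n W0 <= INR n * 0); [|lra]. apply vnorm_le_bound; [lra|].
    intros i _. rewrite E. unfold vzero. rewrite Rabs_R0. lra. }
  exists phi, y, (fun t => Phi t y X0), (fun t => Phi t y Z0).
  split; [exact Hphi|]. split; [exact Hy|]. split; [exact Hc'|]. split; [exact HlX|]. split; [exact HlZ|].
  split; [rewrite EX; apply (Hne (fun k => Xk (phi k))); auto|].
  split; [rewrite EZ; apply (Hne (fun k => Zk (phi k))); auto|].
  split.
  - apply (almost_lsol_cv (fun k => yk (phi k)) y (fun k => Xk (phi k))); auto;
      [apply Has; exact HaX|rewrite EX; exact HcX'].
  - apply (almost_lsol_cv (fun k => yk (phi k)) y (fun k => Zk (phi k))); auto;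
      [apply Has; exact HaZ|rewrite EZ; exact HcZ].
Qed.

(** * Comparison of stable and unstable solutions *)

(** [changes_upto] says S^- <= p, and the next definition says S^+ >= q. These forms, with one
    pattern as witness, are the ones that survive limits. *)
Definition changes_upto (x : vec) (p : nat) : Prop := exists e, compat n e x /\ (changes (n - 1) e <= p)%nat.
Definition changes_from (x : vec) (q : nat) : Prop := exists e, compat n e x /\ (q <= changes (n - 1) e)%nat.

Lemma changes_upto_opp (x : vec) (p : nat) : changes_upto x p -> changes_upto (vscal (-1) x) p.
Proof.
  intros [e [He Hp]]. exists (fun i => negb (e i)). split.
  - intros i Hi. destruct (He i Hi) as [H1 H2]. unfold vscal. split; intros Hx.
    + rewrite H2 by lra; reflexivity.
    + rewrite H1 by lra; reflexivity.
  - replace (changes (n - 1) (fun i => negb (e i))) with (changes (n - 1) e); [exact Hp|].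
    generalize (n - 1)%nat. induction n0 as [|m IH]; [reflexivity|].
    rewrite !changes_S, IH. destruct (e m), (e (S m)); reflexivity.
Qed.

Lemma changes_upto_scal (x : vec) (p : nat) (c : R) : c <> 0 -> changes_upto x p -> changes_upto (vscal c x) p.
Proof.
  intros Hc H. assert (Hpos : forall c x, 0 < c -> changes_upto x p -> changes_upto (vscal c x) p).
  { intros c' x' Hc' [e [He Hp]]. exists e. split; [apply compat_scal; assumption|exact Hp]. }
  destruct (Rtotal_order c 0) as [Hn0|[?|Hp]]; [|contradiction|apply Hpos; assumption].
  replace (vscal c x) with (vscal (- c) (vscal (-1) x)) by (extensionality i; unfold vscal; ring).
  apply Hpos; [lra|]. apply changes_upto_opp; exact H.
Qed.

Lemma derivable_pt_lim_zero_on (F : R -> R) (a b t l : R) :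
  a < t < b -> (forall s, a < s < b -> F s = 0) -> derivable_pt_lim F t l -> l = 0.
Proof.
  intros Ht HF Hl. apply (uniqueness_limite F t); [exact Hl|].
  intros eps He. assert (Hd : 0 < Rmin (t - a) (b - t)) by (apply Rmin_pos; lra).
  exists (mkposreal _ Hd). intros h Hh Hhd. simpl in Hhd.
  pose proof (Rmin_l (t - a) (b - t)); pose proof (Rmin_r (t - a) (b - t)).
  rewrite !HF; [|lra|unfold Rabs in Hhd; destruct Rcase_abs in Hhd; lra].
  replace ((0 - 0) / h - 0) with 0 by (field; exact Hh). rewrite Rabs_R0. exact He.
Qed.

(** If the first coordinate vanished on an interval, its equation would make the second vanish
    there, the coupling being at least [eps0], and so on until the whole solution is zero. *)
Lemma first_coord_nonzero (y : point) (z : R -> vec) (a b : R) : Y y -> lsol y z -> z 0 <> vzero -> a < b ->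
  exists t, a < t < b /\ z t 0%nat <> 0.
Proof.
  intros Hy Hz Hne Hab. apply NNPP; intros Hno.
  assert (H0 : forall t, a < t < b -> z t 0%nat = 0).
  { intros t Ht. apply NNPP; intros Hc. apply Hno. exists t; auto. }
  assert (Hall : forall i, (i < n)%nat -> forall j, (j <= i)%nat -> forall t, a < t < b -> z t j = 0).
  { induction i as [|i IH]; intros Hi j Hj t Ht.
    - replace j with 0%nat by lia. auto.
    - destruct (Nat.eq_dec j (S i)) as [-> |]; [|apply IH; auto; lia].
      pose proof (proj2 Hz t i ltac:(lia)) as Hd.
      pose proof (derivable_pt_lim_zero_on _ a b t _ Ht (IH ltac:(lia) i (le_n i)) Hd) as E.
      rewrite (rsum_ext n _ (fun j => (coef y t i j * z t j) * (if Nat.eqb j (S i) then 1 else 0))) in E.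
      + rewrite rsum_delta in E by lia.
        assert (eps0 <= coef y t i (S i)).
        { apply (hull_jac_offdiag n f eps0 Hadm Hcoop); try lia. apply base_hull; exact Hy. }
        pose proof eps0_pos. apply Rmult_integral in E. destruct E; [lra|assumption].
      + intros j Hjn. destruct (Nat.eqb_spec j (S i)); [ring|].
        destruct (le_lt_dec j i) as [Hle|Hgt].
        * rewrite (IH ltac:(lia) j Hle t Ht). ring.
        * unfold coef. rewrite (hull_jac_tridiagonal n f Hadm Htri);
            [ring|apply base_hull; exact Hy|lia|lia|lia]. }
  apply (lsol_nonzero y z 0 Hy Hz Hne ((a + b) / 2)).
  apply (inRn_ext n); [apply Hz|intros i _; reflexivity|].
  intros i Hi. apply (Hall i Hi i (le_n i)). lra.
Qed.

Lemma exp_seq_cv0 : Un_cv (fun k => exp (- alpha * INR k)) 0.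
Proof.
  intros eps He. pose proof alpha_pos as Hal.
  destruct (INR_unbounded (/ (alpha * eps))) as [k0 Hk0]. exists k0. intros k Hk.
  unfold Rdist. rewrite Rminus_0_r, Rabs_right by (left; apply exp_pos).
  assert (INR k0 <= INR k) by (apply le_INR; lia).
  pose proof (exp_ineq1_le (alpha * INR k)) as Hexp.
  replace (- alpha * INR k) with (- (alpha * INR k)) by ring. rewrite exp_Ropp.
  assert (Hae : 0 < alpha * eps) by nra.
  assert (H1 : 1 < alpha * eps * INR k).
  { rewrite <- (Rinv_r (alpha * eps)) by lra. apply Rmult_lt_compat_l; lra. }
  replace eps with (/ / eps) by (rewrite Rinv_inv; reflexivity).
  apply Rinv_lt_contravar; [apply Rmult_lt_0_compat; [apply Rinv_0_lt_compat; exact He|apply exp_pos]|].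
  apply Rmult_lt_reg_l with eps; [exact He|]. rewrite Rinv_r by lra. nra.
Qed.

(* Rescaling by the dominant solution [b], both [b] and [z] have the same limit along [tk]. *)
Lemma dominant_limit (y : point) (b z : R -> vec) (tk : nat -> R) (A m : R) :
  Y y -> lsol y b -> lsol y z -> b 0 <> vzero -> 0 < m ->
  (forall k, vnorm n (vsub (z (tk k)) (b (tk k))) <= A * exp (- alpha * INR k)) ->
  (forall k, m <= vnorm n (b (tk k))) ->
  exists phi y' Z, increasing_index phi /\ Y y' /\ lsol y' Z /\ Z 0 <> vzero /\
    forall t, exists k0, forall k, (k0 <= k)%nat -> forall e,
      (compat n e (b (t + tk (phi k))) -> compat n e (Z t)) /\
      (compat n e (z (t + tk (phi k))) -> compat n e (Z t)).
Proof.
  intros Hy Hb Hz Hb0 Hm HA Hmb.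
  set (c := fun k => / vnorm n (b (tk k))).
  assert (Hc : forall k, 0 < c k <= / m).
  { intros k. specialize (Hmb k). unfold c. split; [apply Rinv_0_lt_compat; lra|].
    apply Rinv_le_contravar; lra. }
  set (yk := fun k => Pi xf y (tk k)).
  set (Bk := fun k t => vscal (c k) (b (t + tk k))).
  set (Zk := fun k t => vscal (c k) (z (t + tk k))).
  assert (Hyk : forall k, Y (yk k)) by (intros k; apply HYinv; exact Hy).
  assert (HBl : forall k, lsol (yk k) (Bk k)) by (intros k; apply (lsol_scal (yk k) (fun t => b (t + tk k))), lsol_Pi; assumption).
  assert (HZl : forall k, lsol (yk k) (Zk k)) by (intros k; apply (lsol_scal (yk k) (fun t => z (t + tk k))), lsol_Pi; assumption).
  assert (HBa : asymptotic_lsol yk Bk) by (intros T eta He; exists 0%nat; intros k _; apply lsol_almost; [lra|auto]).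
  assert (HB1 : forall k, vnorm n (Bk k 0) = 1).
  { intros k. unfold Bk. rewrite vnorm_scal, Rplus_0_l. rewrite Rabs_right by (left; apply Hc).
    unfold c. apply Rinv_l. specialize (Hmb k). lra. }
  destruct (limit_lsol_pair yk Bk Bk Hyk HB1 HB1 HBa HBa)
    as [phi [y' [Z [_ [Hphi [Hy' [Hcv [HZ [_ [HZ0 [_ [Hlim _]]]]]]]]]]]].
  exists phi, y', Z. repeat (split; [assumption|]).
  (* [z] is normalized by the norm of [b], not by its own. Their rescaled difference tends to zero
     at time 0, and convergence at other times follows from the linear equations. *)
  assert (Hlim2 : forall t, vcv n (fun k => Zk (phi k) t) (Z t)).
  { apply (almost_lsol_cv (fun k => yk (phi k)) y' (fun k => Zk (phi k))); auto.
    - intros T eta He. exists 0%nat. intros k _. apply lsol_almost; [lra|auto].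
    - intros i Hi.
      assert (Hsm : Un_cv (fun k => Zk (phi k) 0 i - Bk (phi k) 0 i) 0).
      { apply (Un_cv_subseq (fun k => Zk k 0 i - Bk k 0 i) 0 phi Hphi).
        intros eps He. pose proof (Rinv_0_lt_compat m Hm) as Him.
        assert (HAp : 0 < / m * (Rabs A + 1)) by (pose proof (Rabs_pos A); apply Rmult_lt_0_compat; lra).
        destruct (exp_seq_cv0 (eps / (/ m * (Rabs A + 1)))) as [k0 Hk0]; [apply Rdiv_lt_0_compat; assumption|].
        exists k0. intros k Hk. specialize (Hk0 k Hk). unfold Rdist in *. rewrite Rminus_0_r in *.
        rewrite Rabs_right in Hk0 by (left; apply exp_pos).
        unfold Zk, Bk, vscal. rewrite !Rplus_0_l, <- Rmult_minus_distr_l, Rabs_mult.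
        rewrite (Rabs_right (c k)) by (left; apply Hc).
        pose proof (coord_le_vnorm n (vsub (z (tk k)) (b (tk k))) i Hi) as H1. unfold vsub in H1 at 1.
        specialize (HA k). pose proof (exp_pos (- alpha * INR k)) as Hep.
        apply (Rmult_lt_compat_l (/ m * (Rabs A + 1))) in Hk0; [|exact HAp].
        replace (/ m * (Rabs A + 1) * (eps / (/ m * (Rabs A + 1)))) with eps in Hk0
          by (field; pose proof (Rabs_pos A); split; lra).
        eapply Rle_lt_trans; [|exact Hk0].
        rewrite Rmult_assoc. pose proof (Rle_abs A).
        apply Rmult_le_compat; [left; apply Hc|apply Rabs_pos|apply Hc|]. nra. }
      assert (HH := CV_plus _ _ _ _ Hsm (Hlim 0 i Hi)). rewrite Rplus_0_l in HH.
      replace (fun k => Zk (phi k) 0 i) with (fun k => Zk (phi k) 0 i - Bk (phi k) 0 i + Bk (phi k) 0 i);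
        [exact HH|]. extensionality k. ring. }
  intros t. destruct (compat_limit n _ _ (Hlim t)) as [k1 Hk1]. destruct (compat_limit n _ _ (Hlim2 t)) as [k2 Hk2].
  exists (Nat.max k1 k2). intros k Hk e. split; intros He.
  - apply (Hk1 k ltac:(lia)). apply compat_scal; [apply Hc|exact He].
  - apply (Hk2 k ltac:(lia)). apply compat_scal; [apply Hc|exact He].
Qed.

Lemma stable_unstable_gap (y : point) (s u : R -> vec) (p q : nat) :
  Y y -> stable y s -> unstable y u -> s 0 <> vzero -> u 0 <> vzero ->
  (forall t, changes_upto (s t) p) -> (forall t, changes_from (u t) q) -> (q + 1 <= p)%nat.
Proof.
  intros Hy Hst Hun Hs0 Hu0 Hp Hq.
  pose proof (proj1 Hst) as Hsl. pose proof (proj2 Hst) as HsQ.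
  pose proof (proj1 Hun) as Hul. pose proof (proj2 Hun) as HuQ.
  pose proof K_pos as HK. pose proof alpha_pos as Hal.
  (* The first coordinate of [s] is nonzero near some [t1], and that of [u] cannot vanish on a whole
     interval there. At a common time [t0] the constant [c] is then defined and nonzero. *)
  assert (Ht0 : exists t0, s t0 0%nat <> 0 /\ u t0 0%nat <> 0).
  { destruct (first_coord_nonzero y s 0 1 Hy Hsl Hs0 ltac:(lra)) as [t1 [_ Hs1]].
    pose proof (derivable_pt_lim_continuity _ _ _ (proj2 Hsl t1 0%nat ltac:(lia))) as Hct.
    destruct (Hct (Rabs (s t1 0%nat)) (Rabs_pos_lt _ Hs1)) as [d [Hd Hcl]].
    destruct (first_coord_nonzero y u t1 (t1 + d) Hy Hul Hu0 ltac:(lra)) as [t0 [Ht0 Hu1]].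
    exists t0. split; [|exact Hu1]. intros E.
    assert (Hbad : Rabs (s t0 0%nat - s t1 0%nat) < Rabs (s t1 0%nat)).
    { apply (Hcl t0). split; [split; [exact I|lra]|]. simpl. unfold Rdist. rewrite Rabs_right; lra. }
    rewrite E, Rminus_0_l, Rabs_Ropp in Hbad. lra. }
  destruct Ht0 as [t0 [Hst0 Hut0]].
  set (c := - u t0 0%nat / s t0 0%nat).
  assert (Hc : c <> 0).
  { unfold c. intros E. apply Hut0. apply (f_equal (fun r => r * s t0 0%nat)) in E. field_simplify in E; [lra|exact Hst0]. }
  set (cs := fun t => vscal c (s t)).
  set (z := fun t => vadd (vscal 1 (u t)) (vscal c (s t))).
  assert (Hcs : lsol y cs) by (apply lsol_scal; exact Hsl).
  assert (Hz : lsol y z) by (apply lsol_comb; assumption).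
  assert (Hcs0 : cs 0 <> vzero).
  { intros E. destruct (nonzero_ex (s 0) (proj1 Hsl 0) Hs0) as [i [_ Hi]].
    apply (f_equal (fun v => v i)) in E. unfold cs, vscal, vzero in E.
    apply Rmult_integral in E. destruct E; contradiction. }
  assert (Hz0 : z 0 <> vzero).
  { intros E. apply Hu0. rewrite <- HuQ.
    assert (H : Q y (z 0) = vzero) by (rewrite E; apply Q_vzero; exact Hy).
    unfold z in H. rewrite Q_comb, HuQ, HsQ in H; auto; try apply Hul; try apply Hsl.
    rewrite HuQ. extensionality i. apply (f_equal (fun v => v i)) in H. unfold vadd, vscal, vzero in *. lra. }
  assert (Hznz : forall t, z t <> vzero) by (apply (lsol_nonzero y z 0 Hy Hz Hz0)).
  pose proof (pos_INR n) as HnR.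
  assert (npos : forall x, inRn n x -> x <> vzero -> 0 < vnorm n x).
  { intros x Hx Hne. destruct (nonzero_ex x Hx Hne) as [i [Hi Hxi]]. apply (vnorm_pos n x i Hi Hxi). }
  assert (Hexp1 : forall k, exp (- alpha * INR k) <= 1).
  { intros k. rewrite <- exp_0. pose proof (pos_INR k).
    destruct (Req_dec (- alpha * INR k) 0) as [-> |ne]; [lra|]. apply Rlt_le, exp_increasing. nra. }
  assert (lower : forall N0 X k, 0 < N0 -> N0 <= K * exp (- alpha * INR k) * X -> 0 <= X -> N0 / K <= X).
  { intros N0 X k HN H HX. apply Rmult_le_reg_l with K; [exact HK|].
    replace (K * (N0 / K)) with N0 by (field; lra). specialize (Hexp1 k). pose proof (exp_pos (- alpha * INR k)).
    eapply Rle_trans; [exact H|]. rewrite Rmult_assoc. apply Rmult_le_compat_l; [lra|]. nra. }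
  (* The limit [Z] of the rescaled [u] has one pattern with at least [q] changes at time 0, so one
     unit of time earlier all its patterns have that many. A bound on all patterns transfers back to
     [z], whose rescaled limit is the same. *)
  assert (Hplus : exists t, t0 < t /\ forall e, compat n e (z t) -> (q <= changes (n - 1) e)%nat).
  { destruct (dominant_limit y u z (fun k => INR k) (Rabs c * (K * vnorm n (s 0))) (vnorm n (u 0) / K) Hy Hul Hz Hu0)
      as [phi [y' [Z [Hphi [Hy' [HZ [HZ0 Hlim]]]]]]].
    - apply Rdiv_lt_0_compat; [apply npos; [apply Hul|exact Hu0]|exact HK].
    - intros k.
      rewrite (vnorm_ext n (vsub (z (INR k)) (u (INR k))) (vscal c (s (INR k))))
        by (intros i _; unfold z, vsub, vadd, vscal; ring).
      rewrite vnorm_scal. pose proof (stable_decay y s 0 (INR k) Hy Hst (pos_INR k)) as H.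
      rewrite Rminus_0_r in H. rewrite !Rmult_assoc. apply Rmult_le_compat_l; [apply Rabs_pos|]. lra.
    - intros k. apply (lower _ _ k); [apply npos; [apply Hul|exact Hu0]| |apply vnorm_nonneg].
      pose proof (unstable_decay y u 0 (INR k) Hy Hun (pos_INR k)) as H. rewrite Rminus_0_r in H. exact H.
    - destruct (Hlim 0) as [k1 Hk1]. destruct (Hlim (-1)) as [k2 Hk2].
      destruct (INR_unbounded (t0 + 1)) as [k3 Hk3].
      assert (HZq : changes_from (Z 0) q).
      { destruct (Hq (0 + INR (phi k1))) as [e [He Hqe]]. exists e. split; [|exact Hqe].
        apply (proj1 (Hk1 k1 (le_n k1) e)). exact He. }
      destruct HZq as [e0 [He0 Hq0]].
      set (k := Nat.max k2 k3). exists (-1 + INR (phi k)). split.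
      + assert (INR k3 <= INR (phi k)); [|lra]. apply le_INR. pose proof (increasing_index_ge phi k Hphi). lia.
      + intros e He. apply (proj2 (Hk2 k ltac:(lia) e)) in He.
        pose proof (lsol_variation y' Z (-1) 0 Hy' HZ (lsol_nonzero y' Z 0 Hy' HZ HZ0 (-1)) ltac:(lra) e0 e He0 He). lia. }
  (* Symmetric: [c * s] dominates in the past, and the limit is read one unit of time later. *)
  assert (Hminus : exists t, t < t0 /\ forall e, compat n e (z t) -> (changes (n - 1) e <= p)%nat).
  { destruct (dominant_limit y cs z (fun k => - INR k) (K * vnorm n (u 0)) (Rabs c * (vnorm n (s 0) / K)) Hy Hcs Hz Hcs0)
      as [phi [y' [Z [Hphi [Hy' [HZ [HZ0 Hlim]]]]]]].
    - apply Rmult_lt_0_compat; [apply Rabs_pos_lt; exact Hc|].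
      apply Rdiv_lt_0_compat; [apply npos; [apply Hsl|exact Hs0]|exact HK].
    - intros k.
      rewrite (vnorm_ext n (vsub (z (- INR k)) (cs (- INR k))) (u (- INR k)))
        by (intros i _; unfold z, cs, vsub, vadd, vscal; ring).
      pose proof (unstable_decay y u (- INR k) 0 Hy Hun ltac:(pose proof (pos_INR k); lra)) as H.
      replace (0 - - INR k) with (INR k) in H by ring. lra.
    - intros k. unfold cs. rewrite vnorm_scal. apply Rmult_le_compat_l; [apply Rabs_pos|].
      apply (lower _ _ k); [apply npos; [apply Hsl|exact Hs0]| |apply vnorm_nonneg].
      pose proof (stable_decay y s (- INR k) 0 Hy Hst ltac:(pose proof (pos_INR k); lra)) as H.
      replace (0 - - INR k) with (INR k) in H by ring. exact H.
    - destruct (Hlim 0) as [k1 Hk1]. destruct (Hlim 1) as [k2 Hk2].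
      destruct (INR_unbounded (1 - t0)) as [k3 Hk3].
      assert (HZp : changes_upto (Z 0) p).
      { destruct (changes_upto_scal _ p c Hc (Hp (0 + - INR (phi k1)))) as [e [He Hpe]]. exists e. split; [|exact Hpe].
        apply (proj1 (Hk1 k1 (le_n k1) e)). exact He. }
      destruct HZp as [e0 [He0 Hp0]].
      set (k := Nat.max k2 k3). exists (1 + - INR (phi k)). split.
      + assert (INR k3 <= INR (phi k)); [|lra]. apply le_INR. pose proof (increasing_index_ge phi k Hphi). lia.
      + intros e He. apply (proj2 (Hk2 k ltac:(lia) e)) in He.
        pose proof (lsol_variation y' Z 0 1 Hy' HZ HZ0 ltac:(lra) e e0 He He0). lia. }
  destruct Hplus as [t1 [Ht1 Hq1]]. destruct Hminus as [t2 [Ht2 Hp2]].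
  assert (Ez : z t0 0%nat = 0) by (unfold z, vadd, vscal, c; field; exact Hst0).
  (* At [t0] the first sign is free: the pattern with more changes is compared with the past, the
     one with fewer with the future. *)
  destruct (compat_flip_first n (z t0) Hn Ez) as [e1 [e2 [He1 [He2 Hch]]]].
  pose proof (compat_sign_pattern n (z t1)) as Hc1. pose proof (compat_sign_pattern n (z t2)) as Hc2.
  pose proof (lsol_variation y z t0 t1 Hy Hz (Hznz t0) Ht1 _ _ Hc1 He1).
  pose proof (lsol_variation y z t2 t0 Hy Hz (Hznz t2) Ht2 _ _ He2 Hc2).
  specialize (Hq1 _ Hc1). specialize (Hp2 _ Hc2). lia.
Qed.

(** * Solutions with prescribed zeros *)

Lemma Vu_fixed (y : point) (v : vec) : Y y -> Vu n Q y v -> inRn n v /\ Q y v = v.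
Proof. intros Hy [v' [Hv ->]]. split; [apply Q_inRn; assumption|apply Q_idem; assumption]. Qed.

(** [N - 1] linear conditions at time [tau] on an [N]-dimensional space of solutions leave a
    nontrivial one. *)
Lemma unstable_with_leading_zeros (y : point) (N : nat) (tau : R) :
  Y y -> is_dim n (Vu n Q y) N -> (1 <= N)%nat ->
  exists U, unstable y U /\ U 0 <> vzero /\ forall i, (i < N - 1)%nat -> U tau i = 0.
Proof.
  intros Hy [b [Hb [Hind _]]] HN.
  destruct (homogeneous_solution (N - 1) N (fun i k => Phi tau y (b k) i) ltac:(lia)) as [c [[j [Hj Hc]] Hsol]].
  assert (Hbk : forall k, (k < N)%nat -> inRn n (b k) /\ Q y (b k) = b k)
    by (intros k Hk; apply Vu_fixed; auto).
  assert (E0 : lincomb (fun k => Phi 0 y (b k)) c N = lincomb b c N).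
  { extensionality i. unfold lincomb. apply rsum_ext. intros k Hk.
    rewrite (proj2 (Phi_lsol y (b k) Hy (proj1 (Hbk k Hk)))). reflexivity. }
  exists (fun t => lincomb (fun k => Phi t y (b k)) c N). split; [split|split].
  - apply (lsol_lincomb y (fun k t => Phi t y (b k))). intros k Hk. apply Phi_lsol; [exact Hy|apply Hbk; exact Hk].
  - rewrite E0. rewrite (proj2 (Q_lincomb y b c N Hy (fun k Hk => proj1 (Hbk k Hk)))).
    extensionality i. unfold lincomb. apply rsum_ext. intros k Hk. rewrite (proj2 (Hbk k Hk)). reflexivity.
  - rewrite E0. intros E. apply Hc, (Hind c); [|exact Hj]. intros i _. rewrite E. reflexivity.
  - intros i Hi. rewrite <- (Hsol i Hi). unfold lincomb. apply rsum_ext. intros; ring.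
Qed.

(** The solutions equal to the first [N + 1] unit vectors at time [tau] have [Q]-components at time
    0 in an [N]-dimensional space, so a nontrivial combination is annihilated by [Q]. *)
Lemma stable_with_trailing_zeros (y : point) (N : nat) (tau : R) :
  Y y -> is_dim n (Vu n Q y) N -> (N < n)%nat ->
  exists S, stable y S /\ S 0 <> vzero /\ forall i, (N < i)%nat -> (i < n)%nat -> S tau i = 0.
Proof.
  intros Hy [b [_ [_ Hspan]]] HN.
  set (e := fun j i => if Nat.eqb j i then 1 else 0 : R).
  assert (He : forall j, (j < n)%nat -> inRn n (e j)).
  { intros j Hj i Hi. unfold e. destruct (Nat.eqb_spec j i); [lia|reflexivity]. }
  set (x := fun j t => Phi (t - tau) (Pi xf y tau) (e j)).
  assert (Hx : forall j, (j < n)%nat -> lsol y (x j) /\ x j tau = e j).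
  { intros j Hj. destruct (Phi_lsol (Pi xf y tau) (e j) (HYinv y tau Hy) (He j Hj)) as [H1 H2]. split.
    - apply (lsol_Pi_inv y (fun t => Phi t (Pi xf y tau) (e j))); assumption.
    - unfold x. rewrite Rminus_diag. exact H2. }
  assert (Ha : forall j, exists a, (j < n)%nat -> Q y (x j 0) = lincomb b a N).
  { intros j. destruct (le_lt_dec n j) as [Hj|Hj]; [exists (fun _ => 0); intros; lia|].
    destruct (Hspan (Q y (x j 0))) as [a Ea].
    - exists (x j 0). split; [apply (Hx j Hj)|reflexivity].
    - exists a. intros _. exact Ea. }
  set (a := fun j => proj1_sig (constructive_indefinite_description _ (Ha j))).
  assert (Ea : forall j, (j < n)%nat -> Q y (x j 0) = lincomb b (a j) N).
  { intros j. exact (proj2_sig (constructive_indefinite_description _ (Ha j))). }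
  destruct (homogeneous_solution N (N + 1) (fun k j => a j k) ltac:(lia)) as [c [[j [Hj Hc]] Hsol]].
  set (S := fun t => lincomb (fun j => x j t) c (N + 1)).
  assert (HS : lsol y S) by (apply (lsol_lincomb y x); intros k Hk; apply Hx; lia).
  assert (HStau : forall i, S tau i = rsum (N + 1) (fun j => c j * (if Nat.eqb j i then 1 else 0))).
  { intros i. unfold S, lincomb. apply rsum_ext. intros k Hk. rewrite (proj2 (Hx k ltac:(lia))). reflexivity. }
  exists S. split; [split; [exact HS|]|split].
  - unfold S. rewrite (proj2 (Q_lincomb y (fun j => x j 0) c (N + 1) Hy (fun k Hk => proj1 (proj1 (Hx k ltac:(lia))) 0))).
    extensionality i. unfold lincomb at 1.
    rewrite (rsum_ext (N + 1) _ (fun j => rsum N (fun k => c j * (a j k * b k i)))).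
    + rewrite rsum_swap. apply rsum_zero. intros k Hk.
      rewrite (rsum_ext (N + 1) _ (fun j => b k i * (a j k * c j))) by (intros; ring).
      rewrite rsum_scal, (Hsol k Hk). ring.
    + intros j' Hj'. rewrite Ea by lia. unfold lincomb. rewrite rsum_scal. reflexivity.
  - intros E. pose proof (lsol_zero y S 0 tau Hy HS E) as Et.
    apply (f_equal (fun v => v j)) in Et. rewrite HStau, rsum_delta in Et by exact Hj. contradiction.
  - intros i Hi Hin. rewrite HStau. apply rsum_zero. intros k Hk.
    destruct (Nat.eqb_spec k i); [lia|ring].
Qed.

(** * Differences of nonlinear solutions *)

Definition gap (y : point) (u : R -> vec) (t : R) : vec := vsub (u t) (orbit y t).

Lemma gap_derivative (y : point) (u : R -> vec) (P : R -> Prop) (t : R) (i : nat) :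
  Y y -> is_traj (snd y) u P -> P t ->
  derivable_pt_lim (fun s => gap y u s i) t (snd y t (u t) i - snd y t (orbit y t) i).
Proof.
  intros Hy Hu Ht. apply (derivable_pt_lim_minus (fun s => u s i) (fun s => orbit y s i));
    [apply Hu; exact Ht|apply (orbit_traj y Hy t I i)].
Qed.

(** The bound [M] is fixed before the interval, since the gap stays in one box on all of [P]. *)
Lemma gap_tri_system (y : point) (u : R -> vec) (P : R -> Prop) (B : R) :
  Y y -> is_traj (snd y) u P -> (forall t, P t -> cb n B (gap y u t)) ->
  exists M, 0 <= M /\ forall a b, (forall t, a <= t <= b -> P t) -> tri_system n M eps0 (gap y u) a b.
Proof.
  intros Hy Hu HB. destruct base_bounded as [r [Hr Hb]].
  set (r' := r + Rabs B). pose proof (Rabs_pos B) as HBp.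
  destruct (hull_jac_bound n f Hadm (3 * r')) as [M [HM HMb]].
  exists M. split; [exact HM|]. intros a b HP t Ht i Hi. specialize (HP t Ht).
  pose proof (orbit_cb r y t Hb Hy) as Hx.
  destruct (difference_rows (snd y) t r' M (u t) (orbit y t) i (base_hull y Hy) Hi) as [A [H1 [H2 [H3 [_ E]]]]]; auto.
  - intros l Hl. specialize (Hx l Hl). specialize (HB t HP l Hl). unfold gap, vsub in HB. pose proof (Rle_abs B).
    unfold r'. replace (u t l) with ((u t l - orbit y t l) + orbit y t l) by ring.
    eapply Rle_trans; [apply Rabs_triang|]. lra.
  - intros l Hl. specialize (Hx l Hl). unfold r'. lra.
  - exists A. repeat split; auto. pose proof (gap_derivative y u P t i Hy Hu HP) as Hd. rewrite E in Hd. exact Hd.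
Qed.

Lemma tri_system_nonzero (M : R) (w : R -> vec) (a b s : R) :
  0 <= M -> tri_system n M eps0 w a b -> a <= s <= b -> (exists i, (i < n)%nat /\ w s i <> 0) ->
  nonzero_on n w a b.
Proof.
  intros HM Hw Hs [i0 [Hi0 Hx]] t Ht. apply NNPP; intros Hno. apply Hx.
  apply (gronwall_zero n M w a b t); auto.
  - intros z Hz i Hi. destruct (Hw z Hz i Hi) as [A [HA [_ [_ Hd]]]]. eexists. split; [exact Hd|].
    rewrite Rplus_0_r. apply rsum_row_bound; exact HA.
  - intros j Hj. apply NNPP; intros Hc. apply Hno. exists j; auto.
Qed.

(** As the gap tends to zero, the intermediate points of the mean value rows collapse onto the orbit
    and the rows approach the linearization. The factor [c k] is harmless because the equation is
    linear. *)
Lemma gap_asymptotic (y : point) (u : R -> vec) (P : R -> Prop) (tk : nat -> R) (c : nat -> R) :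
  Y y -> is_traj (snd y) u P ->
  (forall T eta, 0 < eta -> exists k0, forall k, (k0 <= k)%nat -> forall t, Rabs t <= T ->
     P (t + tk k) /\ cb n eta (gap y u (t + tk k))) ->
  asymptotic_lsol (fun k => Pi xf y (tk k)) (fun k t => vscal (c k) (gap y u (t + tk k))).
Proof.
  intros Hy Hu Hsm T eta He. destruct base_bounded as [r [Hr Hb]].
  destruct (hull_jac_bound n f Hadm (3 * (r + 1))) as [M [HM HMb]].
  destruct (hull_jac_modulus n f Hadm (3 * (r + 1)) eta He) as [d [Hd Hmod]].
  destruct (Hsm T d ltac:(tauto)) as [k0 Hk0]. exists k0. intros k Hk t Ht i Hi.
  destruct (Hk0 k Hk t Ht) as [HP Hgap].
  pose proof (orbit_cb r y (t + tk k) Hb Hy) as Hx.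
  destruct (difference_rows (snd y) (t + tk k) (r + 1) M (u (t + tk k)) (orbit y (t + tk k)) i (base_hull y Hy) Hi)
    as [A [_ [_ [_ [H4 E]]]]]; auto.
  - intros l Hl. specialize (Hx l Hl). specialize (Hgap l Hl). unfold gap, vsub in Hgap.
    replace (u (t + tk k) l) with ((u (t + tk k) l - orbit y (t + tk k) l) + orbit y (t + tk k) l) by ring.
    eapply Rle_trans; [apply Rabs_triang|]. lra.
  - intros l Hl. specialize (Hx l Hl). lra.
  - exists A. split.
    + intros j Hj. rewrite coef_Pi by assumption. apply (H4 eta d); auto. apply Hmod, base_hull; exact Hy.
    + unfold vscal.
      replace (rsum n (fun j => A j * (c k * gap y u (t + tk k) j)))
        with (c k * (snd y (t + tk k) (u (t + tk k)) i - snd y (t + tk k) (orbit y (t + tk k)) i)).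
      * apply (derivable_pt_lim_scal (fun s => gap y u (s + tk k) i)).
        apply (derivable_pt_lim_shift (fun s => gap y u s i)). apply (gap_derivative y u P); assumption.
      * rewrite E, <- rsum_scal. apply rsum_ext. intros j _. unfold gap, vsub. ring.
Qed.

Lemma gap_cb (x : vec) (B : R) : vnorm n x <= B -> cb n B x.
Proof. intros H i Hi. eapply Rle_trans; [apply coord_le_vnorm; exact Hi|exact H]. Qed.

Lemma asymptotic_lsol_normalized (y : point) (tk : nat -> R) (Uk : nat -> R -> vec) (c : nat -> R) :
  Y y -> (forall k, lsol y (Uk k)) ->
  asymptotic_lsol (fun k => Pi xf y (tk k)) (fun k t => vscal (c k) (Uk k (t + tk k))).
Proof.
  intros Hy HU T eta He. exists 0%nat. intros k _. apply lsol_almost; [lra|].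
  apply (lsol_scal _ (fun t => Uk k (t + tk k))), lsol_Pi; auto.
Qed.

Lemma vnorm_normalized (x : vec) : 0 < vnorm n x -> vnorm n (vscal (/ vnorm n x) x) = 1.
Proof.
  intros H. rewrite vnorm_scal, Rabs_right; [apply Rinv_l; lra|]. left. apply Rinv_0_lt_compat; exact H.
Qed.

Lemma lsol_vnorm_pos (y : point) (z : R -> vec) (t : R) : Y y -> lsol y z -> z 0 <> vzero -> 0 < vnorm n (z t).
Proof.
  intros Hy Hz H0. destruct (nonzero_ex (z t) (proj1 Hz t) (lsol_nonzero y z 0 Hy Hz H0 t)) as [i [Hi Hx]].
  apply (vnorm_pos n (z t) i Hi Hx).
Qed.

(** * Sign changes on the local stable and unstable manifolds *)

Variables (hs hu : point -> vec -> vec) (delta C C0 : R).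
Hypothesis HWs : stable_mfds n Y xf Q hs delta C C0 alpha.
Hypothesis HWu : unstable_mfds n Y xf Q hu delta C C0 alpha.

Lemma exp_le_1 (x : R) : x <= 0 -> exp x <= 1.
Proof.
  intros H. rewrite <- exp_0. destruct (Req_dec x 0) as [-> |ne]; [lra|]. apply Rlt_le, exp_increasing. lra.
Qed.

Lemma exp_bound_le (c x N : R) : x <= 0 -> 0 <= N -> c * exp x * N <= Rabs c * N.
Proof.
  intros Hx HN. apply Rmult_le_compat_r; [exact HN|]. pose proof (exp_le_1 x Hx). pose proof (exp_pos x).
  pose proof (Rle_abs c). pose proof (Rabs_pos c). nra.
Qed.

Lemma exp_eventually_small (B eta : R) : 0 < eta -> exists t1, forall t, t1 <= t -> B * exp (- (alpha / 2) * t) < eta.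
Proof.
  intros He. pose proof alpha_pos as Hal. pose proof (Rabs_pos B) as HBp.
  exists (2 * Rabs B / (alpha * eta)). intros t Ht.
  assert (H0 : 0 <= 2 * Rabs B / (alpha * eta)).
  { apply Rmult_le_pos; [lra|]. left. apply Rinv_0_lt_compat. nra. }
  assert (Hb : Rabs B <= eta * (alpha / 2 * t)).
  { replace (Rabs B) with (eta * (alpha / 2 * (2 * Rabs B / (alpha * eta)))) by (field; split; lra).
    apply Rmult_le_compat_l; [lra|]. apply Rmult_le_compat_l; lra. }
  pose proof (exp_ineq1_le (alpha / 2 * t)) as Hexp.
  replace (- (alpha / 2) * t) with (- (alpha / 2 * t)) by ring. rewrite exp_Ropp.
  pose proof (exp_pos (alpha / 2 * t)) as Hp.
  apply Rmult_lt_reg_r with (exp (alpha / 2 * t)); [exact Hp|].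
  rewrite Rmult_assoc, Rinv_l, Rmult_1_r by lra. pose proof (Rle_abs B). nra.
Qed.

(* Overflowing invariance lets the decay estimate be restarted at a later time [s]; by uniqueness the
   restarted trajectory is the old one. *)
Lemma restart_stable (y : point) (u : R -> vec) (B s t : R) :
  Y y -> is_traj (snd y) u (fun t => 0 <= t) -> (forall t, 0 <= t -> cb n B (gap y u t)) ->
  0 <= s -> Ws n Q hs delta (Pi xf y s) (gap y u s) -> 0 <= t ->
  vnorm n (gap y u (t + s)) <= Rabs C * vnorm n (gap y u s).
Proof.
  intros Hy Hu HB Hs HW Ht. destruct base_bounded as [r [Hr Hb]]. pose proof (HYinv y s Hy) as Hys.
  destruct HWs as [_ [_ H]]. destruct (H _ Hys) as [_ [T HT]].
  destruct (HT _ HW) as [u' [Hu0 [Htr [Hdec _]]]]. clear H HT. pose proof alpha_pos as Hal.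
  assert (Hdec' : forall z, 0 <= z -> vnorm n (vsub (u' z) (orbit y (z + s))) <= Rabs C * vnorm n (gap y u s)).
  { intros z Hz. rewrite <- orbit_Pi by exact Hy. eapply Rle_trans; [apply (Hdec z Hz)|].
    apply exp_bound_le; [nra|apply vnorm_nonneg]. }
  set (B' := Rabs C * vnorm n (gap y u s)) in *.
  assert (HB'0 : 0 <= B') by (apply Rmult_le_pos; [apply Rabs_pos|apply vnorm_nonneg]).
  assert (Heq : forall i, (i < n)%nat -> u' t i = u (t + s) i).
  { apply (traj_unique (shift (snd y) s) u' (fun z => u (z + s)) 0 t 0 (r + Rabs B + B')); try lra.
    - apply (base_hull (Pi xf y s)). exact Hys.
    - intros z Hz i. apply Htr. lra.
    - intros z Hz i. apply (derivable_pt_lim_shift (fun z => u z i)). apply Hu. lra.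
    - intros z Hz l Hl. pose proof (gap_cb _ _ (Hdec' z ltac:(lra)) l Hl) as H1. unfold vsub in H1.
      pose proof (orbit_cb r y (z + s) Hb Hy l Hl) as H2. pose proof (Rabs_pos B).
      replace (u' z l) with ((u' z l - orbit y (z + s) l) + orbit y (z + s) l) by ring.
      eapply Rle_trans; [apply Rabs_triang|]. lra.
    - intros z Hz l Hl. pose proof (HB (z + s) ltac:(lra) l Hl) as H1. unfold gap, vsub in H1.
      pose proof (orbit_cb r y (z + s) Hb Hy l Hl) as H2. pose proof (Rle_abs B).
      replace (u (z + s) l) with ((u (z + s) l - orbit y (z + s) l) + orbit y (z + s) l) by ring.
      eapply Rle_trans; [apply Rabs_triang|]. lra.
    - intros i _. rewrite Hu0, Rplus_0_l. unfold vadd, gap, vsub. simpl. unfold orbit. ring. }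
  rewrite (vnorm_ext n (gap y u (t + s)) (vsub (u' t) (orbit y (t + s)))); [apply Hdec'; exact Ht|].
  intros i Hi. unfold gap, vsub. rewrite Heq by exact Hi. reflexivity.
Qed.

(** Backward-time counterpart of [restart_stable]: the new start lies in the past and the two
    trajectories are compared on [[t, 0]]. *)
Lemma restart_unstable (y : point) (u : R -> vec) (B s t : R) :
  Y y -> is_traj (snd y) u (fun t => t <= 0) -> (forall t, t <= 0 -> cb n B (gap y u t)) ->
  s <= 0 -> Wu n Q hu delta (Pi xf y s) (gap y u s) -> t <= 0 ->
  vnorm n (gap y u (t + s)) <= Rabs C * vnorm n (gap y u s).
Proof.
  intros Hy Hu HB Hs HW Ht. destruct base_bounded as [r [Hr Hb]]. pose proof (HYinv y s Hy) as Hys.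
  destruct HWu as [_ [_ H]]. destruct (H _ Hys) as [_ [T HT]].
  destruct (HT _ HW) as [u' [Hu0 [Htr [Hdec _]]]]. clear H HT. pose proof alpha_pos as Hal.
  assert (Hdec' : forall z, z <= 0 -> vnorm n (vsub (u' z) (orbit y (z + s))) <= Rabs C * vnorm n (gap y u s)).
  { intros z Hz. rewrite <- orbit_Pi by exact Hy. eapply Rle_trans; [apply (Hdec z Hz)|].
    apply exp_bound_le; [nra|apply vnorm_nonneg]. }
  set (B' := Rabs C * vnorm n (gap y u s)) in *.
  assert (HB'0 : 0 <= B') by (apply Rmult_le_pos; [apply Rabs_pos|apply vnorm_nonneg]).
  assert (Heq : forall i, (i < n)%nat -> u' t i = u (t + s) i).
  { apply (traj_unique (shift (snd y) s) u' (fun z => u (z + s)) t 0 0 (r + Rabs B + B')); try lra.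
    - apply (base_hull (Pi xf y s)). exact Hys.
    - intros z Hz i. apply Htr. lra.
    - intros z Hz i. apply (derivable_pt_lim_shift (fun z => u z i)). apply Hu. lra.
    - intros z Hz l Hl. pose proof (gap_cb _ _ (Hdec' z ltac:(lra)) l Hl) as H1. unfold vsub in H1.
      pose proof (orbit_cb r y (z + s) Hb Hy l Hl) as H2. pose proof (Rabs_pos B).
      replace (u' z l) with ((u' z l - orbit y (z + s) l) + orbit y (z + s) l) by ring.
      eapply Rle_trans; [apply Rabs_triang|]. lra.
    - intros z Hz l Hl. pose proof (HB (z + s) ltac:(lra) l Hl) as H1. unfold gap, vsub in H1.
      pose proof (orbit_cb r y (z + s) Hb Hy l Hl) as H2. pose proof (Rle_abs B).
      replace (u (z + s) l) with ((u (z + s) l - orbit y (z + s) l) + orbit y (z + s) l) by ring.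
      eapply Rle_trans; [apply Rabs_triang|]. lra.
    - intros i _. rewrite Hu0, Rplus_0_l. unfold vadd, gap, vsub. simpl. unfold orbit. ring. }
  rewrite (vnorm_ext n (gap y u (t + s)) (vsub (u' t) (orbit y (t + s)))); [apply Hdec'; exact Ht|].
  intros i Hi. unfold gap, vsub. rewrite Heq by exact Hi. reflexivity.
Qed.

Lemma changes_upto_limit (xk : nat -> vec) (x : vec) (p : nat) : vcv n xk x ->
  (exists k0, forall k, (k0 <= k)%nat -> changes_upto (xk k) p) -> changes_upto x p.
Proof.
  intros Hc [k0 H]. destruct (compat_limit n xk x Hc) as [k1 Hk1].
  destruct (H (Nat.max k0 k1) ltac:(lia)) as [e [He Hp]]. exists e. split; [|exact Hp].
  apply (Hk1 (Nat.max k0 k1) ltac:(lia)); exact He.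
Qed.

Lemma changes_from_limit (xk : nat -> vec) (x : vec) (q : nat) : vcv n xk x ->
  (exists k0, forall k, (k0 <= k)%nat -> changes_from (xk k) q) -> changes_from x q.
Proof.
  intros Hc [k0 H]. destruct (compat_limit n xk x Hc) as [k1 Hk1].
  destruct (H (Nat.max k0 k1) ltac:(lia)) as [e [He Hp]]. exists e. split; [|exact Hp].
  apply (Hk1 (Nat.max k0 k1) ltac:(lia)); exact He.
Qed.

Lemma vcv_vnorm_le (xk : nat -> vec) (x : vec) (B : R) : vcv n xk x ->
  (exists k0, forall k, (k0 <= k)%nat -> vnorm n (xk k) <= B) -> vnorm n x <= B.
Proof.
  intros Hc [k0 H]. apply Un_cv_le with (fun k => vnorm n (xk (k + k0)%nat)).
  - apply (vcv_vnorm n (fun k => xk (k + k0)%nat)). intros i Hi.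
    apply (Un_cv_subseq (fun k => xk k i) (x i) (fun k => (k + k0)%nat)); [intros k; lia|apply Hc; exact Hi].
  - intros k. apply H. lia.
Qed.

Lemma vscal_vnorm_le (x z : vec) (B : R) : 0 < vnorm n x -> vnorm n z <= B * vnorm n x ->
  vnorm n (vscal (/ vnorm n x) z) <= B.
Proof.
  intros Hx Hz. rewrite vnorm_scal, Rabs_right by (left; apply Rinv_0_lt_compat; exact Hx).
  apply Rmult_le_reg_l with (vnorm n x); [exact Hx|].
  rewrite <- Rmult_assoc, Rinv_r by lra. lra.
Qed.

Lemma stable_manifold_changes (y : point) (N : nat) (xs : vec) :
  Y y -> is_dim n (Vu n Q y) N -> Ms n Q hs delta y xs -> Lambda n (vsub xs (fst y)) ->
  (N <= sigma_lap n (vsub xs (fst y)))%nat.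
Proof.
  intros Hy Hdim [z [Hz Exs]] HL.
  assert (Ez : vsub xs (fst y) = z) by (rewrite Exs; extensionality i; unfold vsub, vadd; ring).
  rewrite Ez in *. clear xs Exs Ez.
  destruct (Nat.eq_dec N 0) as [-> |HN0]; [lia|].
  destruct HWs as [_ [_ H]]. destruct (H y Hy) as [_ [T HT]]. clear H.
  destruct (HT z Hz) as [u [Hu0 [Htr [Hdec Hover]]]]. clear HT. pose proof alpha_pos as Hal.
  assert (Ew0 : forall i, gap y u 0 i = z i).
  { intros i. unfold gap, vsub. rewrite Hu0, orbit_0 by exact Hy. unfold vadd. ring. }
  set (B := Rabs C * vnorm n z).
  assert (HB : forall t, 0 <= t -> cb n B (gap y u t)).
  { intros t Ht. apply gap_cb. eapply Rle_trans; [apply (Hdec t Ht)|].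
    apply exp_bound_le; [nra|apply vnorm_nonneg]. }
  destruct (gap_tri_system y u _ B Hy Htr HB) as [M [HM Hsys]].
  assert (Hnz : forall b, 0 <= b -> nonzero_on n (gap y u) 0 b).
  { intros b Hb. apply (tri_system_nonzero M (gap y u) 0 b 0 HM); [apply Hsys; intros; lra|lra|].
    exists 0%nat. split; [lia|]. rewrite Ew0. apply HL. }
  assert (Hwp : forall t, 0 <= t -> 0 < vnorm n (gap y u t)).
  { intros t Ht. destruct (Hnz t Ht t ltac:(lra)) as [i [Hi Hx]]. apply (vnorm_pos n _ i Hi Hx). }
  set (p := sigma_lap n z).
  assert (Hwch : forall t, 0 < t -> changes_upto (gap y u t) p).
  { intros t Ht. exists (sign_pattern (gap y u t)). split; [apply compat_sign_pattern|].
    unfold p. rewrite <- (changes_Lambda n z (sign_pattern z) Hn HL (compat_sign_pattern n z)).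
    apply (variation_diminishing n M eps0 (gap y u) 0 t eps0_pos Ht).
    - apply Hsys. intros; lra.
    - apply Hnz. lra.
    - apply compat_sign_pattern.
    - apply (compat_ext n _ z); [intros; symmetry; apply Ew0|apply compat_sign_pattern]. }
  (* From [T] on, overflowing invariance places the gap in the local manifold. The zeros of [Uk k]
     are imposed a further [INR k] later, so that they lie in the future of every fixed time of the
     limit. *)
  set (tk := fun k => Rmax T 0 + INR k).
  assert (Htk : forall k, T <= tk k /\ INR k <= tk k).
  { intros k. unfold tk. pose proof (Rmax_l T 0); pose proof (Rmax_r T 0). pose proof (pos_INR k). lra. }
  assert (Htk0 : forall k, 0 <= tk k) by (intros k; pose proof (Htk k); pose proof (pos_INR k); lra).
  assert (HU : forall k, exists U, unstable y U /\ U 0 <> vzero /\ forall i, (i < N - 1)%nat -> U (tk k + INR k) i = 0).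
  { intros k. apply unstable_with_leading_zeros; auto. lia. }
  set (Uk := fun k => proj1_sig (constructive_indefinite_description _ (HU k))).
  assert (HUk : forall k, unstable y (Uk k) /\ Uk k 0 <> vzero /\ forall i, (i < N - 1)%nat -> Uk k (tk k + INR k) i = 0).
  { intros k. exact (proj2_sig (constructive_indefinite_description _ (HU k))). }
  set (Xk := fun k t => vscal (/ vnorm n (gap y u (tk k))) (gap y u (t + tk k))).
  set (Zk := fun k t => vscal (/ vnorm n (Uk k (tk k))) (Uk k (t + tk k))).
  assert (HUp : forall k t, 0 < vnorm n (Uk k t)).
  { intros k t. apply (lsol_vnorm_pos y); auto; apply HUk. }
  destruct (limit_lsol_pair (fun k => Pi xf y (tk k)) Xk Zk)
    as [phi [y' [X [Z [Hphi [Hy' [Hcv [HX [HZ [HX0 [HZ0 [HXl HZl]]]]]]]]]]]].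
  - intros k. apply HYinv; exact Hy.
  - intros k. unfold Xk. rewrite Rplus_0_l. apply vnorm_normalized, Hwp, Htk0.
  - intros k. unfold Zk. rewrite Rplus_0_l. apply vnorm_normalized, HUp.
  - apply (gap_asymptotic y u _ tk (fun k => / vnorm n (gap y u (tk k))) Hy Htr).
    intros T' eta He. destruct (exp_eventually_small (C * vnorm n z) eta He) as [t1 Ht1].
    destruct (INR_unbounded (T' + Rabs t1)) as [k0 Hk0]. exists k0. intros k Hk t Ht.
    assert (Hkk : INR k0 <= INR k) by (apply le_INR; exact Hk). destruct (Htk k) as [_ Hk2].
    assert (Hbig : Rabs t1 <= t + tk k) by (unfold Rabs in Ht at 1; destruct Rcase_abs in Ht; lra).
    pose proof (Rabs_pos t1). pose proof (Rle_abs t1). split; [lra|].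
    apply gap_cb. eapply Rle_trans; [apply (Hdec (t + tk k)); lra|].
    specialize (Ht1 (t + tk k) ltac:(lra)). lra.
  - apply asymptotic_lsol_normalized; [exact Hy|]. intros k. apply HUk.
  - assert (HXs : stable y' X).
    (* The restarted estimate is relative to the gap at [tk k], so the normalized gaps are bounded
       by [Rabs C] uniformly in [k]; decay measured from time 0 would not control this quotient. *)
    { apply (bounded_forward_stable y' X (Rabs C) Hy' HX). intros t Ht.
      apply (vcv_vnorm_le _ _ _ (HXl t)). exists 0%nat. intros k _. unfold Xk.
      apply vscal_vnorm_le; [apply Hwp, Htk0|].
      apply (restart_stable y u B); auto. apply Hover. apply Htk. }
    (* Over moving base points, being fixed by [Q] passes to the limit by [Q_cv]. *)
    assert (HZu : unstable y' Z).
    { split; [exact HZ|]. apply (inRn_ext n); [apply Q_inRn; [exact Hy'|apply HZ]|apply HZ|].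
      intros i Hi.
      assert (HZk : forall k, unstable (Pi xf y (tk k)) (fun t => Uk k (t + tk k)))
        by (intros k; apply unstable_Pi; [exact Hy|apply HUk]).
      assert (Hin : forall k, inRn n (Zk k 0)).
      { intros k j Hj. unfold Zk, vscal. rewrite (proj1 (proj1 (HZk k)) 0 j Hj). ring. }
      assert (Hfix : forall k, Q (Pi xf y (tk k)) (Zk k 0) = Zk k 0).
      { intros k. destruct (HZk k) as [H1 H2]. unfold Zk.
        replace (vscal (/ vnorm n (Uk k (tk k))) (Uk k (0 + tk k)))
          with (vadd (vscal (/ vnorm n (Uk k (tk k))) (Uk k (0 + tk k))) (vscal 0 (Uk k (0 + tk k))))
          by (extensionality j; unfold vadd, vscal; ring).
        rewrite Q_comb, H2; auto; apply H1. }
      pose proof (Q_cv _ _ _ _ (fun k => HYinv y (tk (phi k)) Hy) Hy' Hcv (fun k => Hin (phi k)) (proj1 HZ 0) (HZl 0) i Hi) as Hq.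
      apply (UL_sequence _ _ _ Hq).
      replace (fun k => Q (Pi xf y (tk (phi k))) (Zk (phi k) 0) i) with (fun k => Zk (phi k) 0 i)
        by (extensionality k; rewrite Hfix; reflexivity).
      apply HZl; exact Hi. }
    assert (Hgap : (N - 1 + 1 <= p)%nat); [|lia].
    apply (stable_unstable_gap y' X Z); auto.
    + intros t. apply (changes_upto_limit _ _ _ (HXl t)).
      destruct (INR_unbounded (- t)) as [k0 Hk0]. exists k0. intros k Hk.
      assert (INR k0 <= INR (phi k)) by (apply le_INR; pose proof (increasing_index_ge phi k Hphi); lia).
      destruct (Htk (phi k)). unfold Xk.
      apply changes_upto_scal; [|apply Hwch; lra].
      apply Rinv_neq_0_compat. specialize (Hwp (tk (phi k)) (Htk0 (phi k))). lra.
    + intros t. apply (changes_from_limit _ _ _ (HZl t)).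
      destruct (INR_unbounded t) as [k0 Hk0]. exists k0. intros k Hk.
      assert (INR k0 <= INR (phi k)) by (apply le_INR; pose proof (increasing_index_ge phi k Hphi); lia).
      (* For large [l], the time [t + tk l] precedes [tk l + INR l], where the leading zeros allow a
         pattern with at least [N - 1] changes; every pattern at the earlier time has at least as
         many. *)
      set (l := phi k) in *. destruct (HUk l) as [HUl [HU0 HUz]].
      destruct (compat_leading_zeros n (N - 1) (Uk l (tk l + INR l))) as [e [He Hch]].
      { pose proof (is_dim_le n _ N Hdim). lia. }
      { exact HUz. }
      exists (sign_pattern (Uk l (t + tk l))). split.
      * apply compat_scal; [apply Rinv_0_lt_compat, HUp|apply compat_sign_pattern].
      * eapply Nat.le_trans; [exact Hch|].
        apply (lsol_variation y (Uk l) (t + tk l) (tk l + INR l) Hy (proj1 HUl)); auto; [|lra|apply compat_sign_pattern].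
        apply (lsol_nonzero y (Uk l) 0 Hy (proj1 HUl) HU0).
Qed.

Lemma unstable_manifold_changes (y : point) (N : nat) (xu : vec) :
  Y y -> is_dim n (Vu n Q y) N -> Mu n Q hu delta y xu -> Lambda n (vsub xu (fst y)) ->
  (sigma_lap n (vsub xu (fst y)) + 1 <= N)%nat.
Proof.
  intros Hy Hdim [z [Hz Exu]] HL.
  assert (Ez : vsub xu (fst y) = z) by (rewrite Exu; extensionality i; unfold vsub, vadd; ring).
  rewrite Ez in *. clear xu Exu Ez.
  set (q := sigma_lap n z).
  assert (Eq : changes (n - 1) (sign_pattern z) = q)
    by (apply changes_Lambda; [exact Hn|exact HL|apply compat_sign_pattern]).
  (* A pattern has at most [n - 1] changes, which settles [n <= N]; otherwise there is room for the
     [N + 1] unit vectors. *)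
  destruct (le_lt_dec n N) as [HnN|HNn].
  { pose proof (changes_le (n - 1) (sign_pattern z)). lia. }
  destruct HWu as [_ [_ H]]. destruct (H y Hy) as [_ [T HT]]. clear H.
  destruct (HT z Hz) as [u [Hu0 [Htr [Hdec Hover]]]]. clear HT. pose proof alpha_pos as Hal.
  assert (Ew0 : forall i, gap y u 0 i = z i).
  { intros i. unfold gap, vsub. rewrite Hu0, orbit_0 by exact Hy. unfold vadd. ring. }
  set (B := Rabs C * vnorm n z).
  assert (HB : forall t, t <= 0 -> cb n B (gap y u t)).
  { intros t Ht. apply gap_cb. eapply Rle_trans; [apply (Hdec t Ht)|].
    apply exp_bound_le; [nra|apply vnorm_nonneg]. }
  destruct (gap_tri_system y u _ B Hy Htr HB) as [M [HM Hsys]].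
  assert (Hnz : forall a, a <= 0 -> nonzero_on n (gap y u) a 0).
  { intros a Ha. apply (tri_system_nonzero M (gap y u) a 0 0 HM); [apply Hsys; intros; lra|lra|].
    exists 0%nat. split; [lia|]. rewrite Ew0. apply HL. }
  assert (Hwp : forall t, t <= 0 -> 0 < vnorm n (gap y u t)).
  { intros t Ht. destruct (Hnz t Ht t ltac:(lra)) as [i [Hi Hx]]. apply (vnorm_pos n _ i Hi Hx). }
  assert (Hwch : forall t, t < 0 -> changes_from (gap y u t) q).
  { intros t Ht. exists (sign_pattern (gap y u t)). split; [apply compat_sign_pattern|].
    rewrite <- Eq.
    apply (variation_diminishing n M eps0 (gap y u) t 0 eps0_pos Ht).
    - apply Hsys. intros; lra.
    - apply Hnz. lra.
    - apply (compat_ext n _ z); [intros; symmetry; apply Ew0|apply compat_sign_pattern].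
    - apply compat_sign_pattern. }
  (* The trailing zeros of [Sk k] are imposed a further [INR k] earlier, hence before every fixed
     time of the limit. *)
  set (tk := fun k => - (Rmax T 0 + INR k)).
  assert (Htk : forall k, tk k <= - T /\ tk k <= - INR k).
  { intros k. unfold tk. pose proof (Rmax_l T 0); pose proof (Rmax_r T 0). pose proof (pos_INR k). lra. }
  assert (Htk0 : forall k, tk k <= 0) by (intros k; pose proof (Htk k); pose proof (pos_INR k); lra).
  assert (HS : forall k, exists S, stable y S /\ S 0 <> vzero /\
             forall i, (N < i)%nat -> (i < n)%nat -> S (tk k - INR k) i = 0).
  { intros k. apply stable_with_trailing_zeros; auto. }
  set (Sk := fun k => proj1_sig (constructive_indefinite_description _ (HS k))).
  assert (HSk : forall k, stable y (Sk k) /\ Sk k 0 <> vzero /\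
             forall i, (N < i)%nat -> (i < n)%nat -> Sk k (tk k - INR k) i = 0).
  { intros k. exact (proj2_sig (constructive_indefinite_description _ (HS k))). }
  set (Xk := fun k t => vscal (/ vnorm n (gap y u (tk k))) (gap y u (t + tk k))).
  set (Zk := fun k t => vscal (/ vnorm n (Sk k (tk k))) (Sk k (t + tk k))).
  assert (HSp : forall k t, 0 < vnorm n (Sk k t)).
  { intros k t. apply (lsol_vnorm_pos y); auto; apply HSk. }
  destruct (limit_lsol_pair (fun k => Pi xf y (tk k)) Xk Zk)
    as [phi [y' [X [Z [Hphi [Hy' [Hcv [HX [HZ [HX0 [HZ0 [HXl HZl]]]]]]]]]]]].
  - intros k. apply HYinv; exact Hy.
  - intros k. unfold Xk. rewrite Rplus_0_l. apply vnorm_normalized, Hwp, Htk0.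
  - intros k. unfold Zk. rewrite Rplus_0_l. apply vnorm_normalized, HSp.
  - apply (gap_asymptotic y u _ tk (fun k => / vnorm n (gap y u (tk k))) Hy Htr).
    intros T' eta He. destruct (exp_eventually_small (C * vnorm n z) eta He) as [t1 Ht1].
    destruct (INR_unbounded (T' + Rabs t1)) as [k0 Hk0]. exists k0. intros k Hk t Ht.
    assert (Hkk : INR k0 <= INR k) by (apply le_INR; exact Hk). destruct (Htk k) as [_ Hk2].
    assert (Hbig : t + tk k <= - Rabs t1) by (unfold Rabs in Ht at 1; destruct Rcase_abs in Ht; lra).
    pose proof (Rabs_pos t1). pose proof (Rle_abs t1). split; [lra|].
    apply gap_cb. eapply Rle_trans; [apply (Hdec (t + tk k)); lra|].
    specialize (Ht1 (- (t + tk k)) ltac:(lra)).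
    replace (- (alpha / 2) * - (t + tk k)) with (alpha / 2 * (t + tk k)) in Ht1 by ring. lra.
  - apply asymptotic_lsol_normalized; [exact Hy|]. intros k. apply HSk.
  - assert (HXu : unstable y' X).
    { apply (bounded_backward_unstable y' X (Rabs C) Hy' HX). intros t Ht.
      apply (vcv_vnorm_le _ _ _ (HXl t)). exists 0%nat. intros k _. unfold Xk.
      apply vscal_vnorm_le; [apply Hwp, Htk0|].
      apply (restart_unstable y u B); auto. apply Hover. apply Htk. }
    assert (HZs : stable y' Z).
    { split; [exact HZ|]. apply (inRn_ext n); [apply Q_inRn; [exact Hy'|apply HZ]|intros i _; reflexivity|].
      intros i Hi.
      assert (HZk : forall k, stable (Pi xf y (tk k)) (fun t => Sk k (t + tk k)))
        by (intros k; apply stable_Pi; [exact Hy|apply HSk]).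
      assert (Hin : forall k, inRn n (Zk k 0)).
      { intros k j Hj. unfold Zk, vscal. rewrite (proj1 (proj1 (HZk k)) 0 j Hj). ring. }
      assert (Hfix : forall k, Q (Pi xf y (tk k)) (Zk k 0) = vzero).
      { intros k. destruct (HZk k) as [H1 H2]. unfold Zk.
        replace (vscal (/ vnorm n (Sk k (tk k))) (Sk k (0 + tk k)))
          with (vadd (vscal (/ vnorm n (Sk k (tk k))) (Sk k (0 + tk k))) (vscal 0 (Sk k (0 + tk k))))
          by (extensionality j; unfold vadd, vscal; ring).
        rewrite Q_comb, H2; auto; try apply H1. extensionality j. unfold vadd, vscal, vzero. ring. }
      pose proof (Q_cv _ _ _ _ (fun k => HYinv y (tk (phi k)) Hy) Hy' Hcv (fun k => Hin (phi k)) (proj1 HZ 0) (HZl 0) i Hi) as Hq.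
      apply (UL_sequence _ _ _ Hq).
      replace (fun k => Q (Pi xf y (tk (phi k))) (Zk (phi k) 0) i) with (fun _ : nat => 0)
        by (extensionality k; rewrite Hfix; reflexivity).
      apply Un_cv_const. }
    (* The roles are exchanged: [Z], built by dimension counting, is the stable solution with at
       most [N] changes, and the rescaled trajectory [X] is the unstable one. *)
    apply (stable_unstable_gap y' Z X); auto.
    + intros t. apply (changes_upto_limit _ _ _ (HZl t)).
      destruct (INR_unbounded (- t)) as [k0 Hk0]. exists k0. intros k Hk.
      assert (INR k0 <= INR (phi k)) by (apply le_INR; pose proof (increasing_index_ge phi k Hphi); lia).
      set (l := phi k) in *. destruct (HSk l) as [HSl [HS0 HSz]].
      destruct (compat_trailing_zeros n N (Sk l (tk l - INR l)) HNn HSz) as [e [He Hch]].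
      exists (sign_pattern (Sk l (t + tk l))). split.
      * apply compat_scal; [apply Rinv_0_lt_compat, HSp|apply compat_sign_pattern].
      * eapply Nat.le_trans; [|exact Hch].
        apply (lsol_variation y (Sk l) (tk l - INR l) (t + tk l) Hy (proj1 HSl)); auto; [|lra|apply compat_sign_pattern].
        apply (lsol_nonzero y (Sk l) 0 Hy (proj1 HSl) HS0).
    + intros t. apply (changes_from_limit _ _ _ (HXl t)).
      destruct (INR_unbounded t) as [k0 Hk0]. exists k0. intros k Hk.
      assert (INR k0 <= INR (phi k)) by (apply le_INR; pose proof (increasing_index_ge phi k Hphi); lia).
      destruct (Htk (phi k)). destruct (Hwch (t + tk (phi k)) ltac:(lra)) as [e [He Hqe]].
      exists e. split; [|exact Hqe]. apply compat_scal; [|exact He].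
      apply Rinv_0_lt_compat, Hwp, Htk0.
Qed.

End Setting.

Theorem theorem4p9
  (n : nat) (f : vfield) (eps0 : R)
  (Hn : (2 <= n)%nat)
  (Hadm : C1_admissible n f) (Htri : tridiagonal n f)
  (Hcoop : strongly_cooperative n f eps0)
  (Y : point -> Prop) (xf : R -> vec -> vfield -> vec)
  (Phi : R -> point -> vec -> vec) (Q : point -> vec -> vec) (K alpha : R)
  (hs hu : point -> vec -> vec) (delta C C0 : R)
  (HYsp : in_space n f Y) (HYcpt : compact_set n Y) (HYconn : connected_set n Y)
  (Hflow : is_flow_on Y xf) (HYinv : invariant Y xf)
  (HPhi : is_fundamental n Y xf Phi)
  (Hhyp : exp_dichotomy n Y xf Phi Q K alpha)
  (HWs : stable_mfds n Y xf Q hs delta C C0 alpha)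
  (HWu : unstable_mfds n Y xf Q hu delta C C0 alpha) :
  forall y : point, Y y -> forall N : nat, is_dim n (Vu n Q y) N ->
    (forall xs, Ms n Q hs delta y xs -> xs <> fst y -> Lambda n (vsub xs (fst y)) ->
       (N <= sigma_lap n (vsub xs (fst y)))%nat) /\
    (forall xu, Mu n Q hu delta y xu -> xu <> fst y -> Lambda n (vsub xu (fst y)) ->
       (sigma_lap n (vsub xu (fst y)) + 1 <= N)%nat).
Proof.
  intros y Hy N Hdim. split.
  - intros xs Hxs _ HL. eapply stable_manifold_changes; eauto.
  - intros xu Hxu _ HL. eapply unstable_manifold_changes; eauto.
Qed.
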